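(* Let $p\ge 2$ be an integer, $\mathfrak q=e^{i\pi/p}$, $\xi\in\{1,-1\}$, and let $\mathbf U_{\mathrm a}$ and $\mathbf U_{\mathrm s}$ be the Hopf algebras over $\mathbb C$ (the double bosonizations of the ''asymmetric'' and ''symmetric'' rank-two Nichols algebras, with the same $p$ and $\xi$) defined by the explicit presentations in the context, with coproducts $\Delta_{\mathrm a},\Delta_{\mathrm s}$ and antipodes $S_{\mathrm a},S_{\mathrm s}$ respectively. Then: (1) $\mathbf U_{\mathrm a}$ and $\mathbf U_{\mathrm s}$ are isomorphic as associative algebras. Explicitly, an isomorphism $\widehat\sigma:\mathbf U_{\mathrm s}\to\mathbf U_{\mathrm a}$ is given by $$\widehat\sigma(F_1)=(\mathfrak q-\mathfrak q^{-1})(\xi BF-\mathfrak q^{-1}FB),\qquad \widehat\sigma(F_2)=-(\mathfrak q-\mathfrak q^{-1})\,C k^{-1},$$ $$\widehat\sigma(\phi_1)=EC-\xi\mathfrak q\,CE,\qquad \widehat\sigma(\phi_2)=Bk,$$ $$\widehat\sigma(K_1)=Kk,\qquad \widehat\sigma(K_2)=k^{-1},$$ and the inverse map is $$\widehat\sigma^{-1}(F)=-\frac{1}{(\mathfrak q-\mathfrak q^{-1})^2}(F_1F_2+\xi\mathfrak q\,F_2F_1),\qquad \widehat\sigma^{-1}(B)=\phi_2K_2,$$ $$\widehat\sigma^{-1}(C)=-\frac{1}{\mathfrak q-\mathfrak q^{-1}}F_2K_2^{-1},\qquad \widehat\sigma^{-1}(E)=-\mathfrak q^{-1}(\phi_1\phi_2+\xi\mathfrak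 q\,\phi_2\phi_1),$$ $$\widehat\sigma^{-1}(K)=K_1K_2,\qquad \widehat\sigma^{-1}(k)=K_2^{-1}.$$ (2) The two coalgebra structures are related by a similarity transformation: the element $$\Phi=1\otimes 1+(\mathfrak q-\mathfrak q^{-1})\,Bk\otimes Ck^{-1}\in\mathbf U_{\mathrm a}\otimes\mathbf U_{\mathrm a}$$ is invertible, satisfies an appropriate cocycle condition, and for all $x\in\mathbf U_{\mathrm s}$ $$\Phi^{-1}\,\Delta_{\mathrm a}(\widehat\sigma(x))\,\Phi=(\widehat\sigma\otimes\widehat\sigma)(\Delta_{\mathrm s}(x)).$$ Hence, in particular, the representation categories of $\mathbf U_{\mathrm a}$ and $\mathbf U_{\mathrm s}$ are equivalent as monoidal categories. (3) The antipodes are related as $$U\,S_{\mathrm a}(\widehat\sigma(x))\,U^{-1}=\widehat\sigma(S_{\mathrm s}(x))\qquad\text{for all }x\in\mathbf U_{\mathrm s},$$ with $U=1-(\mathfrak q-\mathfrak q^{-1})\,BCk\in\mathbf U_{\mathrm a}$.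
   Context: Throughout, $p\ge2$ is an integer, $\mathfrak q=e^{i\pi/p}$, $\xi\in\{1,-1\}$, and the base field is $\mathbb C$. All algebras are unital associative. The Hopf algebra $\mathbf U_{\mathrm a}$. It is generated by $B,F,C,E,k,K$ ($k,K$ invertible) with the relations: $$K^{2p}=1,\quad k^{2p}=1,\quad kK=Kk,$$ $$KF=\mathfrak q^{-2}FK,\quad KE=\mathfrak q^{2}EK,\quad EF-FE=\frac{K-K^{-1}}{\mathfrak q-\mathfrak q^{-1}},\quad F^p=0,\quad E^p=0,$$ $$kE=\xi\mathfrak q^{-1}Ek,\quad kF=\xi\mathfrak q\,Fk,$$ $$kB=-Bk,\quad KB=\xi\mathfrak q\,BK,\quad kC=-Ck,\quad KC=\xi\mathfrak q^{-1}CK,$$ $$B^2=0,\quad C^2=0,\quad BC-CB=\frac{k-k^{-1}}{\mathfrak q-\mathfrak q^{-1}},\quad FC-CF=0,\quad BE-EB=0,$$ $$FFB-\xi(\mathfrak q+\mathfrak q^{-1})FBF+BFF=0,\qquad EEC-\xi(\mathfrak q+\mathfrak q^{-1})ECE+CEE=0.$$ If $p=2$, the last two relations hold trivially (because $\mathfrak q+\mathfrak q^{-1}=0$ and $F^2=E^2=0$), and they are replaced by $$BFBF=FBFB,\qquad CECE=ECEC.$$ The coproduct $\Delta_{\mathrm a}$, antipode $S_{\mathrm a}$ and counit $\epsilon$ are given by $$\Delta_{\mathrm a}(F)=F\otimes1+K^{-1}\otimes F,\quad \Delta_{\mathrm a}(E)=E\otimes K+1\otimes E,$$ $$\Delta_{\mathrm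 a}(B)=B\otimes1+k^{-1}\otimes B,\quad \Delta_{\mathrm a}(C)=C\otimes k+1\otimes C,$$ $$S_{\mathrm a}(B)=-kB,\quad S_{\mathrm a}(F)=-KF,\quad S_{\mathrm a}(C)=-Ck^{-1},\quad S_{\mathrm a}(E)=-EK^{-1},$$ $$\epsilon(B)=\epsilon(F)=\epsilon(C)=\epsilon(E)=0,$$ with $k$ and $K$ group-like. The Hopf algebra $\mathbf U_{\mathrm s}$. It is generated by $F_1,F_2,\phi_1,\phi_2,K_1,K_2$ ($K_1,K_2$ invertible) with the relations: $$K_1^{2p}=1,\quad K_2^{2p}=1,\quad K_1K_2=K_2K_1,$$ $$F_1^2=0,\quad F_2^2=0,\quad (F_1F_2)^p-\xi^{-p}(F_2F_1)^p=0,$$ $$\phi_1^2=0,\quad \phi_2^2=0,\quad (\phi_1\phi_2)^p-\xi^{-p}(\phi_2\phi_1)^p=0,$$ $$K_1F_1K_1^{-1}=-F_1,\quad K_1F_2K_1^{-1}=-\xi\mathfrak q^{-1}F_2,\quad K_2F_1K_2^{-1}=-\xi\mathfrak q^{-1}F_1,\quad K_2F_2K_2^{-1}=-F_2,$$ $$K_1\phi_1K_1^{-1}=-\phi_1,\quad K_1\phi_2K_1^{-1}=-\xi\mathfrak q\,\phi_2,\quad K_2\phi_1K_2^{-1}=-\xi\mathfrak q\,\phi_1,\quad K_2\phi_2K_2^{-1}=-\phi_2,$$ $$F_1\phi_1-\phi_1F_1=K_1-K_1^{-1},\quad F_2\phi_2-\phi_2F_2=K_2-K_2^{-1},\quad F_1\phi_2-\phi_2F_1=0,\quad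 F_2\phi_1-\phi_1F_2=0.$$ The coproduct $\Delta_{\mathrm s}$, antipode $S_{\mathrm s}$ and counit $\epsilon$ are given, for $i=1,2$, by $$\Delta_{\mathrm s}(F_i)=F_i\otimes1+K_i^{-1}\otimes F_i,\quad \Delta_{\mathrm s}(\phi_i)=\phi_i\otimes K_i+1\otimes\phi_i,$$ $$S_{\mathrm s}(F_i)=-K_iF_i,\quad S_{\mathrm s}(\phi_i)=-\phi_iK_i^{-1},\quad \epsilon(F_i)=\epsilon(\phi_i)=0,$$ with $K_1$ and $K_2$ group-like.
   Formalization: In part (3) the sign in U is corrected: the formal statement uses U = 1 + (q − q^{-1}) BCk instead of U = 1 − (q − q^{-1}) BCk, since with the printed sign the antipode identity fails at x = φ_2 (it would force 2B = 2Bk^2). *)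

(* Defs.v *)
From HB Require Import structures.
From mathcomp Require Import all_boot all_order all_algebra.
From mathcomp Require Import finmap monalg.
From mathcomp Require Import mathcomp_extra boolp classical_sets reals trigo.
From mathcomp Require Import complex.

Set Implicit Arguments.
Unset Strict Implicit.
Unset Printing Implicit Defensive.

Import Order.TTheory GRing.Theory Num.Theory.
Local Open Scope ring_scope.
Local Open Scope quotient_scope.

Record submodule (K : pzRingType) (V : lmodType K) := Submodule {
  sm_pred : {pred V};
  sm0 : 0 \in sm_pred;
  smP : forall a, {in sm_pred &, forall u v, a *: u + v \in sm_pred} }.

Section LQuot.
Variables (K : pzRingType) (V : lmodType K) (S : submodule V).

Lemma smD u v : u \in sm_pred S -> v \in sm_pred S -> u + v \in sm_pred S.
Proof. by move=> hu hv; rewrite -[u]scale1r smP. Qed.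

Lemma smZ a u : u \in sm_pred S -> a *: u \in sm_pred S.
Proof. by move=> hu; rewrite -[_ *: _]addr0 smP // sm0. Qed.

Lemma sm_zmod : zmod_closed (sm_pred S).
Proof.
split; first exact: sm0.
by move=> u v hu hv; rewrite addrC -scaleN1r smP.
Qed.

HB.instance Definition _ := GRing.isZmodClosed.Build V (sm_pred S) sm_zmod.

Definition lquot : Type := Quotient.quot (sm_pred S).
HB.instance Definition _ := GRing.Zmodule.on lquot.
HB.instance Definition _ := EqQuotient.on lquot.

Definition lpi (x : V) : lquot := \pi_lquot x.

Lemma lpi_eq x y : lpi x = lpi y <-> x - y \in sm_pred S.
Proof.
rewrite /lpi; split=> [/eqP|h]; first by rewrite -Quotient.idealrBE.
by apply/eqP; rewrite -Quotient.idealrBE.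
Qed.

Lemma lpi_repr (x : lquot) : lpi (repr x) = x.
Proof. exact: reprK. Qed.

Lemma lpi_zmod : zmod_morphism lpi.
Proof. by move=> x y; rewrite /lpi !piE. Qed.

HB.instance Definition _ := GRing.isZmodMorphism.Build V lquot lpi lpi_zmod.

Definition lquot_scale (a : K) (x : lquot) : lquot := lpi (a *: repr x).

Lemma lpi_scale a x : lpi (a *: x) = lquot_scale a (lpi x).
Proof.
by apply/lpi_eq; rewrite -scalerBr; apply/smZ/lpi_eq; rewrite lpi_repr.
Qed.

Lemma lquot_ind (P : lquot -> Prop) : (forall x, P (lpi x)) -> forall x, P x.
Proof. by move=> h x; rewrite -[x]lpi_repr. Qed.

Fact lquot_scaleA a b v : lquot_scale a (lquot_scale b v) = lquot_scale (a * b) v.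
Proof. by elim/lquot_ind: v => v; rewrite -!lpi_scale scalerA. Qed.
Fact lquot_scale1 : left_id 1 lquot_scale.
Proof. by elim/lquot_ind=> v; rewrite -!lpi_scale scale1r. Qed.
Fact lquot_scaleDr : right_distributive lquot_scale +%R.
Proof.
move=> a; elim/lquot_ind=> u; elim/lquot_ind=> v.
by rewrite -raddfD -!lpi_scale scalerDr raddfD.
Qed.
Fact lquot_scaleDl v : {morph lquot_scale^~ v : a b / a + b}.
Proof.
by elim/lquot_ind: v => v a b /=; rewrite -!lpi_scale scalerDl raddfD.
Qed.

HB.instance Definition _ := GRing.Zmodule_isLmodule.Build K lquot
  lquot_scaleA lquot_scale1 lquot_scaleDr lquot_scaleDl.

Lemma lpiZ a x : lpi (a *: x) = a *: lpi x.
Proof. exact: lpi_scale. Qed.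

HB.instance Definition _ := GRing.isScalable.Build K V lquot *:%R lpi lpiZ.

End LQuot.

Section GenSubmodule.
Variables (K : pzRingType) (V : lmodType K) (G : V -> Prop).

(* the intersection of all submodules containing [G] *)
Definition span_pred : {pred V} := fun x =>
  `[< forall P : V -> Prop, P 0 ->
        (forall a u v, P u -> P v -> P (a *: u + v)) ->
        (forall g, G g -> P g) -> P x >].

Fact span0 : 0 \in span_pred.
Proof. by rewrite unfold_in; apply: asboolT => P. Qed.
Fact spanP a : {in span_pred &, forall u v, a *: u + v \in span_pred}.
Proof.
move=> u v; rewrite !unfold_in => /asboolW hu /asboolW hv.
apply: asboolT => P P0 PD PG.
by apply: (PD); [apply: (hu P P0 PD PG)|apply: (hv P P0 PD PG)].
Qed.
Definition span_submodule := Submodule span0 spanP.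

Lemma span_gen g : G g -> g \in sm_pred span_submodule.
Proof.
by move=> hg; rewrite unfold_in; apply: asboolT => P _ _; apply.
Qed.
End GenSubmodule.

Record ideal2 (K : pzRingType) (A : algType K) := Ideal2 {
  i2_sm : submodule A;
  i2_Ml : forall a x, x \in sm_pred i2_sm -> a * x \in sm_pred i2_sm;
  i2_Mr : forall a x, x \in sm_pred i2_sm -> x * a \in sm_pred i2_sm;
  i2_1 : 1 \notin sm_pred i2_sm }.

Section AQuot.
Variables (K : pzRingType) (A : algType K) (I : ideal2 A).

Definition aquot : Type := lquot (i2_sm I).
HB.instance Definition _ := GRing.Lmodule.on aquot.

Definition aquot_mul (x y : aquot) : aquot :=
  lpi (i2_sm I) (repr (x : lquot _) * repr (y : lquot _)).

Lemma aquot_mulE (x y : A) :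
  aquot_mul (lpi (i2_sm I) x) (lpi (i2_sm I) y) = lpi (i2_sm I) (x * y).
Proof.
have h (z : A) : repr (lpi (i2_sm I) z) - z \in sm_pred (i2_sm I).
  by apply/lpi_eq; rewrite lpi_repr.
apply/lpi_eq; set x' := repr _; set y' := repr _.
have -> : x' * y' - x * y = (x' - x) * y' + x * (y' - y).
  by rewrite mulrBl mulrBr addrA subrK.
by apply: smD; [apply: i2_Mr|apply: i2_Ml]; apply: h.
Qed.

Local Notation pi := (lpi (i2_sm I)).

Fact aquot_mulA : associative aquot_mul.
Proof.
elim/lquot_ind=> x; elim/lquot_ind=> y; elim/lquot_ind=> z.
by rewrite !aquot_mulE mulrA.
Qed.
Fact aquot_mul1r : left_id (pi 1 : aquot) aquot_mul.
Proof. by elim/lquot_ind=> x; rewrite aquot_mulE mul1r. Qed.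
Fact aquot_mulr1 : right_id (pi 1 : aquot) aquot_mul.
Proof. by elim/lquot_ind=> x; rewrite aquot_mulE mulr1. Qed.
Fact aquot_mulDl : left_distributive aquot_mul +%R.
Proof.
elim/lquot_ind=> x; elim/lquot_ind=> y; elim/lquot_ind=> z.
by rewrite -raddfD !aquot_mulE mulrDl raddfD.
Qed.
Fact aquot_mulDr : right_distributive aquot_mul +%R.
Proof.
elim/lquot_ind=> x; elim/lquot_ind=> y; elim/lquot_ind=> z.
by rewrite -raddfD !aquot_mulE mulrDr raddfD.
Qed.
Fact aquot_nz : (pi 1 : aquot) != 0.
Proof.
apply/eqP; rewrite -[0](raddf0 pi) => /lpi_eq; rewrite subr0.
by apply/negP; exact: i2_1.
Qed.

HB.instance Definition _ := GRing.Zmodule_isNzRing.Build aquot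
  aquot_mulA aquot_mul1r aquot_mulr1 aquot_mulDl aquot_mulDr aquot_nz.

Lemma aquotM (x y : A) : (pi x : aquot) * (pi y : aquot) = pi (x * y).
Proof. exact: aquot_mulE. Qed.
Lemma aquotZ a (x : A) : a *: (pi x : aquot) = pi (a *: x).
Proof. by rewrite lpiZ. Qed.

Fact aquot_scaleAl (a : K) (u v : aquot) : a *: (u * v) = (a *: u) * v.
Proof.
elim/lquot_ind: u => u; elim/lquot_ind: v => v.
by rewrite aquotZ !aquotM aquotZ scalerAl.
Qed.
HB.instance Definition _ := GRing.Lmodule_isLalgebra.Build K aquot aquot_scaleAl.
Fact aquot_scaleAr (a : K) (u v : aquot) : a *: (u * v) = u * (a *: v).
Proof.
elim/lquot_ind: u => u; elim/lquot_ind: v => v.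
by rewrite aquotZ !aquotM aquotZ scalerAr.
Qed.
HB.instance Definition _ := GRing.Lalgebra_isAlgebra.Build K aquot aquot_scaleAr.

Definition api (x : A) : aquot := pi x.
Fact api_linear : linear api.
Proof. by move=> a x y; apply: (linearP (lpi (i2_sm I))). Qed.
HB.instance Definition _ := GRing.isLinear.Build K A aquot _ api api_linear.
Fact api_monoid : monoid_morphism api.
Proof. by split=> // x y; rewrite /api -aquot_mulE. Qed.
HB.instance Definition _ := GRing.isMonoidMorphism.Build A aquot api api_monoid.

End AQuot.

Definition freeAlg (K : fieldType) (I : choiceType) : Type :=
  {malg K[{fmonom I}]}.

Section FreeAlg.
Variables (K : fieldType) (I : choiceType).
Local Notation F := (freeAlg K I).

HB.instance Definition _ := GRing.Lalgebra.on F.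

Lemma malg_mulC (g : {malg K[{fmonom I}]}) c : g * malgC c = c *: g.
Proof.
apply/malgP => k; rewrite malgM_def fgmulgU mcoeffZ.
rewrite [in RHS](monalgE g) raddf_sum [in RHS]raddf_sum /= mulr_sumr.
apply: eq_bigr => i _.
by rewrite mulm1 !mcoeffU mulrC mulrnAr.
Qed.

Fact free_scaleAr (c : K) (x y : F) : c *: (x * y) = x * (c *: y).
Proof. by rewrite -!malg_mulC mulrA. Qed.
HB.instance Definition _ := GRing.Lalgebra_isAlgebra.Build K F free_scaleAr.

Definition fvar (i : I) : F := mkmalgU (fmu i) 1.

Definition feval (A : algType K) (h : I -> A) (x : F) : A :=
  mmap (in_alg A) (fun m : {fmonom I} => \prod_(i <- (m : seq I)) h i) x.

End FreeAlg.

Section FreeEval.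
Variables (K : fieldType) (I : choiceType) (A : algType K) (h : I -> A).

Let hm (m : {fmonom I}) : A := \prod_(i <- (m : seq I)) h i.
Fact hm_morph : mmorphism hm.
Proof.
split=> [x y|]; rewrite /hm; last by rewrite fm1 big_nil.
by rewrite fmM big_cat.
Qed.
HB.instance Definition _ := isMultiplicative.Build {fmonom I} A hm hm_morph.

Lemma feval_linear : linear (feval h).
Proof.
move=> a x y; rewrite /feval -/hm raddfD /=; congr (_ + _).
by rewrite mmapZ /= mulr_algl.
Qed.
HB.instance Definition _ :=
  GRing.isLinear.Build K (freeAlg K I) A _ (feval h) feval_linear.

Lemma feval_monoid : monoid_morphism (feval h).
Proof.
have [] := @commr_mmap_is_multiplicative _ _ _ (in_alg A) hm.
  by move=> g m m'; rewrite /GRing.comm /= mulr_algl mulr_algr.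
by [].
Qed.
HB.instance Definition _ :=
  GRing.isMonoidMorphism.Build (freeAlg K I) A (feval h) feval_monoid.

Lemma feval_var i : feval h (fvar K i) = h i.
Proof. by rewrite /feval /fvar mmapU /= scale1r mul1r fmuE big_seq1. Qed.

End FreeEval.

Section GenIdeal.
Variables (K : fieldType) (A : algType K) (G : A -> Prop).

(* the intersection of all two-sided ideals containing [G] *)
Definition ideal_pred : {pred A} := fun x =>
  `[< forall P : A -> Prop, P 0 ->
        (forall a u v, P u -> P v -> P (a *: u + v)) ->
        (forall a u, P u -> P (a * u)) -> (forall a u, P u -> P (u * a)) ->
        (forall g, G g -> P g) -> P x >].

Fact ideal0 : 0 \in ideal_pred.
Proof. by rewrite unfold_in; apply: asboolT => P. Qed.
Fact idealP a : {in ideal_pred &, forall u v, a *: u + v \in ideal_pred}.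
Proof.
move=> u v; rewrite !unfold_in => /asboolW hu /asboolW hv.
apply: asboolT => P P0 PD Pl Pr PG; apply: (PD).
  exact: (hu P P0 PD Pl Pr PG).
exact: (hv P P0 PD Pl Pr PG).
Qed.
Definition ideal_submodule := Submodule ideal0 idealP.

Lemma ideal_Ml a x : x \in ideal_pred -> a * x \in ideal_pred.
Proof.
rewrite !unfold_in => /asboolW hx; apply: asboolT => P P0 PD Pl Pr PG.
by apply: (Pl); exact: (hx P P0 PD Pl Pr PG).
Qed.
Lemma ideal_Mr a x : x \in ideal_pred -> x * a \in ideal_pred.
Proof.
rewrite !unfold_in => /asboolW hx; apply: asboolT => P P0 PD Pl Pr PG.
by apply: (Pr); exact: (hx P P0 PD Pl Pr PG).
Qed.
Lemma ideal_gen g : G g -> g \in ideal_pred.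
Proof.
by move=> hg; rewrite unfold_in; apply: asboolT => P _ _ _ _; apply.
Qed.

Lemma ideal_kills (B : algType K) (f : {lrmorphism A -> B}) x :
  (forall g, G g -> f g = 0) -> x \in ideal_pred -> f x = 0.
Proof.
move=> hf; rewrite unfold_in => /asboolW /(_ (fun y => f y = 0)); apply => //.
- exact: raddf0.
- by move=> a u v fu fv; rewrite linearP /= fu fv scaler0 addr0.
- by move=> a u fu; rewrite rmorphM /= fu mulr0.
- by move=> a u fu; rewrite rmorphM /= fu mul0r.
Qed.

End GenIdeal.

(* Generators and relations; a relation is a pair (lhs, rhs). MathComp's
   [algType] excludes the zero algebra, so a presentation records that the
   relations hold for some choice of scalars. *)
Record presentation (K : fieldType) := Presentation {
  pgen : choiceType;
  prel : seq (freeAlg K pgen * freeAlg K pgen);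
  paug : exists h : pgen -> K^o,
    forall r, r \in prel -> feval h r.1 = feval h r.2 }.

Section Presented.
Variables (K : fieldType) (P : presentation K).

Definition prelators (x : freeAlg K (pgen P)) : Prop :=
  exists2 r, r \in prel P & x = r.1 - r.2.

Fact pres_proper : 1 \notin sm_pred (ideal_submodule prelators).
Proof.
case: (paug P) => h hh; apply/negP => h1.
suff : feval h 1 = 0 by rewrite rmorph1 => /eqP; rewrite oner_eq0.
apply: ideal_kills h1 => _ [r hr ->].
by rewrite raddfB /= hh // subrr.
Qed.

Definition pres_ideal : ideal2 (freeAlg K (pgen P)) :=
  @Ideal2 K _ (ideal_submodule prelators)
    (@ideal_Ml _ _ _) (@ideal_Mr _ _ _) pres_proper.

Definition presAlg : Type := aquot pres_ideal.
HB.instance Definition _ := GRing.Algebra.on presAlg.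

Definition pvar (i : pgen P) : presAlg := api pres_ideal (fvar K i).

End Presented.

Inductive bilinear_rel (K : fieldType) (V W : lmodType K) :
    {malg K[(V * W)%type]} -> Prop :=
| BilinearL a v v' w : bilinear_rel
    (mkmalgU (a *: v + v', w) 1 - (a *: mkmalgU (v, w) 1 + mkmalgU (v', w) 1))
| BilinearR a v w w' : bilinear_rel
    (mkmalgU (v, a *: w + w') 1 - (a *: mkmalgU (v, w) 1 + mkmalgU (v, w') 1)).

Definition tensor (K : fieldType) (V W : lmodType K) : Type :=
  lquot (span_submodule (@bilinear_rel K V W)).
HB.instance Definition _ (K : fieldType) (V W : lmodType K) :=
  GRing.Lmodule.on (tensor V W).

HB.lock Definition tens (K : fieldType) (V W : lmodType K) (v : V) (w : W) :
    tensor V W :=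
  lpi (span_submodule (@bilinear_rel K V W)) (mkmalgU (v, w) 1).

(* Total in f; it is the map induced by f when f is bilinear. *)
HB.lock Definition tlift (K : fieldType) (V W X : lmodType K) (f : V -> W -> X)
    (x : tensor V W) : X :=
  \sum_(k <- msupp (repr (x : lquot _))) (repr (x : lquot _))@_k *: f k.1 k.2.

Section Tensor.
Variables (K : fieldType) (V W : lmodType K).

Definition bilin (X : lmodType K) (f : V -> W -> X) : Prop :=
  (forall w, linear (f^~ w)) /\ (forall v, linear (f v)).

Lemma tens_bilin : bilin (@tens K V W).
Proof.
split=> [w a v v'|v a w w']; rewrite tens.unlock -[in RHS]lpiZ -raddfD;
  apply/lpi_eq; apply: span_gen; [exact: BilinearL|exact: BilinearR].
Qed.

End Tensor.

Notation "v \ot w" := (tens v w) (at level 40, left associativity) : ring_scope.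

Section TensorTheory.
Variables (K : fieldType) (V W : lmodType K).
Local Notation T := (tensor V W).

Lemma tensDl (v v' : V) (w : W) : (v + v') \ot w = v \ot w + v' \ot w.
Proof. by have := (tens_bilin V W).1 w 1 v v'; rewrite !scale1r. Qed.
Lemma tensDr (v : V) (w w' : W) : v \ot (w + w') = v \ot w + v \ot w'.
Proof. by have := (tens_bilin V W).2 v 1 w w'; rewrite !scale1r. Qed.
Lemma tens0l (w : W) : (0 : V) \ot w = 0.
Proof. by apply: (addrI ((0 : V) \ot w)); rewrite -tensDl !addr0. Qed.
Lemma tens0r (v : V) : v \ot (0 : W) = 0.
Proof. by apply: (addrI (v \ot (0 : W))); rewrite -tensDr !addr0. Qed.
Lemma tensZl a (v : V) (w : W) : (a *: v) \ot w = a *: (v \ot w).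
Proof.
by have := (tens_bilin V W).1 w a v 0; rewrite /= tens0l !addr0.
Qed.
Lemma tensZr a (v : V) (w : W) : v \ot (a *: w) = a *: (v \ot w).
Proof.
by have := (tens_bilin V W).2 v a w 0; rewrite /= tens0r !addr0.
Qed.

Lemma tensor_ind (P : T -> Prop) :
  P 0 -> (forall v w x, P x -> P (v \ot w + x)) -> forall x, P x.
Proof.
move=> P0 PD; elim/lquot_ind => g; rewrite (monalgE g) raddf_sum /=.
elim/big_rec: _ => // -[v w] x _ Px /=.
suff -> : lpi (span_submodule (@bilinear_rel K V W))
    (mkmalgU (v, w) (g@_(v, w))) = (g@_(v, w) *: v) \ot w by exact: PD.
rewrite tensZl tens.unlock -[RHS]lpiZ; congr (lpi _ _).
by apply/malgP => k; rewrite mcoeffZ !mcoeffU mulrnAr mulr1.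
Qed.

Lemma tensor_ext (X : lmodType K) (f g : T -> X) : linear f -> linear g ->
  (forall v w, f (v \ot w) = g (v \ot w)) -> forall x, f x = g x.
Proof.
move=> lf lg fg; have f0 : f 0 = 0.
  by have := lf (-1) 0 0; rewrite scaler0 addr0 scaleN1r addNr.
have g0 : g 0 = 0.
  by have := lg (-1) 0 0; rewrite scaler0 addr0 scaleN1r addNr.
elim/tensor_ind => [|v w x fgx]; first by rewrite f0 g0.
by have := lf 1 (v \ot w) x; rewrite !scale1r => ->;
   have := lg 1 (v \ot w) x; rewrite !scale1r => ->; rewrite fg fgx.
Qed.

Lemma tlift_comb (X : lmodType K) a (f g h : V -> W -> X) :
  (forall v w, h v w = a *: f v w + g v w) ->
  forall x, tlift h x = a *: tlift f x + tlift g x.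
Proof.
move=> hfg x; rewrite tlift.unlock scaler_sumr -big_split /=; apply: eq_bigr => k _.
by rewrite hfg scalerDr !scalerA mulrC.
Qed.

Section Lift.
Variables (X : lmodType K) (f : V -> W -> X).
Hypothesis bf : bilin f.

Let ms (g : {malg K[(V * W)%type]}) : X :=
  \sum_(k <- msupp g) g@_k *: f k.1 k.2.

Let msEw (d : {fset (V * W)%type}) g : (msupp g `<=` d)%fset ->
  ms g = \sum_(k <- d) g@_k *: f k.1 k.2.
Proof.
move=> le; rewrite /ms (big_fset_incl _ le) //= => k _ /mcoeff_outdom ->.
by rewrite scale0r.
Qed.

Let ms_linear : linear ms.
Proof.
move=> a x y; pose d := (msupp x `|` msupp y `|` msupp (a *: x + y))%fset.
rewrite 3?(@msEw d) //; first last.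
- by apply/fsubsetP => k; rewrite !inE => ->; rewrite ?orbT.
- by apply/fsubsetP => k; rewrite !inE => ->; rewrite ?orbT.
- by apply/fsubsetP => k; rewrite !inE => ->; rewrite ?orbT.
rewrite scaler_sumr -big_split /=; apply: eq_bigr => k _.
by rewrite mcoeffD mcoeffZ scalerDl scalerA.
Qed.

Let msU k : ms (mkmalgU k 1) = f k.1 k.2.
Proof.
by rewrite (msEw msuppU_le) big_seq_fset1 mcoeffUU scale1r.
Qed.

Let ms_ker g : g \in sm_pred (span_submodule (@bilinear_rel K V W)) ->
  ms g = 0.
Proof.
have ms0 : ms 0 = 0 by rewrite /ms msupp0 big_seq_fset0.
have msD x y : ms (x + y) = ms x + ms y.
  by have := ms_linear 1 x y; rewrite !scale1r.
have msZ a x : ms (a *: x) = a *: ms x.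
  by have := ms_linear a x 0; rewrite ms0 !addr0.
have msB x y : ms (x - y) = ms x - ms y by rewrite msD -(scaleN1r y) msZ scaleN1r.
rewrite unfold_in => /asboolW /(_ (fun x => ms x = 0)); apply => //.
- by move=> a u v hu hv; rewrite ms_linear hu hv scaler0 addr0.
- move=> _ []; move=> *; rewrite msB msD msZ !msU /=.
    by rewrite bf.1 subrr.
  by rewrite bf.2 subrr.
Qed.

Let tlift_pi g : tlift f (lpi _ g) = ms g.
Proof.
rewrite tlift.unlock -[LHS]/(ms _); apply/eqP; rewrite -subr_eq0 -scaleN1r addrC.
rewrite -ms_linear; apply/eqP/ms_ker; rewrite scaleN1r addrC.
by apply/lpi_eq; rewrite lpi_repr.
Qed.

Lemma tliftE v w : tlift f (v \ot w) = f v w.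
Proof. by rewrite tens.unlock tlift_pi msU. Qed.

Lemma tlift_linear : linear (tlift f).
Proof.
move=> a; elim/lquot_ind => x; elim/lquot_ind => y.
pose S := span_submodule (@bilinear_rel K V W).
have -> : a *: (lpi S x : tensor V W) + lpi S y = lpi S (a *: x + y).
  exact/esym/(linearP (lpi S)).
by rewrite !tlift_pi ms_linear.
Qed.

End Lift.
End TensorTheory.

Section LinearDual.
Variables (K : fieldType) (V : lmodType K).

Lemma linear_dual (v : V) : v != 0 -> exists f : V -> K^o, linear f /\ f v = 1.
Proof.
move=> v0.
pose lin (A : set V) := forall a x y, A x -> A y -> A (a *: x + y).
have [|A [[linA Av] maxA]] := @Zorn_bigcup V (fun A => lin A /\ ~ A v).
  move=> F FP tot; split=> [a x y [A FA Ax] [B FB By]|[A FA Av]].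
    have [AB|BA] := tot _ _ FA FB.
      by exists B => //; apply: (FP _ FB).1 => //; apply: AB.
    by exists A => //; apply: (FP _ FA).1 => //; apply: BA.
  exact: (FP _ FA).2.
have A0 : A 0.
  apply: contrapT => nA0.
  apply: (maxA (fun x => x = 0)).
    split; last by move/(_ 0 erefl).
    move=> x Ax; case: nA0; have := linA (-1) x x Ax Ax.
    by rewrite scaleN1r addNr.
  split; last exact/eqP.
  by move=> a x y -> ->; rewrite scaler0 addr0.
have AZ a x : A x -> A (a *: x).
  by move=> Ax; rewrite -[_ *: _]addr0; exact: linA.
have AD x y : A x -> A y -> A (x + y).
  by move=> Ax Ay; rewrite -[x]scale1r; exact: linA.
have coef u : exists c : K, A (u - c *: v).
  have [Au|nAu] := pselect (A u); first by exists 0; rewrite scale0r subr0.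
  pose B : set V := fun x => exists a w, A w /\ x = w + a *: u.
  have linB : lin B.
    move=> c _ _ [a [w [Aw ->]]] [b [w' [Aw' ->]]].
    exists (c * a + b), (c *: w + w'); split; first exact: linA.
    by rewrite scalerDr scalerDl scalerA addrACA.
  have [|nBv] := pselect (B v); last first.
    have AB : (A `<` B)%classic.
      split=> [x Ax|BA]; first by exists 0, x; rewrite scale0r addr0.
      by apply/nAu/BA; exists 1, 0; rewrite scale1r add0r.
    by case: (maxA B AB).
  move=> [a [w [Aw vE]]].
  have a0 : a != 0.
    apply/eqP => a0; apply: Av; rewrite vE a0 scale0r addr0; exact: Aw.
  exists a^-1; rewrite vE scalerDr scalerA mulVf // scale1r opprD addrCA.
  by rewrite subrr addr0 -scaleNr; apply: AZ.
have coef_uniq u c d : A (u - c *: v) -> A (u - d *: v) -> c = d.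
  move=> hc hd; apply: contrapT => /eqP; rewrite -subr_eq0 => cd.
  apply: Av; have : A ((c - d) *: v).
    have := AD _ _ (AZ (-1) _ hc) hd; rewrite scaleN1r opprB addrA subrK.
    by rewrite scalerBl.
  by move/(AZ (c - d)^-1); rewrite scalerA mulVf // scale1r.
exists (fun u => projT1 (cid (coef u)) : K^o); split=> [a x y|].
  case: cid => c hc; case: cid => d hd; case: cid => e he /=.
  apply: (coef_uniq _ _ _ hc).
  have := linA a _ _ hd he.
  by rewrite scalerBr addrACA -opprD scalerA -scalerDl.
case: cid => c hc /=; apply: (coef_uniq _ _ _ hc).
by rewrite scale1r subrr.
Qed.

End LinearDual.

Section TensorMaps.
Variables (K : fieldType).
Implicit Types (U V W X : lmodType K).

Definition tmap V V' W W' (f : V -> V') (g : W -> W') :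
  tensor V W -> tensor V' W' := tlift (fun v w => f v \ot g w).

Lemma tmap_bilin V V' W W' (f : V -> V') (g : W -> W') :
  linear f -> linear g -> bilin (fun v w => f v \ot g w).
Proof.
move=> lf lg; split=> [w a v v'|v a w w'] /=.
  by rewrite lf tensDl tensZl.
by rewrite lg tensDr tensZr.
Qed.
Lemma tmapE V V' W W' (f : V -> V') (g : W -> W') : linear f -> linear g ->
  forall v w, tmap f g (v \ot w) = f v \ot g w.
Proof. by move=> lf lg v w; rewrite /tmap tliftE //; exact: tmap_bilin. Qed.
Lemma tmap_linear V V' W W' (f : V -> V') (g : W -> W') :
  linear f -> linear g -> linear (tmap f g).
Proof. by move=> lf lg; apply/tlift_linear/tmap_bilin. Qed.

Definition tassoc U V W : tensor (tensor U V) W -> tensor U (tensor V W) :=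
  tlift (fun x w => tlift (fun u v => u \ot (v \ot w)) x).
Definition tassoc_inv U V W : tensor U (tensor V W) -> tensor (tensor U V) W :=
  tlift (fun u y => tlift (fun v w => (u \ot v) \ot w) y).
Definition tlunit V : tensor K^o V -> V := tlift (fun (a : K^o) v => a *: v).
Definition tlunit_inv V (v : V) : tensor K^o V := (1 : K^o) \ot v.
Definition trunit V : tensor V K^o -> V := tlift (fun v (a : K^o) => a *: v).
Definition trunit_inv V (v : V) : tensor V K^o := v \ot (1 : K^o).

Lemma tassoc_bilin1 U V W (w : W) :
  bilin (fun (u : U) (v : V) => u \ot (v \ot w)).
Proof.
split=> [v a u u'|u a v v'] /=; first by rewrite tensDl tensZl.
by rewrite tensDl tensZl tensDr tensZr.
Qed.
Lemma tassoc_bilin U V W : bilin (fun (x : tensor U V) (w : W) =>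
  tlift (fun u v => u \ot (v \ot w)) x).
Proof.
split=> [w|x a w w']; first exact/tlift_linear/tassoc_bilin1.
by apply: tlift_comb => u v; rewrite !tensDr !tensZr.
Qed.
Lemma tassocE U V W (u : U) (v : V) (w : W) :
  tassoc ((u \ot v) \ot w) = u \ot (v \ot w).
Proof.
rewrite /tassoc tliftE ?tliftE //; first exact: tassoc_bilin1.
exact: tassoc_bilin.
Qed.
Lemma tassoc_linear U V W : linear (@tassoc U V W).
Proof. exact/tlift_linear/tassoc_bilin. Qed.

Lemma tassoc_inv_bilin1 U V W (u : U) :
  bilin (fun (v : V) (w : W) => (u \ot v) \ot w).
Proof.
split=> [w a v v'|v a w w'] /=; last by rewrite tensDr tensZr.
by rewrite tensDr tensZr tensDl tensZl.
Qed.
Lemma tassoc_inv_bilin U V W : bilin (fun (u : U) (y : tensor V W) =>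
  tlift (fun v w => (u \ot v) \ot w) y).
Proof.
split=> [y a u u'|u]; last exact/tlift_linear/tassoc_inv_bilin1.
by apply: tlift_comb => v w; rewrite !tensDl !tensZl.
Qed.
Lemma tassoc_invE U V W (u : U) (v : V) (w : W) :
  tassoc_inv (u \ot (v \ot w)) = (u \ot v) \ot w.
Proof.
rewrite /tassoc_inv tliftE ?tliftE //; first exact: tassoc_inv_bilin1.
exact: tassoc_inv_bilin.
Qed.
Lemma tassoc_inv_linear U V W : linear (@tassoc_inv U V W).
Proof. exact/tlift_linear/tassoc_inv_bilin. Qed.

Lemma tlunit_bilin V : bilin (fun (a : K^o) (v : V) => a *: v).
Proof.
by split=> [v b a a'|a b v v'] /=;
  rewrite ?scalerDl ?scalerDr ?scalerA //= mulrC.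
Qed.
Lemma tlunitE V (a : K^o) (v : V) : tlunit (a \ot v) = a *: v.
Proof. by rewrite /tlunit tliftE //; exact: tlunit_bilin. Qed.
Lemma tlunit_linear V : linear (@tlunit V).
Proof. exact/tlift_linear/tlunit_bilin. Qed.
Lemma tlunit_inv_linear V : linear (@tlunit_inv V).
Proof. by move=> a v w; rewrite /tlunit_inv tensDr tensZr. Qed.

Lemma trunit_bilin V : bilin (fun (v : V) (a : K^o) => a *: v).
Proof.
by split=> [a b v v'|v b a a'] /=;
  rewrite ?scalerDl ?scalerDr ?scalerA //= mulrC.
Qed.
Lemma trunitE V (v : V) (a : K^o) : trunit (v \ot a) = a *: v.
Proof. by rewrite /trunit tliftE //; exact: trunit_bilin. Qed.
Lemma trunit_linear V : linear (@trunit V).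
Proof. exact/tlift_linear/trunit_bilin. Qed.
Lemma trunit_inv_linear V : linear (@trunit_inv V).
Proof. by move=> a v w; rewrite /trunit_inv tensDl tensZl. Qed.

Lemma id_linear V : linear (@id V). Proof. by []. Qed.
Lemma comp_linear U V W (f : V -> W) (g : U -> V) :
  linear f -> linear g -> linear (f \o g).
Proof. by move=> lf lg a u v /=; rewrite lg lf. Qed.

Lemma linear0' U V (f : U -> V) : linear f -> f 0 = 0.
Proof. by move=> lf; have := lf (-1) 0 0; rewrite scaler0 addr0 scaleN1r addNr. Qed.
Lemma linearD' U V (f : U -> V) : linear f -> {morph f : x y / x + y}.
Proof. by move=> lf x y; have := lf 1 x y; rewrite !scale1r. Qed.
Lemma linearZ' U V (f : U -> V) a : linear f -> {morph f : x / a *: x}.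
Proof.
by move=> lf x; have := lf a x 0; rewrite (linear0' lf) !addr0.
Qed.

Lemma tensl_linear U V (v : V) : linear (fun u : U => u \ot v).
Proof. exact: (tens_bilin U V).1. Qed.
Lemma tensr_linear U V (u : U) : linear (fun v : V => u \ot v).
Proof. exact: (tens_bilin U V).2. Qed.

Lemma tensor3_ext U V W X (f g : tensor (tensor U V) W -> X) :
  linear f -> linear g ->
  (forall u v w, f ((u \ot v) \ot w) = g ((u \ot v) \ot w)) ->
  forall x, f x = g x.
Proof.
move=> lf lg fg; apply: tensor_ext => // x w; move: x.
apply: (tensor_ext (f := f \o (fun x => x \ot w)) (g := g \o (fun x => x \ot w))).
- exact: (comp_linear lf (tensl_linear _)).
- exact: (comp_linear lg (tensl_linear _)).
by move=> u v; exact: fg.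
Qed.

Lemma tensor3r_ext U V W X (f g : tensor U (tensor V W) -> X) :
  linear f -> linear g ->
  (forall u v w, f (u \ot (v \ot w)) = g (u \ot (v \ot w))) ->
  forall x, f x = g x.
Proof.
move=> lf lg fg; apply: tensor_ext => // u.
apply: (tensor_ext (f := f \o (fun x => u \ot x)) (g := g \o (fun x => u \ot x))).
- exact: (comp_linear lf (tensr_linear _)).
- exact: (comp_linear lg (tensr_linear _)).
by move=> v w; exact: fg.
Qed.

Lemma tensor4_ext U V W X (Y : lmodType K) (f g : tensor (tensor (tensor U V) W) X -> Y) :
  linear f -> linear g ->
  (forall u v w x, f (((u \ot v) \ot w) \ot x) = g (((u \ot v) \ot w) \ot x)) ->
  forall x, f x = g x.
Proof.
move=> lf lg fg; apply: tensor_ext => // y x; move: y.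
apply: (tensor3_ext (f := f \o (fun y => y \ot x)) (g := g \o (fun y => y \ot x))).
- exact: (comp_linear lf (tensl_linear _)).
- exact: (comp_linear lg (tensl_linear _)).
by move=> u v w; exact: fg.
Qed.

Lemma tlift_fun_linear U V W X (F : U -> V -> W -> X) (x : tensor V W) :
  (forall v w, linear (fun u => F u v w)) -> linear (fun u => tlift (F u) x).
Proof. by move=> hF a u u'; apply: tlift_comb => v w; exact: hF. Qed.

End TensorMaps.

Section TensorAlgebra.
Variables (K : fieldType) (A B : algType K).
Local Notation T := (tensor A B).

Definition tmul (x y : T) : T :=
  tlift (fun a b => tlift (fun a' b' => (a * a') \ot (b * b')) y) x.

Lemma mull_linear (C : algType K) (c : C) : linear ( *%R c).
Proof. by move=> a x y; rewrite mulrDr -scalerAr. Qed.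
Lemma mulr_linear (C : algType K) (c : C) : linear ( *%R^~ c).
Proof. by move=> a x y; rewrite mulrDl -scalerAl. Qed.

Lemma tmul_bilin1 (a : A) (b : B) :
  bilin (fun a' b' => (a * a') \ot (b * b')).
Proof. by apply: tmap_bilin; exact: mull_linear. Qed.

Lemma tmul_bilin2 (y : T) :
  bilin (fun (a : A) (b : B) => tlift (fun a' b' => (a * a') \ot (b * b')) y).
Proof.
split=> [b|a]; apply: tlift_fun_linear => a' b' c u v.
  by rewrite mulr_linear tensDl tensZl.
by rewrite mulr_linear tensDr tensZr.
Qed.

Lemma tmulr_linear y : linear (tmul^~ y).
Proof. exact/tlift_linear/tmul_bilin2. Qed.

Lemma tmull_linear x : linear (tmul x).
Proof.
move=> c u v; apply: tlift_comb => a b.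
by rewrite (tlift_linear (tmul_bilin1 a b)).
Qed.

Lemma tmulE a b a' b' :
  tmul (a \ot b) (a' \ot b') = (a * a') \ot (b * b').
Proof.
rewrite /tmul tliftE ?tliftE //; first exact: tmul_bilin1.
exact: tmul_bilin2.
Qed.

Fact tmulA : associative tmul.
Proof.
move=> x y z; move: x; apply: tensor_ext => [||a b].
- exact: tmulr_linear.
- by apply: (comp_linear (tmulr_linear z)); exact: tmulr_linear.
move: y; apply: tensor_ext => [||a' b'].
- by apply: (comp_linear (tmull_linear _)); exact: tmulr_linear.
- by apply: (comp_linear (tmulr_linear z)); exact: tmull_linear.
move: z; apply: tensor_ext => [||a'' b''].
- by apply: (comp_linear (tmull_linear _)); exact: tmull_linear.
- exact: tmull_linear.
by rewrite !tmulE !mulrA.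
Qed.

Fact tmul1r : left_id (1 \ot 1) tmul.
Proof.
apply: tensor_ext => [||a b]; [exact: tmull_linear|by []|].
by rewrite tmulE !mul1r.
Qed.
Fact tmulr1 : right_id (1 \ot 1) tmul.
Proof.
apply: tensor_ext => [||a b]; [exact: tmulr_linear|by []|].
by rewrite tmulE !mulr1.
Qed.
Fact tmulDl : left_distributive tmul +%R.
Proof. by move=> x y z; rewrite (linearD' (tmulr_linear z)). Qed.
Fact tmulDr : right_distributive tmul +%R.
Proof. by move=> x y z; rewrite (linearD' (tmull_linear x)). Qed.
Fact tens_nz : (1 : A) \ot (1 : B) != 0.
Proof.
have [f [lf f1]] := linear_dual (oner_neq0 A).
have [g [lg g1]] := linear_dual (oner_neq0 B).
apply/eqP => /(congr1 (tlift (fun a b => f a * g b : K^o))).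
have bfg : bilin (fun a b => f a * g b : K^o).
  split=> [b a x y|a b x y] /=.
    by rewrite lf mulrDl -scalerAl.
  by rewrite lg mulrDr -scalerAr.
rewrite (linear0' (tlift_linear bfg)) tliftE // f1 g1 mulr1.
by move/eqP; rewrite oner_eq0.
Qed.

HB.instance Definition _ := GRing.Zmodule_isNzRing.Build (tensor A B)
  tmulA tmul1r tmulr1 tmulDl tmulDr tens_nz.
Fact tens_scaleAl (a : K) (u v : T) : a *: (u * v) = (a *: u) * v.
Proof. exact/esym/(linearZ' a (tmulr_linear v)). Qed.
HB.instance Definition _ :=
  GRing.Lmodule_isLalgebra.Build K (tensor A B) tens_scaleAl.
Fact tens_scaleAr (a : K) (u v : T) : a *: (u * v) = u * (a *: v).
Proof. exact/esym/(linearZ' a (tmull_linear u)). Qed.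
HB.instance Definition _ :=
  GRing.Lalgebra_isAlgebra.Build K (tensor A B) tens_scaleAr.

Lemma tensM (a a' : A) (b b' : B) :
  (a \ot b) * (a' \ot b') = (a * a') \ot (b * b').
Proof. exact: tmulE. Qed.
Lemma tens1 : (1 : tensor A B) = 1 \ot 1. Proof. by []. Qed.

End TensorAlgebra.

Record hopfAlgebra (K : fieldType) (H : algType K) := HopfAlgebra {
  hdelta : {lrmorphism H -> tensor H H};
  heps : {lrmorphism H -> K^o};
  hS : {linear H -> H};
  h_coassoc : forall x,
    tassoc (tmap hdelta id (hdelta x)) = tmap id hdelta (hdelta x);
  h_counitl : forall x, tlunit (tmap heps id (hdelta x)) = x;
  h_counitr : forall x, trunit (tmap id heps (hdelta x)) = x;
  h_antipl : forall x, tlift (fun a b => hS a * b) (hdelta x) = (heps x)%:A;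
  h_antipr : forall x, tlift (fun a b => a * hS b) (hdelta x) = (heps x)%:A }.

Definition inverse_of (H : nzRingType) (x y : H) : Prop :=
  x * y = 1 /\ y * x = 1.

(* For invertible Phi this is what makes Phi^-1 * Delta * Phi coassociative
   and counital: Phi^-1 is a (Drinfeld) twist. *)
Definition twist_cocycle (K : fieldType) (H : algType K) (h : hopfAlgebra H)
    (Phi : tensor H H) : Prop :=
  [/\ tassoc (tmap (hdelta h) id Phi * (Phi \ot 1)) =
        tmap id (hdelta h) Phi * (1 \ot Phi),
      tlunit (tmap (heps h) id Phi) = 1 &
      trunit (tmap id (heps h) Phi) = 1].

Record category := Category {
  obj :> Type;
  hom : obj -> obj -> Type;
  idm : forall X, hom X X;
  comp : forall X Y Z, hom Y Z -> hom X Y -> hom X Z;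
  comp_idl : forall X Y (f : hom X Y), comp (idm Y) f = f;
  comp_idr : forall X Y (f : hom X Y), comp f (idm X) = f;
  comp_assoc : forall X Y Z T (f : hom Z T) (g : hom Y Z) (h : hom X Y),
    comp f (comp g h) = comp (comp f g) h }.

Arguments idm {c} X.
Notation "f \oc g" := (comp f g) (at level 45, right associativity).

Record iso (C : category) (X Y : C) := Iso {
  iso_hom :> hom X Y;
  iso_inv : hom Y X;
  iso_homK : iso_inv \oc iso_hom = idm X;
  iso_invK : iso_hom \oc iso_inv = idm Y }.

Record functor (C D : category) := Functor {
  fobj :> C -> D;
  fmap : forall X Y, hom X Y -> hom (fobj X) (fobj Y);
  fmap_id : forall X, fmap (idm X) = idm (fobj X);
  fmap_comp : forall X Y Z (f : hom Y Z) (g : hom X Y),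
    fmap (f \oc g) = fmap f \oc fmap g }.

Arguments fmap {C D} f0 {X Y}.

Definition is_equivalence (C D : category) (F : functor C D) : Prop :=
  exists (G : functor D C)
    (eta : forall X : C, iso (G (F X)) X)
    (eps : forall Y : D, iso (F (G Y)) Y),
    (forall (X Y : C) (f : hom X Y),
       f \oc iso_hom (eta X) = iso_hom (eta Y) \oc fmap G (fmap F f)) /\
    (forall (X Y : D) (f : hom X Y),
       f \oc iso_hom (eps X) = iso_hom (eps Y) \oc fmap F (fmap G f)).

Record monoidalCategory := MonoidalCategory {
  mcat :> category;
  munit : mcat;
  mtens : mcat -> mcat -> mcat;
  mtensm : forall X X' Y Y' : mcat, hom X X' -> hom Y Y' ->
    hom (mtens X Y) (mtens X' Y');
  massoc : forall X Y Z : mcat, iso (mtens (mtens X Y) Z) (mtens X (mtens Y Z));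
  mlunit : forall X : mcat, iso (mtens munit X) X;
  mrunit : forall X : mcat, iso (mtens X munit) X;
  mtens_id : forall X Y : mcat, mtensm (idm X) (idm Y) = idm (mtens X Y);
  mtens_comp : forall (X X' X'' Y Y' Y'' : mcat) (f : hom X' X'') (g : hom X X')
      (f' : hom Y' Y'') (g' : hom Y Y'),
    mtensm (f \oc g) (f' \oc g') = mtensm f f' \oc mtensm g g';
  massoc_nat : forall (X X' Y Y' Z Z' : mcat)
      (f : hom X X') (g : hom Y Y') (h : hom Z Z'),
    mtensm f (mtensm g h) \oc iso_hom (massoc X Y Z) =
    iso_hom (massoc X' Y' Z') \oc mtensm (mtensm f g) h;
  mlunit_nat : forall (X Y : mcat) (f : hom X Y),
    f \oc iso_hom (mlunit X) = iso_hom (mlunit Y) \oc mtensm (idm munit) f;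
  mrunit_nat : forall (X Y : mcat) (f : hom X Y),
    f \oc iso_hom (mrunit X) = iso_hom (mrunit Y) \oc mtensm f (idm munit);
  mpentagon : forall X Y Z T : mcat,
    iso_hom (massoc X Y (mtens Z T)) \oc iso_hom (massoc (mtens X Y) Z T) =
    mtensm (idm X) (iso_hom (massoc Y Z T)) \oc
      iso_hom (massoc X (mtens Y Z) T) \oc
      mtensm (iso_hom (massoc X Y Z)) (idm T);
  mtriangle : forall X Y : mcat,
    mtensm (idm X) (iso_hom (mlunit Y)) \oc iso_hom (massoc X munit Y) =
    mtensm (iso_hom (mrunit X)) (idm Y) }.

Record monoidal_structure (C D : monoidalCategory) (F : functor C D) :=
  MonoidalStructure {
  mon_unit : iso (munit D) (F (munit C));
  mon_tens : forall X Y : C, iso (mtens (F X) (F Y)) (F (mtens X Y));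
  mon_nat : forall (X X' Y Y' : C) (f : hom X X') (g : hom Y Y'),
    fmap F (mtensm f g) \oc iso_hom (mon_tens X Y) =
    iso_hom (mon_tens X' Y') \oc mtensm (fmap F f) (fmap F g);
  mon_assoc : forall X Y Z : C,
    fmap F (iso_hom (massoc X Y Z)) \oc iso_hom (mon_tens (mtens X Y) Z) \oc
      mtensm (iso_hom (mon_tens X Y)) (idm (F Z)) =
    iso_hom (mon_tens X (mtens Y Z)) \oc
      mtensm (idm (F X)) (iso_hom (mon_tens Y Z)) \oc
      iso_hom (massoc (F X) (F Y) (F Z));
  mon_lunit : forall X : C,
    fmap F (iso_hom (mlunit X)) \oc iso_hom (mon_tens (munit C) X) \oc
      mtensm (iso_hom mon_unit) (idm (F X)) = iso_hom (mlunit (F X));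
  mon_runit : forall X : C,
    fmap F (iso_hom (mrunit X)) \oc iso_hom (mon_tens X (munit C)) \oc
      mtensm (idm (F X)) (iso_hom mon_unit) = iso_hom (mrunit (F X)) }.

Definition monoidally_equivalent (C D : monoidalCategory) : Prop :=
  exists F : functor C D, is_equivalence F /\ inhabited (monoidal_structure F).

Section FullSubcategory.
Variables (C : monoidalCategory) (P : C -> Prop).
Hypotheses (P1 : P (munit C)) (PT : forall X Y, P X -> P Y -> P (mtens X Y)).

Definition full_category : category := {|
  obj := {X : C | P X};
  hom X Y := hom (sval X) (sval Y);
  idm X := idm (sval X);
  comp X Y Z f g := f \oc g;
  comp_idl X Y f := comp_idl f;
  comp_idr X Y f := comp_idr f;
  comp_assoc X Y Z T f g h := comp_assoc f g h |}.

Definition full_iso (X Y : full_category) (i : iso (sval X) (sval Y)) :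
  iso X Y := @Iso full_category X Y i (iso_inv i) (iso_homK i) (iso_invK i).

Definition full_unit : full_category := exist P (munit C) P1.
Definition full_tens (X Y : full_category) : full_category :=
  exist P (mtens (sval X) (sval Y)) (PT (svalP X) (svalP Y)).

Definition full_monoidal : monoidalCategory := {|
  mcat := full_category;
  munit := full_unit;
  mtens := full_tens;
  mtensm X X' Y Y' f g := mtensm f g;
  massoc X Y Z := @full_iso (full_tens (full_tens X Y) Z)
    (full_tens X (full_tens Y Z)) (massoc (sval X) (sval Y) (sval Z));
  mlunit X := @full_iso (full_tens full_unit X) X (mlunit (sval X));
  mrunit X := @full_iso (full_tens X full_unit) X (mrunit (sval X));
  mtens_id X Y := mtens_id (sval X) (sval Y);
  mtens_comp X X' X'' Y Y' Y'' f g f' g' := mtens_comp f g f' g';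
  massoc_nat X X' Y Y' Z Z' f g h := massoc_nat f g h;
  mlunit_nat X Y f := mlunit_nat f;
  mrunit_nat X Y f := mrunit_nat f;
  mpentagon X Y Z T := mpentagon (sval X) (sval Y) (sval Z) (sval T);
  mtriangle X Y := mtriangle (sval X) (sval Y) |}.

End FullSubcategory.

Record lmodule (K : fieldType) (H : algType K) := LModule {
  lcar :> lmodType K;
  lact : H -> lcar -> lcar;
  lact_bilin : bilin lact;
  lact1 : forall v, lact 1 v = v;
  lactM : forall x y v, lact (x * y) v = lact x (lact y v) }.

Record lmodule_hom (K : fieldType) (H : algType K) (V W : lmodule H) :=
  LModuleHom {
  lhom :> V -> W;
  lhom_linear : linear lhom;
  lhom_act : forall x v, lhom (lact x v) = lact x (lhom v) }.

Section ModuleCategory.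
Variables (K : fieldType) (H : algType K).

Lemma lhom_ext (V W : lmodule H) (f g : lmodule_hom V W) :
  (forall v, f v = g v) -> f = g.
Proof.
case: f g => f lf hf [g lg hg] /= fg.
have {}fg : f = g by apply/funext.
by subst g; congr LModuleHom; apply: Prop_irrelevance.
Qed.

Definition lhom_id (V : lmodule H) : lmodule_hom V V :=
  @LModuleHom _ _ V V id (@id_linear _ V) (fun _ _ => erefl).

Fact lhom_comp_act (U V W : lmodule H) (f : lmodule_hom V W)
    (g : lmodule_hom U V) x v : (f \o g) (lact x v) = lact x ((f \o g) v).
Proof. by rewrite /= !lhom_act. Qed.
Definition lhom_comp (U V W : lmodule H) (f : lmodule_hom V W)
    (g : lmodule_hom U V) : lmodule_hom U W :=
  LModuleHom (comp_linear (@lhom_linear _ _ _ _ f) (@lhom_linear _ _ _ _ g))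
    (lhom_comp_act f g).

Definition ModCat : category.
Proof.
refine (@Category (lmodule H) (@lmodule_hom K H) lhom_id lhom_comp _ _ _);
  by move=> *; apply: lhom_ext.
Defined.

End ModuleCategory.

Section RepCategory.
Variables (K : fieldType) (H : algType K) (h : hopfAlgebra H).
Implicit Types V W X : lmodule H.

(* V \ot W as an A \ot B-module; a Hopf algebra acts on V \ot W by restriction
   along its coproduct. *)
Definition tact2 (A B : algType K) (V : lmodule A) (W : lmodule B)
    (t : tensor A B) (x : tensor V W) : tensor V W :=
  tlift (fun a b => tmap (lact a) (lact b) x) t.

Lemma lact_linear (A : algType K) (M : lmodule A) (a : A) :
  linear (@lact _ _ M a).
Proof. exact: (lact_bilin M).2. Qed.
Lemma lactl_linear (A : algType K) (M : lmodule A) (v : M) :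
  linear ((@lact _ _ M)^~ v).
Proof. exact: (lact_bilin M).1. Qed.

Section TensorAction.
Variables (A B : algType K) (V : lmodule A) (W : lmodule B).
Local Notation act := (@tact2 A B V W).

Lemma tact2_bilin1 (x : tensor V W) :
  bilin (fun (a : A) (b : B) => tmap (@lact _ _ V a) (@lact _ _ W b) x).
Proof.
split=> [b|a]; apply: tlift_fun_linear => v w c u u'.
  by rewrite (lactl_linear v) tensDl tensZl.
by rewrite (lactl_linear w) tensDr tensZr.
Qed.
Lemma tact2_linearl x : linear (act^~ x).
Proof. exact/tlift_linear/tact2_bilin1. Qed.
Lemma tact2_linear t : linear (act t).
Proof.
move=> c x y; apply: tlift_comb => a b.
by rewrite tmap_linear //; exact: lact_linear.
Qed.
Lemma tact2E a b v w : act (a \ot b) (v \ot w) = lact a v \ot lact b w.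
Proof.
rewrite /tact2 tliftE; first by rewrite tmapE //; exact: lact_linear.
exact: tact2_bilin1.
Qed.
Lemma tact2_1 x : act 1 x = x.
Proof.
move: x; apply: tensor_ext => [||v w]; [exact: tact2_linear|by []|].
by rewrite tens1 tact2E !lact1.
Qed.
Lemma tact2M s t x : act (s * t) x = act s (act t x).
Proof.
move: s; apply: tensor_ext => [||a b].
- by apply: (comp_linear (tact2_linearl x)); exact: mulr_linear.
- exact: tact2_linearl.
move: t; apply: tensor_ext => [||a' b'].
- by apply: (comp_linear (tact2_linearl x)); exact: mull_linear.
- by apply: (comp_linear (tact2_linear _)); exact: tact2_linearl.
move: x; apply: tensor_ext => [||v w].
- exact: tact2_linear.
- by apply: (comp_linear (tact2_linear _)); exact: tact2_linear.
by rewrite tensM !tact2E !lactM.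
Qed.
End TensorAction.

Definition rep_tens_act V W (x : H) : tensor V W -> tensor V W :=
  @tact2 H H V W (hdelta h x).

Fact rep_tens_bilin V W : bilin (@rep_tens_act V W).
Proof.
split=> [x|a]; last exact: tact2_linear.
by apply: (comp_linear (tact2_linearl x)); exact: linearP.
Qed.
Fact rep_tens_act1 V W v : @rep_tens_act V W 1 v = v.
Proof. by rewrite /rep_tens_act rmorph1 tact2_1. Qed.
Fact rep_tens_actM V W x y v :
  @rep_tens_act V W (x * y) v = rep_tens_act x (rep_tens_act y v).
Proof. by rewrite /rep_tens_act rmorphM tact2M. Qed.

Definition rep_tens V W : lmodule H :=
  @LModule K H (tensor V W) (@rep_tens_act V W)
    (rep_tens_bilin V W) (@rep_tens_act1 V W) (@rep_tens_actM V W).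

Definition rep_unit_act (x : H) (a : K^o) : K^o := heps h x * a.
Fact rep_unit_bilin : bilin rep_unit_act.
Proof.
split=> [w a x y|x a v w]; rewrite /rep_unit_act.
  by rewrite linearP mulrDl scalerAl.
by rewrite mulrDr scalerAr.
Qed.
Fact rep_unit_act1 v : rep_unit_act 1 v = v.
Proof. by rewrite /rep_unit_act rmorph1 mul1r. Qed.
Fact rep_unit_actM x y v :
  rep_unit_act (x * y) v = rep_unit_act x (rep_unit_act y v).
Proof. by rewrite /rep_unit_act rmorphM mulrA. Qed.
Definition rep_unit : lmodule H :=
  @LModule K H K^o rep_unit_act rep_unit_bilin rep_unit_act1 rep_unit_actM.

End RepCategory.

Section RepMonoidal.
Variables (K : fieldType) (H : algType K) (h : hopfAlgebra H).
Implicit Types U V W X Y Z : lmodule H.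
Local Notation lin f := (@lhom_linear _ _ _ _ f).

Definition tens_module (A B : algType K) (V : lmodule A) (W : lmodule B) :
    lmodule (tensor A B) :=
  @LModule K (tensor A B) (tensor V W) (@tact2 K A B V W)
    (conj (@tact2_linearl K A B V W) (@tact2_linear K A B V W))
    (@tact2_1 K A B V W) (@tact2M K A B V W).

Definition mk_iso (V W : lmodule H) (f : lmodule_hom V W) (g : W -> V)
    (lg : linear g) (fK : cancel f g) (gK : cancel g f) :
  @iso (ModCat H) V W.
Proof.
pose hg x w : g (lact x w) = lact x (g w) :=
  etrans (congr1 (fun y => g (lact x y)) (esym (gK w)))
    (etrans (congr1 g (esym (lhom_act f x (g w)))) (fK _)).
refine (@Iso (ModCat H) V W f (LModuleHom lg hg) _ _).
- by apply: lhom_ext => v; exact: fK.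
- by apply: lhom_ext => v; exact: gK.
Defined.

Fact rep_tensm_act X X' Y Y' (f : lmodule_hom X X') (g : lmodule_hom Y Y')
    x (v : rep_tens h X Y) :
  tmap f g (lact x v) = lact x (tmap f g v : rep_tens h X' Y').
Proof.
rewrite /= /rep_tens_act; move: (hdelta h x) => {x}.
apply: tensor_ext => [||a b].
- by apply: (comp_linear (tmap_linear (lin f) (lin g))); exact: tact2_linearl.
- exact: tact2_linearl.
move: v; apply: tensor_ext => [||v w].
- by apply: (comp_linear (tmap_linear (lin f) (lin g))); exact: tact2_linear.
- by apply: (comp_linear (tact2_linear _));
    exact: (tmap_linear (lin f) (lin g)).
rewrite tact2E !(tmapE (lin f) (lin g)) !lhom_act.
by rewrite tact2E.
Qed.
Definition rep_tensm X X' Y Y' (f : lmodule_hom X X') (g : lmodule_hom Y Y') :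
    lmodule_hom (rep_tens h X Y) (rep_tens h X' Y') :=
  LModuleHom (V := rep_tens h X Y) (W := rep_tens h X' Y')
    (tmap_linear (lin f) (lin g)) (@rep_tensm_act _ _ _ _ f g).

Lemma rep_tensmE X X' Y Y' (f : lmodule_hom X X') (g : lmodule_hom Y Y') v w :
  rep_tensm f g (v \ot w) = f v \ot g w.
Proof. exact: (tmapE (lin f) (lin g)). Qed.

Lemma tassoc_act (A B C : algType K) (U : lmodule A) (V : lmodule B)
    (W : lmodule C) (t : tensor (tensor A B) C) (x : tensor (tensor U V) W) :
  tassoc (@tact2 K _ _ (tens_module U V) W t x) =
  @tact2 K _ _ U (tens_module V W) (tassoc t) (tassoc x).
Proof.
move: t; apply: tensor3_ext => [||a b c].
- apply: (comp_linear (@tassoc_linear _ _ _ _)).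
  exact: (@tact2_linearl K _ _ (tens_module U V) W).
- by apply: (comp_linear (@tact2_linearl _ _ _ U (tens_module V W) _));
    exact: tassoc_linear.
move: x; apply: tensor3_ext => [||u v w].
- apply: (comp_linear (@tassoc_linear _ _ _ _)).
  exact: (@tact2_linear K _ _ (tens_module U V) W).
- by apply: (comp_linear (@tact2_linear _ _ _ U (tens_module V W) _));
    exact: tassoc_linear.
have e1 := @tact2E K _ _ (tens_module U V) W (a \ot b) c (u \ot v) w.
have e2 := @tact2E K _ _ U (tens_module V W) a (b \ot c) u (v \ot w).
rewrite tassocE.
rewrite tassocE.
apply: (etrans (congr1 (@tassoc K U V W) e1)).
apply: (etrans _ (esym e2)).
have e3 := @tact2E K _ _ U V a b u v.
have e4 := @tact2E K _ _ V W b c v w.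
apply: (etrans (congr1 (fun z => tassoc (z \ot lact c w)) e3)).
apply: (etrans _ (congr1 (fun z => lact a u \ot z) (esym e4))).
exact: tassocE.
Qed.

Lemma hdelta_linear : linear (hdelta h). Proof. exact: linearP. Qed.
Lemma heps_linear : linear (heps h). Proof. exact: linearP. Qed.

Fact rep_assoc_act X Y Z x (v : rep_tens h (rep_tens h X Y) Z) :
  tassoc (lact x v) = lact x (tassoc v : rep_tens h X (rep_tens h Y Z)).
Proof.
rewrite /= /rep_tens_act.
have el t : @tact2 K H H (rep_tens h X Y) Z t v =
    @tact2 K _ _ (tens_module X Y) Z (tmap (hdelta h) id t) v.
  move: t; apply: tensor_ext => [||a b].
  - exact: (@tact2_linearl K H H (rep_tens h X Y) Z).
  - apply: (comp_linear (@tact2_linearl K _ _ (tens_module X Y) Z v)).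
    exact: (tmap_linear hdelta_linear (@id_linear _ _)).
  rewrite (tmapE hdelta_linear (@id_linear _ _)) /tact2 tliftE.
    rewrite tliftE //; exact: (@tact2_bilin1 K _ _ (tens_module X Y) Z v).
  exact: (@tact2_bilin1 K H H (rep_tens h X Y) Z v).
have er t (w : tensor X (tensor Y Z)) : @tact2 K H H X (rep_tens h Y Z) t w =
    @tact2 K _ _ X (tens_module Y Z) (tmap id (hdelta h) t) w.
  move: t; apply: tensor_ext => [||a b].
  - exact: (@tact2_linearl K H H X (rep_tens h Y Z)).
  - apply: (comp_linear (@tact2_linearl K _ _ X (tens_module Y Z) w)).
    exact: (tmap_linear (@id_linear _ _) hdelta_linear).
  rewrite (tmapE (@id_linear _ _) hdelta_linear) /tact2 tliftE.
    rewrite tliftE //; exact: (@tact2_bilin1 K _ _ X (tens_module Y Z) w).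
  exact: (@tact2_bilin1 K H H X (rep_tens h Y Z) w).
by rewrite el tassoc_act er h_coassoc.
Qed.
Definition rep_assoc_hom X Y Z : lmodule_hom
    (rep_tens h (rep_tens h X Y) Z) (rep_tens h X (rep_tens h Y Z)) :=
  LModuleHom (V := rep_tens h (rep_tens h X Y) Z)
    (W := rep_tens h X (rep_tens h Y Z))
    (@tassoc_linear K X Y Z) (@rep_assoc_act X Y Z).

Lemma tassocK (A B C : lmodType K) : cancel (@tassoc K A B C) (@tassoc_inv K A B C).
Proof.
apply: tensor3_ext => [||a b c] //; last by rewrite tassocE tassoc_invE.
exact: (comp_linear (@tassoc_inv_linear _ _ _ _) (@tassoc_linear _ _ _ _)).
Qed.
Lemma tassoc_invK (A B C : lmodType K) :
  cancel (@tassoc_inv K A B C) (@tassoc K A B C).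
Proof.
apply: tensor3r_ext => [||a b c] //; last by rewrite tassoc_invE tassocE.
exact: (comp_linear (@tassoc_linear _ _ _ _) (@tassoc_inv_linear _ _ _ _)).
Qed.

Definition rep_assoc X Y Z : @iso (ModCat H)
    (rep_tens h (rep_tens h X Y) Z) (rep_tens h X (rep_tens h Y Z)) :=
  mk_iso (f := rep_assoc_hom X Y Z) (@tassoc_inv_linear K X Y Z)
    (@tassocK X Y Z) (@tassoc_invK X Y Z).

Fact rep_lunit_act X x (v : rep_tens h (rep_unit h) X) :
  tlunit (lact x v) = lact x (tlunit v).
Proof.
rewrite /= /rep_tens_act.
rewrite -[in RHS](h_counitl h x); move: (hdelta h x) => {x}.
apply: tensor_ext => [||a b].
- by apply: (comp_linear (@tlunit_linear _ _));
    exact: (@tact2_linearl K H H (rep_unit h) X).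
- apply: (comp_linear (lactl_linear _)); apply: (comp_linear (@tlunit_linear _ _)).
  exact: (tmap_linear heps_linear (@id_linear _ _)).
move: v; apply: tensor_ext => [||c v].
- by apply: (comp_linear (@tlunit_linear _ _));
    exact: (@tact2_linear K H H (rep_unit h) X).
- by apply: (comp_linear (lact_linear _)); exact: tlunit_linear.
rewrite (@tact2E K H H (rep_unit h) X) (tmapE heps_linear (@id_linear _ _)).
rewrite !tlunitE.
have e1 := @linearZ' K H X _ (heps h a) (lactl_linear v) b.
have e2 := @linearZ' K X X _ c (lact_linear (heps h a *: b)) v.
apply: (etrans _ (esym e2)); apply: (etrans _ (congr1 _ (esym e1))).
by rewrite /= scalerA mulrC.
Qed.
Definition rep_lunit_hom X : lmodule_hom (rep_tens h (rep_unit h) X) X :=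
  LModuleHom (V := rep_tens h (rep_unit h) X)
    (@tlunit_linear K X) (@rep_lunit_act X).

Lemma tlunitK (V : lmodType K) : cancel (@tlunit K V) (@tlunit_inv K V).
Proof.
apply: tensor_ext => [||a v] //.
  exact: (comp_linear (@tlunit_inv_linear _ _) (@tlunit_linear _ _)).
rewrite tlunitE /tlunit_inv tensZr -tensZl; congr (_ \ot _); exact: mulr1.
Qed.
Lemma tlunit_invK (V : lmodType K) : cancel (@tlunit_inv K V) (@tlunit K V).
Proof. by move=> v; rewrite tlunitE scale1r. Qed.

Definition rep_lunit X : @iso (ModCat H) (rep_tens h (rep_unit h) X) X :=
  mk_iso (f := rep_lunit_hom X) (@tlunit_inv_linear K X)
    (@tlunitK X) (@tlunit_invK X).

Fact rep_runit_act X x (v : rep_tens h X (rep_unit h)) :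
  trunit (lact x v) = lact x (trunit v).
Proof.
rewrite /= /rep_tens_act.
rewrite -[in RHS](h_counitr h x); move: (hdelta h x) => {x}.
apply: tensor_ext => [||a b].
- by apply: (comp_linear (@trunit_linear _ _));
    exact: (@tact2_linearl K H H X (rep_unit h)).
- apply: (comp_linear (lactl_linear _)); apply: (comp_linear (@trunit_linear _ _)).
  exact: (tmap_linear (@id_linear _ _) heps_linear).
move: v; apply: tensor_ext => [||v c].
- by apply: (comp_linear (@trunit_linear _ _));
    exact: (@tact2_linear K H H X (rep_unit h)).
- by apply: (comp_linear (lact_linear _)); exact: trunit_linear.
rewrite (@tact2E K H H X (rep_unit h)) (tmapE (@id_linear _ _) heps_linear).
rewrite !trunitE.
have e1 := @linearZ' K H X _ (heps h b) (lactl_linear v) a.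
have e2 := @linearZ' K X X _ c (lact_linear (heps h b *: a)) v.
apply: (etrans _ (esym e2)); apply: (etrans _ (congr1 _ (esym e1))).
by rewrite /= scalerA mulrC.
Qed.
Definition rep_runit_hom X : lmodule_hom (rep_tens h X (rep_unit h)) X :=
  LModuleHom (V := rep_tens h X (rep_unit h))
    (@trunit_linear K X) (@rep_runit_act X).

Lemma trunitK (V : lmodType K) : cancel (@trunit K V) (@trunit_inv K V).
Proof.
apply: tensor_ext => [||v a] //.
  exact: (comp_linear (@trunit_inv_linear _ _) (@trunit_linear _ _)).
rewrite trunitE /trunit_inv tensZl -tensZr; congr (_ \ot _); exact: mulr1.
Qed.
Lemma trunit_invK (V : lmodType K) : cancel (@trunit_inv K V) (@trunit K V).
Proof. by move=> v; rewrite trunitE scale1r. Qed.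

Definition rep_runit X : @iso (ModCat H) (rep_tens h X (rep_unit h)) X :=
  mk_iso (f := rep_runit_hom X) (@trunit_inv_linear K X)
    (@trunitK X) (@trunit_invK X).

Lemma rep_lext X Y (M : lmodType K) (f g : rep_tens h X Y -> M) :
  linear f -> linear g -> (forall x y, f (x \ot y) = g (x \ot y)) ->
  forall v, f v = g v.
Proof. exact: (@tensor_ext K X Y M f g). Qed.
Lemma rep_lextl X Y (Z : lmodType K) (f : rep_tens h X Y -> Z) y :
  linear f -> linear (fun x => f (x \ot y)).
Proof. by move=> lf; exact: (comp_linear lf (@tensl_linear K X Y y)). Qed.

Lemma rep_ext X Y Z (f g : lmodule_hom (rep_tens h X Y) Z) :
  (forall x y, f (x \ot y) = g (x \ot y)) -> f = g.
Proof.
move=> fg; apply: lhom_ext.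
exact: (@rep_lext X Y Z f g (lin f) (lin g) fg).
Qed.
Lemma rep_ext3 X Y Z T
    (f g : lmodule_hom (rep_tens h (rep_tens h X Y) Z) T) :
  (forall x y z, f ((x \ot y) \ot z) = g ((x \ot y) \ot z)) -> f = g.
Proof.
move=> fg; apply: rep_ext => w z.
exact: (@rep_lext X Y T (fun w => f (w \ot z)) (fun w => g (w \ot z))
  (@rep_lextl (rep_tens h X Y) Z T f z (lin f))
  (@rep_lextl (rep_tens h X Y) Z T g z (lin g)) (fun x y => fg x y z)).
Qed.
Lemma rep_ext4 X Y Z T S
    (f g : lmodule_hom (rep_tens h (rep_tens h (rep_tens h X Y) Z) T) S) :
  (forall x y z t,
    f (((x \ot y) \ot z) \ot t) = g (((x \ot y) \ot z) \ot t)) -> f = g.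
Proof.
move=> fg; apply: rep_ext => v t.
pose f' (v : rep_tens h (rep_tens h X Y) Z) : S := f (v \ot t).
pose g' (v : rep_tens h (rep_tens h X Y) Z) : S := g (v \ot t).
have lf' : linear f' :=
  @rep_lextl (rep_tens h (rep_tens h X Y) Z) T S f t (lin f).
have lg' : linear g' :=
  @rep_lextl (rep_tens h (rep_tens h X Y) Z) T S g t (lin g).
apply: (@rep_lext (rep_tens h X Y) Z S f' g' lf' lg') => w z.
exact: (@rep_lext X Y S (fun w => f' (w \ot z)) (fun w => g' (w \ot z))
  (@rep_lextl (rep_tens h X Y) Z S f' z lf')
  (@rep_lextl (rep_tens h X Y) Z S g' z lg') (fun x y => fg x y z t)).
Qed.

Lemma rep_assocE X Y Z (x : X) (y : Y) (z : Z) :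
  rep_assoc_hom X Y Z ((x \ot y) \ot z) = x \ot (y \ot z).
Proof. exact: tassocE. Qed.
Lemma rep_lunitE X (a : K^o) (x : X) : rep_lunit_hom X (a \ot x) = a *: x.
Proof. exact: tlunitE. Qed.
Lemma rep_runitE X (a : K^o) (x : X) : rep_runit_hom X (x \ot a) = a *: x.
Proof. exact: trunitE. Qed.

Fact rep_mtens_id X Y : rep_tensm (lhom_id X) (lhom_id Y) =
  lhom_id (rep_tens h X Y).
Proof. by apply: rep_ext => x y; rewrite rep_tensmE. Qed.
Fact rep_mtens_comp X X' X'' Y Y' Y'' (f : lmodule_hom X' X'')
    (g : lmodule_hom X X') (f' : lmodule_hom Y' Y'') (g' : lmodule_hom Y Y') :
  rep_tensm (lhom_comp f g) (lhom_comp f' g') =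
  lhom_comp (rep_tensm f f') (rep_tensm g g').
Proof.
apply: rep_ext => x y; rewrite rep_tensmE.
by rewrite [RHS](congr1 (rep_tensm f f') (rep_tensmE g g' x y)) rep_tensmE.
Qed.
Fact rep_massoc_nat X X' Y Y' Z Z' (f : lmodule_hom X X')
    (g : lmodule_hom Y Y') (k : lmodule_hom Z Z') :
  lhom_comp (rep_tensm f (rep_tensm g k)) (rep_assoc_hom X Y Z) =
  lhom_comp (rep_assoc_hom X' Y' Z') (rep_tensm (rep_tensm f g) k).
Proof.
apply: rep_ext3 => x y z.
rewrite [LHS](congr1 (rep_tensm f (rep_tensm g k)) (rep_assocE x y z)).
rewrite [RHS](congr1 (rep_assoc_hom X' Y' Z')
  (rep_tensmE (rep_tensm f g) k (x \ot y) z)).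
rewrite (rep_tensmE f (rep_tensm g k)) (rep_tensmE g k) (rep_tensmE f g).
exact/esym/rep_assocE.
Qed.
Fact rep_mlunit_nat X Y (f : lmodule_hom X Y) :
  lhom_comp f (rep_lunit_hom X) =
  lhom_comp (rep_lunit_hom Y) (rep_tensm (lhom_id (rep_unit h)) f).
Proof.
apply: rep_ext => a x.
rewrite [LHS](congr1 f (rep_lunitE a x)).
rewrite [RHS](congr1 (rep_lunit_hom Y) (rep_tensmE (lhom_id (rep_unit h)) f a x)).
by rewrite rep_lunitE; exact: (linearZ' _ (lin f)).
Qed.
Fact rep_mrunit_nat X Y (f : lmodule_hom X Y) :
  lhom_comp f (rep_runit_hom X) =
  lhom_comp (rep_runit_hom Y) (rep_tensm f (lhom_id (rep_unit h))).
Proof.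
apply: rep_ext => x a.
rewrite [LHS](congr1 f (rep_runitE a x)).
rewrite [RHS](congr1 (rep_runit_hom Y) (rep_tensmE f (lhom_id (rep_unit h)) x a)).
by rewrite rep_runitE; exact: (linearZ' _ (lin f)).
Qed.
Fact rep_mpentagon X Y Z T :
  lhom_comp (rep_assoc_hom X Y (rep_tens h Z T))
    (rep_assoc_hom (rep_tens h X Y) Z T) =
  lhom_comp (rep_tensm (lhom_id X) (rep_assoc_hom Y Z T))
    (lhom_comp (rep_assoc_hom X (rep_tens h Y Z) T)
      (rep_tensm (rep_assoc_hom X Y Z) (lhom_id T))).
Proof.
apply: rep_ext4 => x y z t.
rewrite [LHS](congr1 (rep_assoc_hom X Y (rep_tens h Z T))
  (@rep_assocE (rep_tens h X Y) Z T (x \ot y) z t)).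
rewrite [LHS](@rep_assocE X Y (rep_tens h Z T) x y (z \ot t)).
set F := rep_tensm (lhom_id X) _; set G := rep_assoc_hom X _ T.
rewrite [RHS](congr1 (fun w => F (G w))
  (rep_tensmE (rep_assoc_hom X Y Z) (lhom_id T) ((x \ot y) \ot z) t)).
rewrite [RHS](congr1 (fun w => F (G (w \ot t))) (rep_assocE x y z)).
rewrite [RHS](congr1 F (@rep_assocE X (rep_tens h Y Z) T x (y \ot z) t)).
rewrite [RHS](rep_tensmE (lhom_id X) (rep_assoc_hom Y Z T)).
by rewrite rep_assocE.
Qed.
Fact rep_mtriangle X Y :
  lhom_comp (rep_tensm (lhom_id X) (rep_lunit_hom Y))
    (rep_assoc_hom X (rep_unit h) Y) =
  rep_tensm (rep_runit_hom X) (lhom_id Y).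
Proof.
apply: rep_ext3 => x a y.
rewrite [LHS](congr1 (rep_tensm (lhom_id X) (rep_lunit_hom Y))
  (@rep_assocE X (rep_unit h) Y x a y)).
rewrite [LHS](rep_tensmE (lhom_id X) (rep_lunit_hom Y)).
rewrite [RHS](rep_tensmE (rep_runit_hom X) (lhom_id Y)).
by rewrite rep_lunitE rep_runitE tensZl tensZr.
Qed.

Definition RepCat : monoidalCategory :=
  @MonoidalCategory (ModCat H) (rep_unit h) (rep_tens h) rep_tensm
    rep_assoc rep_lunit rep_runit rep_mtens_id rep_mtens_comp rep_massoc_nat
    rep_mlunit_nat rep_mrunit_nat rep_mpentagon rep_mtriangle.

Definition finite_dim (V : lmodType K) : Prop :=
  exists n (e : 'I_n -> V), forall v,
    exists c : 'I_n -> K, v = \sum_i c i *: e i.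

Lemma finite_dim_unit : finite_dim (rep_unit h).
Proof.
exists 1%N, (fun=> 1 : K^o) => v; exists (fun=> v).
by rewrite big_ord1; exact/esym/mulr1.
Qed.

Lemma finite_dim_tens (X Y : lmodule H) :
  finite_dim X -> finite_dim Y -> finite_dim (rep_tens h X Y).
Proof.
move=> [m [e he]] [n [f hf]].
pose I := ('I_m * 'I_n)%type; exists #|{: I}|.
exists (fun i => e (enum_val i).1 \ot f (enum_val i).2).
suff H' : forall v : tensor X Y, exists c : I -> K,
    v = \sum_(i : I) c i *: (e i.1 \ot f i.2).
  move=> v; have [c ->] := H' v; exists (fun i => c (enum_val i)).
  by rewrite (reindex (@enum_val _ {: I})) //; exact/onW_bij/enum_val_bij.
elim/tensor_ind => [|x y v [c ->]].
  by exists (fun=> 0); rewrite big1 // => i _; rewrite scale0r.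
have [a ->] := he x; have [b ->] := hf y.
exists (fun i => a i.1 * b i.2 + c i).
under [RHS]eq_bigr do rewrite scalerDl.
rewrite big_split /=; congr (_ + _).
rewrite (big_morph (fun u : X => u \ot _)
  (linearD' (tensl_linear _)) (linear0' (tensl_linear _))).
under eq_bigr => i _ do rewrite (big_morph (fun w : Y => _ \ot w)
  (linearD' (tensr_linear _)) (linear0' (tensr_linear _))).
rewrite pair_big /=; apply: eq_bigr => i _.
by rewrite tensZl tensZr scalerA.
Qed.

Definition fdRepCat : monoidalCategory :=
  @full_monoidal RepCat (fun V : lmodule H => finite_dim V)
    finite_dim_unit finite_dim_tens.

End RepMonoidal.

Definition qroot (R : realType) (p : nat) : R[i] :=
  (cos (pi / p%:R) +i* sin (pi / p%:R))%C.

(* [gak'], [gaK'], [gsK1'], [gsK2'] are the inverses of [gak], [gaK], ... *)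
Inductive gen_a := gaB | gaF | gaC | gaE | gak | gak' | gaK | gaK'.
Inductive gen_s := gsF1 | gsF2 | gsphi1 | gsphi2 | gsK1 | gsK1' | gsK2 | gsK2'.

HB.instance Definition _ := gen_eqMixin gen_a.
HB.instance Definition _ := gen_choiceMixin gen_a.
HB.instance Definition _ := gen_eqMixin gen_s.
HB.instance Definition _ := gen_choiceMixin gen_s.

(* The defining relations, read in any algebra A for a family g of elements. *)
Section Relations.
Variables (K : fieldType) (p : nat) (q xi : K) (A : algType K).

Definition Ua_rel (g : gen_a -> A) : seq (A * A) :=
  let B := g gaB in let F := g gaF in
  let C := g gaC in let E := g gaE in
  let k := g gak in let k' := g gak' in
  let K := g gaK in let K' := g gaK' in
  [:: (k * k', 1); (k' * k, 1); (K * K', 1); (K' * K, 1);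
      (K ^+ (2 * p), 1); (k ^+ (2 * p), 1); (k * K, K * k);
      (K * F, q ^- 2 *: (F * K)); (K * E, q ^+ 2 *: (E * K));
      (E * F - F * E, (q - q^-1)^-1 *: (K - K'));
      (F ^+ p, 0); (E ^+ p, 0);
      (k * E, (xi * q^-1) *: (E * k)); (k * F, (xi * q) *: (F * k));
      (k * B, - (B * k)); (K * B, (xi * q) *: (B * K));
      (k * C, - (C * k)); (K * C, (xi * q^-1) *: (C * K));
      (B ^+ 2, 0); (C ^+ 2, 0);
      (B * C - C * B, (q - q^-1)^-1 *: (k - k'));
      (F * C - C * F, 0); (B * E - E * B, 0)] ++
  (if p == 2 then
     [:: (B * F * B * F, F * B * F * B); (C * E * C * E, E * C * E * C)]
   else
     [:: (F * F * B - (xi * (q + q^-1)) *: (F * B * F) + B * F * F, 0);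
         (E * E * C - (xi * (q + q^-1)) *: (E * C * E) + C * E * E, 0)]).

Definition Us_rel (g : gen_s -> A) : seq (A * A) :=
  let F1 := g gsF1 in let F2 := g gsF2 in
  let phi1 := g gsphi1 in let phi2 := g gsphi2 in
  let K1 := g gsK1 in let K1' := g gsK1' in
  let K2 := g gsK2 in let K2' := g gsK2' in
  [:: (K1 * K1', 1); (K1' * K1, 1); (K2 * K2', 1); (K2' * K2, 1);
      (K1 ^+ (2 * p), 1); (K2 ^+ (2 * p), 1); (K1 * K2, K2 * K1);
      (F1 ^+ 2, 0); (F2 ^+ 2, 0);
      ((F1 * F2) ^+ p - xi ^- p *: (F2 * F1) ^+ p, 0);
      (phi1 ^+ 2, 0); (phi2 ^+ 2, 0);
      ((phi1 * phi2) ^+ p - xi ^- p *: (phi2 * phi1) ^+ p, 0);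
      (K1 * F1 * K1', - F1); (K1 * F2 * K1', - ((xi * q^-1) *: F2));
      (K2 * F1 * K2', - ((xi * q^-1) *: F1)); (K2 * F2 * K2', - F2);
      (K1 * phi1 * K1', - phi1); (K1 * phi2 * K1', - ((xi * q) *: phi2));
      (K2 * phi1 * K2', - ((xi * q) *: phi1)); (K2 * phi2 * K2', - phi2);
      (F1 * phi1 - phi1 * F1, K1 - K1'); (F2 * phi2 - phi2 * F2, K2 - K2');
      (F1 * phi2 - phi2 * F1, 0); (F2 * phi1 - phi1 * F2, 0)].

End Relations.

Section Presentations.
Variables (K : fieldType) (p : nat) (q xi : K).

Section RelMap.
Variables (A B : algType K) (f : {lrmorphism A -> B}).

Let fD x y : f (x + y) = f x + f y. Proof. exact: rmorphD. Qed.
Let fN x : f (- x) = - f x. Proof. exact: rmorphN. Qed.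
Let fM x y : f (x * y) = f x * f y. Proof. exact: rmorphM. Qed.
Let fX n x : f (x ^+ n) = f x ^+ n. Proof. exact: rmorphXn. Qed.
Let fZ a x : f (a *: x) = a *: f x. Proof. exact: linearZ. Qed.
Let f1 : f 1 = 1. Proof. exact: rmorph1. Qed.
Let f0 : f 0 = 0. Proof. exact: rmorph0. Qed.
Let fE := (fD, fN, fM, fX, fZ, f1, f0).

Lemma Ua_rel_map (g : gen_a -> A) :
  Ua_rel p q xi (fun x => f (g x)) = [seq (f r.1, f r.2) | r <- Ua_rel p q xi g].
Proof.
rewrite /Ua_rel map_cat; congr cat; last case: (p == 2)%N;
  by cbv beta iota zeta delta [map fst snd]; rewrite !fE ?expr2.
Qed.

Lemma Us_rel_map (g : gen_s -> A) :
  Us_rel p q xi (fun x => f (g x)) = [seq (f r.1, f r.2) | r <- Us_rel p q xi g].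
Proof.
by rewrite /Us_rel; cbv beta iota zeta delta [map fst snd]; rewrite !fE ?expr2.
Qed.

End RelMap.

Definition eps_a (g : gen_a) : K^o :=
  if g is (gaB | gaF | gaC | gaE) then 0 else 1.
Definition eps_s (g : gen_s) : K^o :=
  if g is (gsF1 | gsF2 | gsphi1 | gsphi2) then 0 else 1.

Hypothesis hp : (2 <= p)%N.

Let ring0 (A : nzRingType) : (0 : A) ^+ p = 0.
Proof. by rewrite expr0n; case: p hp. Qed.
Let ring00 (A : nzRingType) : (0 : A) ^+ 2 = 0.
Proof. by rewrite expr0n. Qed.

Fact Ua_aug : exists h : gen_a -> K^o,
  forall r, r \in Ua_rel p q xi (@fvar K gen_a) -> feval h r.1 = feval h r.2.
Proof.
exists eps_a => r hr.
have : (feval eps_a r.1, feval eps_a r.2) \in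
    Ua_rel p q xi (fun x => feval eps_a (fvar K x)).
  by rewrite Ua_rel_map; apply/mapP; exists r.
have -> : (fun x => feval eps_a (fvar K x)) = eps_a.
  by apply/funext => x; rewrite feval_var.
suff /allP h : all (fun r : K^o * K^o => r.1 == r.2) (Ua_rel p q xi eps_a).
  by move=> /h /= /eqP.
rewrite /Ua_rel all_cat; apply/andP; split; last case: (p == 2)%N;
  cbv beta iota zeta delta [all fst snd eps_a];
  by rewrite ?(mulr0, mul0r, mulr1, ring0, ring00, scaler0, subrr, oppr0,
    expr1n, addr0, eqxx).
Qed.

Fact Us_aug : exists h : gen_s -> K^o,
  forall r, r \in Us_rel p q xi (@fvar K gen_s) -> feval h r.1 = feval h r.2.
Proof.
exists eps_s => r hr.
have : (feval eps_s r.1, feval eps_s r.2) \in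
    Us_rel p q xi (fun x => feval eps_s (fvar K x)).
  by rewrite Us_rel_map; apply/mapP; exists r.
have -> : (fun x => feval eps_s (fvar K x)) = eps_s.
  by apply/funext => x; rewrite feval_var.
suff /allP h : all (fun r : K^o * K^o => r.1 == r.2) (Us_rel p q xi eps_s).
  by move=> /h /= /eqP.
rewrite /Us_rel; cbv beta iota zeta delta [all fst snd eps_s].
by rewrite ?(mulr0, mul0r, mulr1, ring0, ring00, scaler0, subrr, oppr0, expr1n,
  addr0, eqxx).
Qed.

Definition Ua_pres : presentation K := Presentation Ua_aug.
Definition Us_pres : presentation K := Presentation Us_aug.

Definition Ua : algType K := presAlg Ua_pres.
Definition Us : algType K := presAlg Us_pres.

Definition Ua_gen (g : gen_a) : Ua := @pvar K Ua_pres g.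
Definition Us_gen (g : gen_s) : Us := @pvar K Us_pres g.

(* With the Hopf axioms these values determine the structure; in particular
   S(k) = k^-1 and S(K) = K^-1. *)
Definition Ua_hopf_spec (h : hopfAlgebra Ua) : Prop :=
  let B := Ua_gen gaB in let F := Ua_gen gaF in
  let C := Ua_gen gaC in let E := Ua_gen gaE in
  let k := Ua_gen gak in let k' := Ua_gen gak' in
  let K := Ua_gen gaK in let K' := Ua_gen gaK' in
  [/\ [/\ hdelta h F = F \ot 1 + K' \ot F,
          hdelta h E = E \ot K + 1 \ot E,
          hdelta h B = B \ot 1 + k' \ot B &
          hdelta h C = C \ot k + 1 \ot C],
      hdelta h k = k \ot k /\ hdelta h K = K \ot K,
      [/\ hS h B = - (k * B), hS h F = - (K * F),
          hS h C = - (C * k') & hS h E = - (E * K')],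
      [/\ heps h B = 0, heps h F = 0, heps h C = 0 & heps h E = 0] &
      heps h k = 1 /\ heps h K = 1].

Definition Us_hopf_spec (h : hopfAlgebra Us) : Prop :=
  let F1 := Us_gen gsF1 in let F2 := Us_gen gsF2 in
  let phi1 := Us_gen gsphi1 in let phi2 := Us_gen gsphi2 in
  let K1 := Us_gen gsK1 in let K1' := Us_gen gsK1' in
  let K2 := Us_gen gsK2 in let K2' := Us_gen gsK2' in
  [/\ [/\ hdelta h F1 = F1 \ot 1 + K1' \ot F1,
          hdelta h F2 = F2 \ot 1 + K2' \ot F2,
          hdelta h phi1 = phi1 \ot K1 + 1 \ot phi1 &
          hdelta h phi2 = phi2 \ot K2 + 1 \ot phi2],
      hdelta h K1 = K1 \ot K1 /\ hdelta h K2 = K2 \ot K2,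
      [/\ hS h F1 = - (K1 * F1), hS h F2 = - (K2 * F2),
          hS h phi1 = - (phi1 * K1') & hS h phi2 = - (phi2 * K2')],
      [/\ heps h F1 = 0, heps h F2 = 0, heps h phi1 = 0 & heps h phi2 = 0] &
      heps h K1 = 1 /\ heps h K2 = 1].

End Presentations.

(* Main.v *)
From HB Require Import structures.
Require Import Defs.
From mathcomp Require Import all_boot all_order all_algebra.
From mathcomp Require Import mathcomp_extra boolp reals trigo complex.
From mathcomp Require Import finmap monalg.
From mathcomp Require Import ring.
Set Implicit Arguments.
Unset Strict Implicit.
Unset Printing Implicit Defensive.
Import Order.TTheory GRing.Theory Num.Theory.
Local Open Scope ring_scope.

(** Put f = xi BF - q^-1 FB.  The Serre relation between B and F says that
    F f = xi q^-1 f F, and it forces f^2 = 0; conversely, for x^2 = y^2 = 0 the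
    identity (xy + xi q yx)^p = (xy)^p - xi^-p (yx)^p turns F^p = 0 into the
    relation of order 2p of U_s.  So sigma and its inverse respect the defining
    relations, and everything else about them is a finite computation with
    words in the generators, done by reflection.

    The coproduct of U_a respects F^p = E^p = 0 because the Gaussian binomials
    [p, j], 0 < j < p, vanish at q^2.  The Hopf structure of U_s is transported:
    tau (x) tau (Phi^-1 Delta_a(sigma x) Phi) and tau (U S_a(sigma x) U^-1), with
    tau the inverse of sigma, take the prescribed values on the generators, so
    that the relations of U_s need not be checked against Delta_s and S_s.

    The monoidal equivalence is restriction along sigma, with the action of Phi
    on X (x) Y as its monoidal structure. *)

(** * Rewriting in a noncommutative algebra, by reflection *)

(** Only two facts about q enter: q^p = -1, and q^2 has order exactly p.

    Relations whose degree grows with p are out of reach of word rewriting; they are settled through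
    closed formulas for (xy + xi q yx)^p, (x + y)^p and (xy)^p. All others have bounded degree.

    The case p = 2 is singular: there q + q^-1 = 0, so that BFBF = FBFB, obtained for p <> 2 by
    dividing the Serre relation by xi (q + q^-1), has to be given, and some coefficients vanish only
    modulo q^2 = -1.

    Identities are stated for an arbitrary family satisfying the relations, not for the generators
    themselves. They then apply alike in U_a and to the two commuting copies of U_a inside U_a (x)
    U_a. The antipode S_a comes from the universal property as a morphism into the opposite algebra.

    The element U is the one of Drinfeld's theory of twists: U = m (id (x) S_a)(Phi^-1), with
    inverse m (S_a (x) id)(Phi). *)

Inductive scal :=
  | SVar of nat | SOne | SAdd of scal & scal | SMul of scal & scal | SOpp of scal.
Definition ncword := seq nat.
Definition ncpoly := seq (scal * ncword).
Definition ncrule := (ncword * ncpoly)%type.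
Inductive ncexp :=
  | NVar of nat | NZero | NOne | NAdd of ncexp & ncexp | NOpp of ncexp
  | NMul of ncexp & ncexp | NScale of scal & ncexp | NExp of ncexp & nat.

Definition smul (a b : scal) : scal :=
  match a, b with SOne, _ => b | _, SOne => a | _, _ => SMul a b end.

Definition npmul (p1 p2 : ncpoly) : ncpoly :=
  flatten [seq [seq (smul x.1 y.1, x.2 ++ y.2) | y <- p2] | x <- p1].

Fixpoint nppow (p : ncpoly) n : ncpoly :=
  if n is m.+1 then npmul p (nppow p m) else [:: (SOne, [::])].

Fixpoint ncnorm (e : ncexp) : ncpoly :=
  match e with
  | NVar i => [:: (SOne, [:: i])]
  | NZero => [::]
  | NOne => [:: (SOne, [::])]
  | NAdd a b => ncnorm a ++ ncnorm b
  | NOpp a => [seq (SOpp x.1, x.2) | x <- ncnorm a]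
  | NMul a b => npmul (ncnorm a) (ncnorm b)
  | NScale c a => [seq (smul c x.1, x.2) | x <- ncnorm a]
  | NExp a n => nppow (ncnorm a) n
  end.

Fixpoint strip (l w : ncword) : option ncword :=
  match l, w with
  | [::], _ => Some w
  | i :: l', j :: w' => if Nat.eqb i j then strip l' w' else None
  | _, _ => None
  end.

Fixpoint rule_at (rs : seq ncrule) (w : ncword) : option ncpoly :=
  if rs is r :: rs' then
    if strip r.1 w is Some v then Some [seq (x.1, x.2 ++ v) | x <- r.2]
    else rule_at rs' w
  else None.

Fixpoint step (rs : seq ncrule) (w : ncword) : option ncpoly :=
  if rule_at rs w is Some p then Some p else
  if w is i :: w' then
    if step rs w' is Some p then Some [seq (x.1, i :: x.2) | x <- p] else None
  else None.

Fixpoint reduce (rs : seq ncrule) (fuel : nat) (p : ncpoly) : ncpoly :=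
  if fuel is n.+1 then
    flatten [seq if step rs x.2 is Some p'
                 then reduce rs n [seq (smul x.1 y.1, y.2) | y <- p']
                 else [:: x] | x <- p]
  else p.

Fixpoint weqb (v w : ncword) : bool :=
  match v, w with
  | [::], [::] => true
  | i :: v', j :: w' => Nat.eqb i j && weqb v' w'
  | _, _ => false
  end.

Fixpoint insert_term (c : scal) (w : ncword) (p : ncpoly) : ncpoly :=
  if p is x :: p' then
    if weqb w x.2 then (SAdd c x.1, w) :: p' else x :: insert_term c w p'
  else [:: (c, w)].

Definition collect (p : ncpoly) : ncpoly :=
  foldr (fun x p' => insert_term x.1 x.2 p') [::] p.

Definition shift_rules (d : nat) (rs : seq ncrule) : seq ncrule :=
  [seq ([seq (d + i)%N | i <- r.1],
        [seq (x.1, [seq (d + i)%N | i <- x.2]) | x <- r.2]) | r <- rs].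

Section Denotation.
Variables (K : fieldType) (A : algType K) (ce : seq K) (ae : seq A).

Fixpoint sden (c : scal) : K :=
  match c with
  | SVar n => nth 0 ce n
  | SOne => 1
  | SAdd a b => sden a + sden b
  | SMul a b => sden a * sden b
  | SOpp a => - sden a
  end.

(** The one-letter case avoids a trailing factor 1, so that a rule unfolds by computation to a
    relation in its usual form. *)
Fixpoint wden (w : ncword) : A :=
  match w with
  | [::] => 1
  | [:: i] => nth 0 ae i
  | i :: w' => nth 0 ae i * wden w'
  end.

Fixpoint pden (p : ncpoly) : A :=
  match p with
  | [::] => 0
  | [:: x] => sden x.1 *: wden x.2
  | x :: p' => sden x.1 *: wden x.2 + pden p'
  end.

Fixpoint eden (e : ncexp) : A :=
  match e with
  | NVar i => nth 0 ae i
  | NZero => 0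
  | NOne => 1
  | NAdd a b => eden a + eden b
  | NOpp a => - eden a
  | NMul a b => eden a * eden b
  | NScale c a => sden c *: eden a
  | NExp a n => eden a ^+ n
  end.

Fixpoint rules_hold (rs : seq ncrule) : Prop :=
  if rs is r :: rs' then wden r.1 = pden r.2 /\ rules_hold rs' else True.

Fixpoint all_zero (p : ncpoly) : Prop :=
  if p is x :: p' then sden x.1 = 0 /\ all_zero p' else True.

Lemma wden_cons i w : wden (i :: w) = nth 0 ae i * wden w.
Proof. by case: w => //=; rewrite mulr1. Qed.

Lemma wden_cat v w : wden (v ++ w) = wden v * wden w.
Proof.
by elim: v => [|i v IH]; rewrite ?mul1r // cat_cons !wden_cons IH mulrA.
Qed.

Lemma pden_cons x p : pden (x :: p) = sden x.1 *: wden x.2 + pden p.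
Proof. by case: p => //=; rewrite addr0. Qed.

Lemma pdenE p : pden p = \sum_(x <- p) sden x.1 *: wden x.2.
Proof. by elim: p => [|x p IH]; rewrite ?big_nil // pden_cons big_cons IH. Qed.

Lemma pden_cat p1 p2 : pden (p1 ++ p2) = pden p1 + pden p2.
Proof. by rewrite !pdenE big_cat. Qed.

Lemma sden_smul a b : sden (smul a b) = sden a * sden b.
Proof. by case: a; case: b => *; rewrite /= ?mul1r ?mulr1. Qed.

Lemma pden_npmul p1 p2 : pden (npmul p1 p2) = pden p1 * pden p2.
Proof.
rewrite !pdenE /npmul big_flatten /= big_map mulr_suml; apply: eq_bigr => x _.
rewrite big_map mulr_sumr; apply: eq_bigr => y _ /=.
by rewrite sden_smul wden_cat -scalerAl -scalerAr scalerA.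
Qed.

Lemma pden_scale c p :
  pden [seq (smul c x.1, x.2) | x <- p] = sden c *: pden p.
Proof.
rewrite !pdenE big_map scaler_sumr; apply: eq_bigr => x _ /=.
by rewrite sden_smul scalerA.
Qed.

Lemma pden_norm e : pden (ncnorm e) = eden e.
Proof.
elim: e => /= [i|||a IHa b IHb|a IH|a IHa b IHb|c a IH|a IH n].
- by rewrite scale1r.
- by [].
- by rewrite scale1r.
- by rewrite pden_cat IHa IHb.
- rewrite -IH !pdenE big_map -sumrN; apply: eq_bigr => x _ /=.
  by rewrite scaleNr.
- by rewrite pden_npmul IHa IHb.
- by rewrite pden_scale IH.
elim: n => [|n IHn] /=; first by rewrite scale1r.
by rewrite pden_npmul IH IHn exprS.
Qed.

Lemma stripP l w v : strip l w = Some v -> w = l ++ v.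
Proof.
elim: l w => [|i l IH] [|j w] //= => [[]|[]|] //.
by case: (Nat.eqb i j) (PeanoNat.Nat.eqb_eq i j) => // -[/(_ erefl) ->] _ /IH ->.
Qed.

Lemma rule_atP rs w p : rules_hold rs -> rule_at rs w = Some p -> wden w = pden p.
Proof.
elim: rs => //= r rs IH [hr hrs]; case E: (strip r.1 w) => [v|]; last exact: IH.
case=> <-; rewrite (stripP E) wden_cat hr !pdenE big_map mulr_suml.
by apply: eq_bigr => x _ /=; rewrite wden_cat scalerAl.
Qed.

Lemma stepP rs w p : rules_hold rs -> step rs w = Some p -> wden w = pden p.
Proof.
move=> hrs; elim: w p => [|i w IH] p /=; case E: (rule_at rs _) => [p'|] //.
- by case=> <-; exact: rule_atP E.
- by case=> <-; exact: rule_atP E.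
case E': (step rs w) => [p'|] // [<-]; rewrite -/(wden (i :: w)) wden_cons.
rewrite (IH _ E') !pdenE big_map mulr_sumr; apply: eq_bigr => x _.
by rewrite wden_cons scalerAr.
Qed.

Lemma reduceP rs n p : rules_hold rs -> pden (reduce rs n p) = pden p.
Proof.
move=> hrs; elim: n p => //= n IH p.
rewrite !pdenE big_flatten /= big_map; apply: eq_bigr => x _.
case E: (step rs x.2) => [p'|]; last by rewrite big_seq1.
by rewrite -pdenE IH pden_scale (stepP hrs E).
Qed.

Lemma weqbP v w : weqb v w -> v = w.
Proof.
elim: v w => [|i v IH] [|j w] //= /andP[+ /IH ->].
by case: (Nat.eqb i j) (PeanoNat.Nat.eqb_eq i j) => // -[/(_ erefl) ->].
Qed.

Lemma collectP p : pden (collect p) = pden p.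
Proof.
elim: p => //= x p IH; rewrite -/(pden (x :: p)) pden_cons -IH; move: (collect p).
elim=> [|y p' IHp]; first by rewrite /= addr0.
rewrite /insert_term -/insert_term.
case: ifP => [/weqbP e|_]; rewrite !pden_cons ?IHp /=.
  by rewrite scalerDl addrA e.
by rewrite addrCA.
Qed.

Lemma all_zeroP p : all_zero p -> pden p = 0.
Proof. by elim: p => // x p IH [h /IH hp]; rewrite pden_cons h hp scale0r addr0. Qed.

(** The variable [p] is there to be instantiated by evaluation; [all_zero p] then leaves one scalar
    equation per remaining word. Only soundness is claimed: the rules may be non-confluent and the
    fuel may run out. *)
Lemma ncrewrite rs n e1 e2 p :
  collect (reduce rs n (ncnorm (NAdd e1 (NOpp e2)))) = p ->
  rules_hold rs -> all_zero p -> eden e1 = eden e2.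
Proof.
move=> <- hrs /all_zeroP; rewrite collectP reduceP // pden_norm /=.
by move/eqP; rewrite subr_eq0 => /eqP.
Qed.

Lemma rules_hold_cat rs1 rs2 :
  rules_hold rs1 -> rules_hold rs2 -> rules_hold (rs1 ++ rs2).
Proof. by elim: rs1 => //= r rs IH [hr hrs] h; split=> //; exact: IH. Qed.

End Denotation.

Lemma wden_shift (K : fieldType) (A : algType K) (ae : seq A) d w :
  wden ae [seq (d + i)%N | i <- w] = wden (drop d ae) w.
Proof.
by elim: w => // i w IH; rewrite map_cons !wden_cons IH nth_drop.
Qed.

Lemma rules_hold_shift (K : fieldType) (A : algType K) (ce : seq K) (ae : seq A)
    d rs :
  rules_hold ce (drop d ae) rs -> rules_hold ce ae (shift_rules d rs).
Proof.
elim: rs => //= r rs IH [hr /IH hrs]; split=> //=.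
rewrite wden_shift hr !pdenE big_map; apply: eq_bigr => x _ /=.
by rewrite wden_shift.
Qed.

(** [nth] gives 0 beyond the end of the list, so appending letters changes the meaning of larger
    indices; the bound excludes them. *)
Definition rule_within (n : nat) (r : ncrule) : bool :=
  all (gtn n) r.1 && all (fun x => all (gtn n) x.2) r.2.

Lemma wden_catl (K : fieldType) (A : algType K) (ae be : seq A) w :
  all (gtn (size ae)) w -> wden (ae ++ be) w = wden ae w.
Proof.
elim: w => // i w IH /= /andP[hi /IH hw].
by rewrite -!/(wden _ (i :: w)) !wden_cons hw nth_cat hi.
Qed.

Lemma pden_catl (K : fieldType) (A : algType K) (ce : seq K) (ae be : seq A) p :
  all (fun x => all (gtn (size ae)) x.2) p -> pden ce (ae ++ be) p = pden ce ae p.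
Proof.
elim: p => // x p IH /= /andP[hx /IH hp].
by rewrite -!/(pden _ _ (x :: p)) !pden_cons hp wden_catl.
Qed.

Lemma rules_hold_catl (K : fieldType) (A : algType K) (ce : seq K)
    (ae be : seq A) rs :
  all (rule_within (size ae)) rs ->
  rules_hold ce ae rs -> rules_hold ce (ae ++ be) rs.
Proof.
elim: rs => //= r rs IH /andP[hw /IH hrs] [hr /hrs hs]; split=> //.
by have [h1 h2] := andP hw; rewrite wden_catl // pden_catl.
Qed.

Ltac seq_index x s :=
  let s := eval hnf in s in
  lazymatch s with
  | x :: _ => constr:(O)
  | _ :: ?s' => let n := seq_index x s' in constr:(S n)
  end.

Ltac reify_scal ce c :=
  lazymatch c with
  | @GRing.one _ => constr:(SOne)
  | @GRing.mul _ ?a ?b =>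
      let a := reify_scal ce a in let b := reify_scal ce b in constr:(SMul a b)
  | @GRing.add _ ?a ?b =>
      let a := reify_scal ce a in let b := reify_scal ce b in constr:(SAdd a b)
  | @GRing.opp _ ?a => let a := reify_scal ce a in constr:(SOpp a)
  | _ => let n := seq_index c ce in constr:(SVar n)
  end.

Ltac reify_nc ce ae e :=
  lazymatch e with
  | @GRing.zero _ => constr:(NZero)
  | @GRing.one _ => constr:(NOne)
  | @GRing.mul _ ?a ?b =>
      let a := reify_nc ce ae a in let b := reify_nc ce ae b in constr:(NMul a b)
  | @GRing.add _ ?a ?b =>
      let a := reify_nc ce ae a in let b := reify_nc ce ae b in constr:(NAdd a b)
  | @GRing.opp _ ?a => let a := reify_nc ce ae a in constr:(NOpp a)
  | @GRing.scale _ _ ?c ?a =>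
      let c := reify_scal ce c in let a := reify_nc ce ae a in
      constr:(NScale c a)
  | @GRing.exp _ ?a 2 => let a := reify_nc ce ae a in constr:(NExp a 2)
  | _ => let n := seq_index e ae in constr:(NVar n)
  end.

(* Rewriting stops at depth 100; a bound that is too small can only leave scalar
   goals that are false. *)
Ltac nc H :=
  lazymatch type of H with
  | @rules_hold _ ?A ?ce ?ae ?rs =>
    lazymatch goal with |- ?x = ?y =>
      let x := reify_nc ce ae x in let y := reify_nc ce ae y in
      refine (@ncrewrite _ A ce ae rs 100 x y _ _ H _);
      [vm_compute; reflexivity | cbn [all_zero sden fst nth]]
    end
  end.

(* [xi = 1 \/ xi = -1] and the nonvanishing of q and q^2 - 1 are taken from the
   context. *)
Ltac scalars :=
  repeat split;
  match goal with hxi : _ = 1 \/ _ = -1 |- _ =>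
    let h := fresh in destruct hxi as [h|h]; rewrite ?h end;
  field; by do ?(apply/andP; split).

Definition sat (K : fieldType) (A : algType K) (s : seq (A * A)) : Prop :=
  forall r, r \in s -> r.1 = r.2.

Lemma satP (K : fieldType) (A : algType K) (s : seq (A * A)) :
  sat s <-> foldr (fun r P => r.1 = r.2 /\ P) True s.
Proof.
rewrite /sat; elim: s => //= r s IH; split=> [h|[h hs] x].
  split; first by apply: h; rewrite inE eqxx.
  by apply/IH => x hx; apply: h; rewrite inE hx orbT.
by rewrite inE => /orP[/eqP -> //|]; apply: (IH.2 hs).
Qed.

Lemma sat_cat (K : fieldType) (A : algType K) (s1 s2 : seq (A * A)) :
  sat (s1 ++ s2) <-> sat s1 /\ sat s2.
Proof.
split=> [h|[h1 h2] r]; last by rewrite mem_cat => /orP[/h1|/h2].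
by split=> r hr; apply: h; rewrite mem_cat hr ?orbT.
Qed.

Section Rules.
Let q := SVar 0.
Let qV := SVar 1.
Let xi := SVar 2.
Let t := SVar 3.
Let m1 := SOpp SOne.
Let swap i j c : ncrule := ([:: i; j], [:: (c, [:: j; i])]).
(** Letters 4 to 7 move to the right of the others. With the rules below, a reduced word follows the
    triangular decomposition: a word in letters 0, 1, then one in letters 2, 3, then a word in the
    torus. *)
Let torus : seq ncrule :=
  [:: ([:: 4; 5], [:: (SOne, [::])]); ([:: 5; 4], [:: (SOne, [::])]);
      ([:: 6; 7], [:: (SOne, [::])]); ([:: 7; 6], [:: (SOne, [::])]);
      swap 6 4 SOne; swap 6 5 SOne; swap 7 4 SOne; swap 7 5 SOne]%N.

(* Letters: 0 = B, 1 = F, 2 = C, 3 = E, 4 = k, 5 = k^-1, 6 = K, 7 = K^-1.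
   Scalars: 0 = q, 1 = q^-1, 2 = xi, 3 = (q - q^-1)^-1. *)
Definition Ua_rules : seq ncrule :=
  torus ++
  [:: swap 4 1 (SMul xi q); swap 5 1 (SMul xi qV);
      swap 4 3 (SMul xi qV); swap 5 3 (SMul xi q);
      swap 4 0 m1; swap 5 0 m1; swap 4 2 m1; swap 5 2 m1;
      swap 6 1 (SMul qV qV); swap 7 1 (SMul q q);
      swap 6 3 (SMul q q); swap 7 3 (SMul qV qV);
      swap 6 0 (SMul xi q); swap 7 0 (SMul xi qV);
      swap 6 2 (SMul xi qV); swap 7 2 (SMul xi q);
      ([:: 3; 1], [:: (SOne, [:: 1; 3]); (t, [:: 6]); (SOpp t, [:: 7])]);
      ([:: 2; 0], [:: (SOne, [:: 0; 2]); (SOpp t, [:: 4]); (t, [:: 5])]);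
      swap 2 1 SOne; swap 3 0 SOne; ([:: 0; 0], [::]); ([:: 2; 2], [::])]%N.

(** For p <> 2 the quartic rules resolve an overlap: [FFBB] reduces to 0 through [BB], but to a
    multiple of [FBFB - BFBF] through [FFB]. For p = 2 the relations F^p = E^p = 0 have degree two
    and are rules themselves. *)
Definition Serre_rules (p : nat) : seq ncrule :=
  if p == 2 then
    [:: ([:: 1; 1], [::]); ([:: 3; 3], [::]);
        ([:: 1; 0; 1; 0], [:: (SOne, [:: 0; 1; 0; 1])]);
        ([:: 3; 2; 3; 2], [:: (SOne, [:: 2; 3; 2; 3])])]%N
  else
    [:: ([:: 1; 1; 0], [:: (SMul xi (SAdd q qV), [:: 1; 0; 1]); (m1, [:: 0; 1; 1])]);
        ([:: 3; 3; 2], [:: (SMul xi (SAdd q qV), [:: 3; 2; 3]); (m1, [:: 2; 3; 3])]);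
        ([:: 1; 0; 1; 0], [:: (SOne, [:: 0; 1; 0; 1])]);
        ([:: 3; 2; 3; 2], [:: (SOne, [:: 2; 3; 2; 3])])]%N.

(* Letters: 0 = F1, 1 = F2, 2 = phi1, 3 = phi2, 4 = K1, 5 = K1^-1, 6 = K2,
   7 = K2^-1. *)
Definition Us_rules : seq ncrule :=
  torus ++
  [:: swap 4 0 m1; swap 5 0 m1; swap 6 1 m1; swap 7 1 m1;
      swap 4 2 m1; swap 5 2 m1; swap 6 3 m1; swap 7 3 m1;
      swap 4 1 (SOpp (SMul xi qV)); swap 5 1 (SOpp (SMul xi q));
      swap 6 0 (SOpp (SMul xi qV)); swap 7 0 (SOpp (SMul xi q));
      swap 4 3 (SOpp (SMul xi q)); swap 5 3 (SOpp (SMul xi qV));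
      swap 6 2 (SOpp (SMul xi q)); swap 7 2 (SOpp (SMul xi qV));
      ([:: 2; 0], [:: (SOne, [:: 0; 2]); (m1, [:: 4]); (SOne, [:: 5])]);
      ([:: 3; 1], [:: (SOne, [:: 1; 3]); (m1, [:: 6]); (SOne, [:: 7])]);
      swap 3 0 SOne; swap 2 1 SOne;
      ([:: 0; 0], [::]); ([:: 1; 1], [::]); ([:: 2; 2], [::]); ([:: 3; 3], [::])]%N.

End Rules.

(** * Commutation relations in an algebra *)

Lemma exprD_orth (A : nzRingType) (x y : A) n :
  x * y = 0 -> y * x = 0 -> (x + y) ^+ n.+1 = x ^+ n.+1 + y ^+ n.+1.
Proof.
move=> xy yx; elim: n => [|n IH]; first by rewrite !expr1.
have xyn : x * y ^+ n.+1 = 0 by rewrite exprS mulrA xy mul0r.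
have yxn : y * x ^+ n.+1 = 0 by rewrite exprS mulrA yx mul0r.
by rewrite exprS IH mulrDl !mulrDr xyn yxn addr0 add0r -!exprS.
Qed.

Section Commutation.
Variables (L : fieldType) (A : algType L).

Lemma swap_inv (k k' x : A) (c d : L) :
  k * k' = 1 -> k' * k = 1 -> k * x = c *: (x * k) -> c * d = 1 ->
  k' * x = d *: (x * k').
Proof.
move=> kk' k'k kx cd.
have -> : x * k' = c *: (k' * x).
  rewrite -[x * k']mul1r -k'k -!mulrA (mulrA k) kx -scalerAl -!mulrA kk' mulr1.
  by rewrite scalerAr.
by rewrite scalerA mulrC cd scale1r.
Qed.

Lemma swap_conj (k k' x : A) (c : L) :
  k' * k = 1 -> k * x * k' = c *: x -> k * x = c *: (x * k).
Proof. by move=> k'k h; rewrite scalerAl -h -!mulrA k'k mulr1. Qed.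

Lemma torus_swap (k k' l l' : A) :
  k * k' = 1 -> k' * k = 1 -> l * l' = 1 -> l' * l = 1 -> k * l = l * k ->
  [/\ l * k = 1 *: (k * l), l * k' = 1 *: (k' * l), l' * k = 1 *: (k * l') &
      l' * k' = 1 *: (k' * l')].
Proof.
move=> kk k'k ll l'l kl.
have c11 : 1 * 1 = 1 :> L by rewrite mulr1.
have h1 : l * k = 1 *: (k * l) by rewrite scale1r.
have h2 : k' * l = 1 *: (l * k').
  by apply: (swap_inv kk k'k _ c11); rewrite scale1r.
split=> //; first by rewrite h2 !scale1r.
  exact: (swap_inv ll l'l h1 c11).
by apply: (swap_inv ll l'l _ c11); rewrite h2 !scale1r.
Qed.

(** Multiplying the relation by x on the left and on the right expresses [x * y * y * x] as c times
    either side. *)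
Lemma Serre_commute (x y : A) (c : L) : c != 0 -> x ^+ 2 = 0 ->
  y * y * x - c *: (y * x * y) + x * y * y = 0 -> y * x * y * x = x * y * x * y.
Proof.
rewrite expr2 => c0 xx h.
have hl : x * y * y * x = c *: (x * y * x * y).
  apply/eqP; rewrite -subr_eq0; apply/eqP; move/(congr1 ( *%R x)): h.
  by rewrite mulr0 !mulrDr mulrN -scalerAr !mulrA xx !mul0r addr0.
have hr : x * y * y * x = c *: (y * x * y * x).
  apply/eqP; rewrite -subr_eq0; apply/eqP; move/(congr1 ( *%R^~ x)): h.
  by rewrite mul0r !mulrDl mulNr -scalerAl -(mulrA _ x x) xx mulr0 add0r addrC.
by apply: (scalerI c0); rewrite -hl.
Qed.

Lemma inv_expr (x y : A) n :
  x * y = 1 -> y * x = 1 -> x ^+ n = 1 -> y ^+ n = 1.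
Proof.
move=> xy yx xn.
by rewrite -[LHS]mul1r -xn -exprMn_comm ?xy ?expr1n // /GRing.comm xy yx.
Qed.

(** Reordering gives (xy)^n = d x^n y^n for some scalar d, whose value does not matter. It serves
    for the powers of S_a(F) and S_a(E). *)
Lemma skew_expr0 (x y : A) (c : L) n :
  y * x = c *: (x * y) -> x ^+ n = 0 -> (x * y) ^+ n = 0.
Proof.
move=> yx xn.
have yxn m : y * x ^+ m = c ^+ m *: (x ^+ m * y).
  elim: m => [|m IH]; first by rewrite !expr0 scale1r mulr1 mul1r.
  by rewrite !exprSr mulrA IH -scalerAl -(mulrA _ y x) yx -scalerAr scalerA !mulrA.
suff [d ->] : exists d, (x * y) ^+ n = d *: (x ^+ n * y ^+ n).
  by rewrite xn mul0r scaler0.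
elim: n {xn} => [|n [d IH]]; first by exists 1; rewrite !expr0 scale1r mulr1.
exists (d * c ^+ n); rewrite exprS IH -scalerAr -scalerA; congr (_ *: _).
by rewrite mulrA -(mulrA x y) yxn -scalerAr -scalerAl mulrA -exprS -mulrA -exprS.
Qed.

End Commutation.

(** * Gaussian binomial coefficients *)

Section QBinomial.
Variables (K : fieldType) (z : K).

Fixpoint qbin (n k : nat) : K :=
  match n, k with
  | _, 0 => 1
  | 0, _.+1 => 0
  | n'.+1, k'.+1 => qbin n' k' + z ^+ k'.+1 * qbin n' k'.+1
  end.

(** This is (1 - z)^n times the usual q-factorial, a normalization without division. *)
Definition qfact (n : nat) : K := \prod_(i < n) (1 - z ^+ i.+1).

Lemma qbin0 n : qbin n 0 = 1. Proof. by case: n. Qed.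

Lemma qbin_small n k : (n < k)%N -> qbin n k = 0.
Proof.
elim: n k => [|n IH] [|k] //= nk.
by rewrite !IH ?mulr0 ?addr0 // (ltn_trans (ltnSn n)).
Qed.

Lemma qbinn n : qbin n n = 1.
Proof. by elim: n => //= n ->; rewrite qbin_small ?mulr0 ?addr0. Qed.

Lemma qfactS n : qfact n.+1 = qfact n * (1 - z ^+ n.+1).
Proof. by rewrite /qfact big_ord_recr. Qed.

(** The factorial formula is kept in product form because factorials may vanish at a root of unity;
    it is proved by induction on both arguments from the Pascal rule. *)
Lemma qbin_fact k m : qbin (k + m) k * (qfact k * qfact m) = qfact (k + m).
Proof.
elim: k m => [|k IHk] m.
  by rewrite qbin0 /qfact big_ord0 !mul1r.
elim: m => [|m IHm]; first by rewrite addn0 qbinn /qfact big_ord0 mul1r mulr1.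
have h1 := IHk m.+1; have h2 := IHm; rewrite addSnnS in h2.
rewrite addSn [RHS]qfactS -addSn exprD /=; move: h1 h2; rewrite !qfactS.
set a := qfact (k + _); set b := qbin _ k; set c := qbin _ k.+1.
set fk := qfact k; set fm := qfact m; set zk := z ^+ k.+1; set zm := z ^+ m.+1.
move=> h1 h2.
have -> : (b + zk * c) * (fk * (1 - zk) * (fm * (1 - zm))) =
    b * (fk * (fm * (1 - zm))) * (1 - zk) + zk * (c * (fk * (1 - zk) * fm)) * (1 - zm).
  by ring.
by rewrite h1 h2; ring.
Qed.

Lemma qbin_expr (A : algType K) (x y : A) n : y * x = z *: (x * y) ->
  (x + y) ^+ n = \sum_(k < n.+1) qbin n k *: (x ^+ k * y ^+ (n - k)).
Proof.
move=> yx; have yxn k : y * x ^+ k = z ^+ k *: (x ^+ k * y).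
  elim: k => [|k IH]; first by rewrite !expr0 scale1r mulr1 mul1r.
  by rewrite !exprSr mulrA IH -scalerAl -(mulrA _ y x) yx -scalerAr scalerA !mulrA.
elim: n => [|n IH]; first by rewrite big_ord1 subnn qbin0 scale1r mulr1.
rewrite exprS IH mulrDl !mulr_sumr.
rewrite [X in _ + X]big_ord_recl [X in X + _]big_ord_recr /=.
rewrite [RHS]big_ord_recl [X in _ = _ + X]big_ord_recr /=.
rewrite !subnn !qbinn !qbin0 !expr0 !scale1r !mulr1 !mul1r !subn0.
rewrite (qbin_small (ltnSn n)) mulr0 addr0 scale1r -exprS -exprS.
rewrite [LHS]addrC -[LHS]addrA; congr (_ + _).
rewrite addrA -big_split /=; congr (_ + _); apply: eq_bigr => i _.
rewrite /bump /= add1n subSS scalerDl addrC -!scalerAr; congr (_ + _).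
  by rewrite mulrA -exprS.
rewrite mulrA yxn -scalerAl scalerA mulrC -mulrA -exprS.
by rewrite -subSn // subSS.
Qed.

(** For 0 < k < n the factor 1 - z^n kills [qfact n], while [qfact k] and [qfact (n - k)] are
    nonzero; so [qbin n k] vanishes, and only x^n and y^n remain. *)
Lemma qbin_expr0 (A : algType K) (x y : A) n :
  (0 < n)%N -> z ^+ n = 1 -> (forall j, (0 < j < n)%N -> z ^+ j != 1) ->
  y * x = z *: (x * y) -> x ^+ n = 0 -> y ^+ n = 0 -> (x + y) ^+ n = 0.
Proof.
move=> n0 zn zj yx xn yn; rewrite (qbin_expr _ yx) big1 // => -[k /= kn] _.
have [->|k0] := posnP k; first by rewrite subn0 yn mulr0 scaler0.
move: kn; rewrite ltnS leq_eqVlt => /orP[/eqP -> |kn].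
  by rewrite xn mul0r scaler0.
have qfact0 m : (m < n)%N -> qfact m != 0.
  move=> mn; apply/prodf_neq0 => i _; rewrite subr_eq0 eq_sym zj //=.
  by rewrite (leq_ltn_trans (ltn_ord i)).
suff -> : qbin n k = 0 by rewrite scale0r.
apply/eqP; have /eqP := qbin_fact k (n - k); rewrite subnKC ?(ltnW kn) //.
case: n n0 zn kn qfact0 {zj xn yn} => // n _ zn kn qfact0.
rewrite [qfact n.+1]qfactS zn subrr mulr0 !mulf_eq0 !(negPf (qfact0 _ _)) ?orbF //.
by rewrite ltn_subrL k0.
Qed.

End QBinomial.

(** * Opposite algebras *)

Section Opposite.
Variables (K : fieldType) (A : algType K).

(** An antipode reverses products, hence is a morphism into the opposite algebra; with an algebra
    structure on [A^c] it can be defined on generators and relations. *)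
HB.instance Definition _ := GRing.Lmodule.copy A^c A.

Lemma mulcE (x y : A^c) : x * y = (y : A) * (x : A). Proof. by []. Qed.

Fact converse_scaleAl (a : K) (u v : A^c) : a *: (u * v) = (a *: u : A^c) * v.
Proof. exact: (@scalerAr K A a v u). Qed.
HB.instance Definition _ :=
  GRing.Lmodule_isLalgebra.Build K A^c converse_scaleAl.
Fact converse_scaleAr (a : K) (u v : A^c) : a *: (u * v) = u * (a *: v : A^c).
Proof. exact: (@scalerAl K A a v u). Qed.
HB.instance Definition _ :=
  GRing.Lalgebra_isAlgebra.Build K A^c converse_scaleAr.

End Opposite.

(** * Algebras given by generators and relations *)

(** Stated as an induction principle, the form in which the Hopf axioms are extended from the
    generators. *)
Definition generates (K : fieldType) (A : algType K) (I : Type) (g : I -> A) :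
    Prop :=
  forall Q : A -> Prop, Q 1 -> (forall a x y, Q x -> Q y -> Q (a *: x + y)) ->
    (forall x y, Q x -> Q y -> Q (x * y)) -> (forall i, Q (g i)) -> forall x, Q x.

Lemma generates_ext (K : fieldType) (A B : algType K) (I : Type) (g : I -> A)
    (f f' : {lrmorphism A -> B}) :
  generates g -> (forall i, f (g i) = f' (g i)) -> forall x, f x = f' x.
Proof.
move=> hg ff'; apply: hg => // [|a x y fx fy|x y fx fy].
- by rewrite !rmorph1.
- by rewrite !linearP /= fx fy.
- by rewrite !rmorphM /= fx fy.
Qed.

Section Presented.
Variables (K : fieldType) (P : presentation K).

Lemma pvar_rel r : r \in prel P ->
  api (pres_ideal P) r.1 = api (pres_ideal P) r.2.
Proof. by move=> hr; apply/lpi_eq/ideal_gen; exists r. Qed.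

Lemma fvarM (I : choiceType) (i : I) (s : seq I) :
  mkmalgU (FMonom (i :: s)) 1 =
  fvar K i * (mkmalgU (FMonom s) 1 : freeAlg K I) :> freeAlg K I.
Proof.
rewrite /fvar malgM_def fgmulUU mulr1; congr (mkmalgU _ _).
by apply/eqP; rewrite fmP fmM fmuE.
Qed.

Lemma pres_ind (Q : presAlg P -> Prop) :
  Q 1 -> (forall a x y, Q x -> Q y -> Q (a *: x + y)) ->
  (forall i x, Q x -> Q (pvar i * x)) -> forall x, Q x.
Proof.
move=> Q1 QD QM x.
have Q0 : Q 0 by rewrite -(addNr 1) -scaleN1r; exact: QD.
elim/lquot_ind: x => g; rewrite -/(api (pres_ideal P) g) (monalgE g) raddf_sum /=.
elim/big_rec: _ => // m y _ Qy.
have -> : mkmalgU m (g@_m) = g@_m *: mkmalgU m 1 :> freeAlg K (pgen P).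
  by apply/malgP => k; rewrite mcoeffZ !mcoeffU mulrnAr mulr1.
rewrite linearZ; apply: QD => // {y Qy}; case: m => s.
elim: s => [|i s IH]; last by rewrite fvarM rmorphM; exact: QM.
suff -> : mkmalgU (FMonom [::]) 1 = 1 :> freeAlg K (pgen P) by rewrite rmorph1.
by congr (mkmalgU _ _); apply/eqP; rewrite fmP fm1.
Qed.

Lemma pvar_generates : generates (@pvar K P).
Proof. by move=> Q Q1 QD QM Qg; apply: pres_ind => // i x; exact: QM. Qed.

Section Lift.
Variables (A : algType K) (h : pgen P -> A).
Hypothesis hrel : forall r, r \in prel P -> feval h r.1 = feval h r.2.

Definition pres_map (x : presAlg P) : A := feval h (repr (x : lquot _)).

(** The chosen representative of the class of y differs from y by an element of the ideal, which
    [feval h] kills. *)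
Lemma pres_mapE y : pres_map (api (pres_ideal P) y) = feval h y.
Proof.
apply/eqP; rewrite -subr_eq0 -raddfB; apply/eqP.
apply: (@ideal_kills _ _ (@prelators K P)) => [_ [r hr ->]|].
  by rewrite raddfB /= hrel // subrr.
exact: ((lpi_eq (i2_sm (pres_ideal P)) _ _).1 (lpi_repr _)).
Qed.

Fact pres_map_linear : linear pres_map.
Proof.
move=> a; elim/lquot_ind => x; elim/lquot_ind => y.
rewrite -!/(api (pres_ideal P) _) -linearP !pres_mapE; exact: linearP.
Qed.
Fact pres_map_monoid : monoid_morphism pres_map.
Proof.
split=> [|x y].
  by have := pres_mapE 1; rewrite !rmorph1.
elim/lquot_ind: x => x; elim/lquot_ind: y => y.
by rewrite -!/(api (pres_ideal P) _) -rmorphM !pres_mapE rmorphM.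
Qed.
HB.instance Definition _ :=
  GRing.isLinear.Build K (presAlg P) A _ pres_map pres_map_linear.
HB.instance Definition _ :=
  GRing.isMonoidMorphism.Build (presAlg P) A pres_map pres_map_monoid.

Lemma pres_lift : exists f : {lrmorphism presAlg P -> A},
  forall i, f (pvar i) = h i.
Proof. by exists pres_map => i; rewrite -[RHS](feval_var h); exact: pres_mapE. Qed.

End Lift.
End Presented.

(** * Hopf structures given on generators *)

Section LRMap.
Variables (K : fieldType) (A B : algType K).

(** The proofs are carried as arguments so that the morphism structure of the bare function can be
    inferred. *)
Definition lrmap (f : A -> B) of linear f & monoid_morphism f := f.
HB.instance Definition _ f (lf : linear f) (mf : monoid_morphism f) :=
  GRing.isLinear.Build K A B _ (lrmap lf mf) lf.
HB.instance Definition _ f (lf : linear f) (mf : monoid_morphism f) :=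
  GRing.isMonoidMorphism.Build A B (lrmap lf mf) mf.

Definition linmap (f : A -> B) of linear f := f.
HB.instance Definition _ f (lf : linear f) :=
  GRing.isLinear.Build K A B _ (linmap lf) lf.

End LRMap.

Section TensorMorphisms.
Variable K : fieldType.
Implicit Types A B C D : algType K.

(** With [tin_comm] and [tinM], these two commuting copies turn a computation in A (x) B into one
    with words in twice as many letters. *)
Definition tinl A B (a : A) : tensor A B := a \ot 1.
Definition tinr A B (b : B) : tensor A B := 1 \ot b.

Fact tinl_monoid A B : monoid_morphism (@tinl A B).
Proof. by split=> // x y; rewrite /tinl tensM mulr1. Qed.
Fact tinr_monoid A B : monoid_morphism (@tinr A B).
Proof. by split=> // x y; rewrite /tinr tensM mulr1. Qed.
HB.instance Definition _ A B :=
  GRing.isLinear.Build K A (tensor A B) _ (@tinl A B) (@tensl_linear K A B 1).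
HB.instance Definition _ A B :=
  GRing.isMonoidMorphism.Build A (tensor A B) (@tinl A B) (@tinl_monoid A B).
HB.instance Definition _ A B :=
  GRing.isLinear.Build K B (tensor A B) _ (@tinr A B) (@tensr_linear K A B 1).
HB.instance Definition _ A B :=
  GRing.isMonoidMorphism.Build B (tensor A B) (@tinr A B) (@tinr_monoid A B).

Lemma tin_comm A B (a : A) (b : B) : tinr A b * tinl B a = tinl B a * tinr A b.
Proof. by rewrite /tinl /tinr !tensM !mulr1 !mul1r. Qed.

Lemma tinM A B (a : A) (b : B) : tinl B a * tinr A b = a \ot b.
Proof. by rewrite /tinl /tinr tensM mulr1 mul1r. Qed.

Lemma linear_morphM A B (f : A -> B) (x y : A) : linear f ->
  linear (fun y => f (x * y)) /\ linear (fun x => f (x * y)) /\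
  linear (fun y => f x * f y) /\ linear (fun x => f x * f y).
Proof.
move=> lf; split; first exact: (comp_linear lf (mull_linear x)).
split; first exact: (comp_linear lf (mulr_linear y)).
split; first exact: (comp_linear (mull_linear (f x)) lf).
exact: (comp_linear (mulr_linear (f y)) lf).
Qed.

Lemma tensor_morphM A B C (f : tensor A B -> C) : linear f ->
  (forall a b a' b', f ((a \ot b) * (a' \ot b')) = f (a \ot b) * f (a' \ot b')) ->
  {morph f : x y / x * y}.
Proof.
move=> lf hf x y; move: x; apply: tensor_ext => [||a b].
- exact: (linear_morphM 0 y lf).2.1.
- exact: (linear_morphM 0 y lf).2.2.2.
move: y; apply: tensor_ext => [||a' b'] //.
- exact: (linear_morphM _ 0 lf).1.
- exact: (linear_morphM _ 0 lf).2.2.1.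
Qed.

Lemma tmapM A A' B B' (f : A -> A') (g : B -> B') :
  linear f -> linear g -> {morph f : x y / x * y} -> {morph g : x y / x * y} ->
  {morph tmap f g : x y / x * y}.
Proof.
move=> lf lg mf mg; apply: tensor_morphM; first exact: tmap_linear.
by move=> a b a' b'; rewrite tensM !tmapE // tensM mf mg.
Qed.

Lemma tensor3_morphM A B C D (f : tensor (tensor A B) C -> D) : linear f ->
  (forall a b c a' b' c', f (((a \ot b) \ot c) * ((a' \ot b') \ot c')) =
     f ((a \ot b) \ot c) * f ((a' \ot b') \ot c')) ->
  {morph f : x y / x * y}.
Proof.
move=> lf hf x y; move: x; apply: tensor3_ext => [||a b c].
- exact: (linear_morphM 0 y lf).2.1.
- exact: (linear_morphM 0 y lf).2.2.2.
move: y; apply: tensor3_ext => [||a' b' c'] //.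
- exact: (linear_morphM _ 0 lf).1.
- exact: (linear_morphM _ 0 lf).2.2.1.
Qed.

Lemma tassocM A B C : {morph @tassoc K A B C : x y / x * y}.
Proof.
apply: (tensor3_morphM (@tassoc_linear K A B C)).
by move=> *; rewrite !tensM !tassocE !tensM.
Qed.

Lemma tlunitM A : {morph @tlunit K A : x y / x * y}.
Proof.
apply: tensor_morphM; first exact: tlunit_linear.
by move=> a b a' b'; rewrite tensM !tlunitE -scalerAl -scalerAr scalerA.
Qed.

Lemma trunitM A : {morph @trunit K A : x y / x * y}.
Proof.
apply: tensor_morphM; first exact: trunit_linear.
by move=> a b a' b'; rewrite tensM !trunitE -scalerAl -scalerAr scalerA.
Qed.

End TensorMorphisms.

Section GeneratorsHopf.
Variables (K : fieldType) (H : algType K) (I : Type) (g : I -> H).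
Hypothesis gen : generates g.
Variables (D : {lrmorphism H -> tensor H H}) (e : {lrmorphism H -> K^o}).
Variable S : {linear H -> H}.
Hypotheses (S1 : S 1 = 1) (SM : forall x y, S (x * y) = S y * S x).

Lemma antil_bilin : bilin (fun a b => S a * b).
Proof.
split=> [b|a]; last exact: mull_linear.
by apply: (comp_linear (mulr_linear b)); exact: linearP.
Qed.
Lemma antir_bilin : bilin (fun a b => a * S b).
Proof.
split=> [b|a]; first exact: mulr_linear.
by apply: (comp_linear (mull_linear a)); exact: linearP.
Qed.

(** For pure tensors u = a' (x) b' and v = a (x) b the left side is S(a) (S(a') b') b: the
    contribution of u sits in the middle, and being a scalar it comes out. In [antirM] it is v that
    sits inside. *)
Lemma antilM c (u v : tensor H H) : tlift (fun a b => S a * b) u = c%:A ->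
  tlift (fun a b => S a * b) (u * v) = c *: tlift (fun a b => S a * b) v.
Proof.
have lS := tlift_linear antil_bilin.
have sand (m : H) : bilin (fun a b => S a * m * b).
  split=> [b|a]; last exact: mull_linear.
  apply: (comp_linear (mulr_linear b)); apply: (comp_linear (mulr_linear m)).
  exact: linearP.
move=> uc; transitivity (tlift (fun a b => S a * tlift (fun a b => S a * b) u * b) v).
  move: v {uc}; apply: tensor_ext => [||a b].
  - exact: (comp_linear lS (mull_linear u)).
  - exact: tlift_linear.
  rewrite tliftE //; move: u; apply: tensor_ext => [||a' b'].
  - exact: (comp_linear lS (mulr_linear _)).
  - apply: (comp_linear (mulr_linear b)); apply: (comp_linear (mull_linear _)).
    exact: lS.
  by rewrite tensM !(tliftE antil_bilin) SM !mulrA.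
rewrite uc; move: v {uc}; apply: tensor_ext => [||a b].
- exact: tlift_linear.
- by move=> d x y; rewrite lS scalerDr !scalerA mulrC.
by rewrite tliftE // (tliftE antil_bilin) -scalerAr mulr1 -scalerAl.
Qed.

Lemma antirM c (u v : tensor H H) : tlift (fun a b => a * S b) v = c%:A ->
  tlift (fun a b => a * S b) (u * v) = c *: tlift (fun a b => a * S b) u.
Proof.
have lS := tlift_linear antir_bilin.
have sand (m : H) : bilin (fun a b => a * m * S b).
  split=> [b|a]; last by apply: (comp_linear (mull_linear _)); exact: linearP.
  apply: (comp_linear (mulr_linear (S b))); exact: mulr_linear.
move=> vc; transitivity (tlift (fun a b => a * tlift (fun a b => a * S b) v * S b) u).
  move: u {vc}; apply: tensor_ext => [||a b].
  - exact: (comp_linear lS (mulr_linear v)).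
  - exact: tlift_linear.
  rewrite tliftE //; move: v; apply: tensor_ext => [||a' b'].
  - exact: (comp_linear lS (mull_linear _)).
  - apply: (comp_linear (mulr_linear (S b))); apply: (comp_linear (mull_linear _)).
    exact: lS.
  by rewrite tensM !(tliftE antir_bilin) SM !mulrA.
rewrite vc; move: u {vc}; apply: tensor_ext => [||a b].
- exact: tlift_linear.
- by move=> d x y; rewrite lS scalerDr !scalerA mulrC.
by rewrite tliftE // (tliftE antir_bilin) -scalerAr mulr1 -scalerAl.
Qed.

Hypotheses
  (coassoc : forall i, tassoc (tmap D id (D (g i))) = tmap id D (D (g i)))
  (counitl : forall i, tlunit (tmap e id (D (g i))) = g i)
  (counitr : forall i, trunit (tmap id e (D (g i))) = g i)
  (antipl : forall i,
     tlift (fun a b => S a * b) (D (g i)) = (e (g i))%:A)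
  (antipr : forall i,
     tlift (fun a b => a * S b) (D (g i)) = (e (g i))%:A).

Let lD : linear D := linearP D.
Let le : linear e := linearP e.
Let lid : linear (@id H) := @id_linear K H.

Let mD : {morph D : x y / x * y} := rmorphM D.
Let me : {morph e : x y / x * y} := rmorphM e.
Let mid : {morph @id H : x y / x * y}. Proof. by []. Qed.

(** Coassociativity and the counit laws compare multiplicative maps, so they pass to products at
    once; the antipode laws pass through [antilM] and [antirM]. *)
Lemma generators_hopf : exists h : hopfAlgebra H,
  [/\ (forall x, hdelta h x = D x), (forall x, heps h x = e x) &
      (forall x, hS h x = S x)].
Proof.
have la := @tassoc_linear K H H H.
have ma := @tassocM K H H H.
have mt := tmapM lD lid mD mid.
have mt' := tmapM lid lD mid mD.
have h1 x : tassoc (tmap D id (D x)) = tmap id D (D x).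
  move: x; apply: gen => //.
  - by rewrite rmorph1 !(tmapE lD lid) (tmapE lid lD) rmorph1 tens1 tassocE.
  - move=> a x y hx hy; rewrite !lD (tmap_linear lD lid) (tmap_linear lid lD).
    by rewrite [LHS]la hx hy.
  - move=> x y hx hy; rewrite mD (mt (D x) (D y)) (mt' (D x) (D y)).
    by rewrite [LHS](ma _ _) hx hy.
have h2 x : tlunit (tmap e id (D x)) = x.
  move: x; apply: gen => //.
  - by rewrite rmorph1 (tmapE le lid) rmorph1 tlunitE scale1r.
  - move=> a x y hx hy; rewrite lD (tmap_linear le lid) tlunit_linear hx hy //.
  - by move=> x y hx hy; rewrite mD (tmapM le lid me mid) tlunitM hx hy.
have h3 x : trunit (tmap id e (D x)) = x.
  move: x; apply: gen => //.
  - by rewrite rmorph1 (tmapE lid le) rmorph1 trunitE scale1r.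
  - move=> a x y hx hy; rewrite lD (tmap_linear lid le) trunit_linear hx hy //.
  - by move=> x y hx hy; rewrite mD (tmapM lid le mid me) trunitM hx hy.
have h4 x : tlift (fun a b => S a * b) (D x) = (e x)%:A.
  move: x; apply: gen => //.
  - by rewrite !rmorph1 tens1 (tliftE antil_bilin) S1 mulr1 scale1r.
  - move=> a x y hx hy; rewrite lD le (tlift_linear antil_bilin) hx hy.
    by rewrite scalerDl scalerA.
  - by move=> x y hx hy; rewrite mD me (antilM _ hx) hy scalerA.
have h5 x : tlift (fun a b => a * S b) (D x) = (e x)%:A.
  move: x; apply: gen => //.
  - by rewrite !rmorph1 tens1 (tliftE antir_bilin) S1 mulr1 scale1r.
  - move=> a x y hx hy; rewrite lD le (tlift_linear antir_bilin) hx hy.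
    by rewrite scalerDl scalerA.
  - by move=> x y hx hy; rewrite mD me (antirM _ hy) hx scalerA mulrC.
by exists (HopfAlgebra h1 h2 h3 h4 h5).
Qed.

End GeneratorsHopf.

(** * Monoidal equivalence induced by an isomorphism up to a twist *)

Section FullEquivalence.
Variables (C D : monoidalCategory) (P : C -> Prop) (Q : D -> Prop).
Hypotheses (P1 : P (munit C)) (PT : forall X Y, P X -> P Y -> P (mtens X Y)).
Hypotheses (Q1 : Q (munit D)) (QT : forall X Y, Q X -> Q Y -> Q (mtens X Y)).

Definition full_functor (C D : monoidalCategory) (P : C -> Prop) (Q : D -> Prop)
    (F : functor C D) (PF : forall X, P X -> Q (F X)) :
    functor (full_category P) (full_category Q) :=
  @Functor (full_category P) (full_category Q)
    (fun X => exist Q (F (sval X)) (PF _ (svalP X)))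
    (fun X Y f => fmap F f) (fun X => fmap_id F (sval X))
    (fun X Y Z f g => fmap_comp F f g).

Variables (F : functor C D) (G : functor D C).
Hypotheses (PF : forall X, P X -> Q (F X)) (QG : forall Y, Q Y -> P (G Y)).
Variables (eta : forall X : C, iso (G (F X)) X) (eps : forall Y : D, iso (F (G Y)) Y).
Hypotheses
  (eta_nat : forall (X Y : C) (f : Defs.hom X Y),
     f \oc iso_hom (eta X) = iso_hom (eta Y) \oc fmap G (fmap F f))
  (eps_nat : forall (X Y : D) (f : Defs.hom X Y),
     f \oc iso_hom (eps X) = iso_hom (eps Y) \oc fmap F (fmap G f)).
Variable M : monoidal_structure F.

Lemma full_monoidal_equivalence :
  monoidally_equivalent (full_monoidal P1 PT) (full_monoidal Q1 QT).
Proof.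
exists (full_functor PF); split.
  exists (full_functor QG).
  exists (fun X => @full_iso C P (full_functor QG (full_functor PF X)) X (eta (sval X))).
  exists (fun Y => @full_iso D Q (full_functor PF (full_functor QG Y)) Y (eps (sval Y))).
  by split=> X Y f; [exact: eta_nat|exact: eps_nat].
constructor.
refine (@MonoidalStructure (full_monoidal P1 PT) (full_monoidal Q1 QT) (full_functor PF)
  (@full_iso D Q (full_unit Q1) (full_functor PF (full_unit P1)) (mon_unit M))
  (fun X Y => @full_iso D Q (full_tens QT (full_functor PF X) (full_functor PF Y))
     (full_functor PF (full_tens PT X Y)) (mon_tens M (sval X) (sval Y))) _ _ _ _).
- by move=> X X' Y Y' f g; exact: (mon_nat M).
- by move=> X Y Z; exact: (mon_assoc M).
- by move=> X; exact: (mon_lunit M).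
- by move=> X; exact: (mon_runit M).
Qed.

End FullEquivalence.

(** * Restriction of modules along an algebra morphism *)

Section Restriction.
Variables (K : fieldType) (A B : algType K) (f : {lrmorphism A -> B}).

Fact res_bilin (M : lmodule B) : bilin (fun x (v : M) => lact (f x) v).
Proof.
split=> [v|x]; last exact: lact_linear.
by apply: (comp_linear (lactl_linear v)); exact: linearP.
Qed.
Fact res_act1 (M : lmodule B) (v : M) : lact (f 1) v = v.
Proof. by rewrite rmorph1 lact1. Qed.
Fact res_actM (M : lmodule B) x y (v : M) :
  lact (f (x * y)) v = lact (f x) (lact (f y) v).
Proof. by rewrite rmorphM lactM. Qed.

Definition res (M : lmodule B) : lmodule A :=
  LModule (res_bilin M) (@res_act1 M) (@res_actM M).

Definition res_hom (M N : lmodule B) (u : lmodule_hom M N) :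
    lmodule_hom (res M) (res N) :=
  @LModuleHom K A (res M) (res N) u (@lhom_linear _ _ _ _ u)
    (fun x v => lhom_act u (f x) v).

Definition res_functor : functor (ModCat B) (ModCat A).
Proof.
refine (@Functor (ModCat B) (ModCat A) res res_hom _ _);
  by move=> *; apply: lhom_ext.
Defined.

Lemma tact2_res (V W : lmodule B) (t : tensor A A) (v : tensor V W) :
  @tact2 K A A (res V) (res W) t v = tact2 (tmap f f t) v.
Proof.
have lf : linear f := linearP f.
move: t; apply: tensor_ext => [||a b].
- exact: (@tact2_linearl K A A (res V) (res W) v).
- exact: (comp_linear (tact2_linearl v) (tmap_linear lf lf)).
move: v; apply: tensor_ext => [||v w].
- exact: (@tact2_linear K A A (res V) (res W)).
- exact: tact2_linear.
by rewrite (tmapE lf lf) tact2E (@tact2E K A A (res V) (res W)).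
Qed.

End Restriction.

Section TensorActions.
Variables (K : fieldType) (A : algType K) (h : hopfAlgebra A).
Implicit Types X Y Z : lmodule A.

Lemma tact2_tmap X X' Y Y' (u : lmodule_hom X X') (w : lmodule_hom Y Y')
    (t : tensor A A) (v : tensor X Y) :
  tmap u w (tact2 t v) = tact2 t (tmap u w v).
Proof.
have lu := @lhom_linear _ _ _ _ u; have lw := @lhom_linear _ _ _ _ w.
move: t; apply: tensor_ext => [||a b].
- exact: (comp_linear (tmap_linear lu lw) (tact2_linearl v)).
- exact: tact2_linearl.
move: v; apply: tensor_ext => [||x y].
- exact: (comp_linear (tmap_linear lu lw) (tact2_linear _)).
- exact: (comp_linear (tact2_linear _) (tmap_linear lu lw)).
by rewrite tact2E !(tmapE lu lw) tact2E !lhom_act.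
Qed.

Let lD : linear (hdelta h) := linearP (hdelta h).
Let le : linear (heps h) := linearP (heps h).
Let lid : linear (@id A) := @id_linear K A.

(** Moves the action from A (x) A to (A (x) A) (x) A, where one side of the cocycle condition lives
    before reassociation. *)
Lemma tact2_delta_l X Y Z (t : tensor A A) (v : tensor (tensor X Y) Z) :
  @tact2 K A A (rep_tens h X Y) Z t v =
  @tact2 K _ _ (tens_module X Y) Z (tmap (hdelta h) id t) v.
Proof.
have b1 := @tact2_bilin1 K A A (rep_tens h X Y) Z v.
have b2 := @tact2_bilin1 K _ _ (tens_module X Y) Z v.
move: t; apply: tensor_ext => [||a b].
- exact: (@tact2_linearl K A A (rep_tens h X Y) Z).
- apply: (comp_linear (@tact2_linearl K _ _ (tens_module X Y) Z v)).
  exact: (tmap_linear lD lid).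
by rewrite (tmapE lD lid) /tact2 (tliftE b1) (tliftE b2).
Qed.

Lemma tact2_delta_r X Y Z (t : tensor A A) (v : tensor X (tensor Y Z)) :
  @tact2 K A A X (rep_tens h Y Z) t v =
  @tact2 K _ _ X (tens_module Y Z) (tmap id (hdelta h) t) v.
Proof.
have b1 := @tact2_bilin1 K A A X (rep_tens h Y Z) v.
have b2 := @tact2_bilin1 K _ _ X (tens_module Y Z) v.
move: t; apply: tensor_ext => [||a b].
- exact: (@tact2_linearl K A A X (rep_tens h Y Z)).
- apply: (comp_linear (@tact2_linearl K _ _ X (tens_module Y Z) v)).
  exact: (tmap_linear lid lD).
by rewrite (tmapE lid lD) /tact2 (tliftE b1) (tliftE b2).
Qed.

Lemma tact2_inl X Y Z (t : tensor A A) (v : tensor (tensor X Y) Z) :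
  tmap (@tact2 K A A X Y t) id v = @tact2 K _ _ (tens_module X Y) Z (t \ot 1) v.
Proof.
have lt := @tact2_linear K A A X Y t; have li := @id_linear K Z.
move: v; apply: tensor_ext => [||x z].
- exact: (tmap_linear lt li).
- exact: (@tact2_linear K _ _ (tens_module X Y) Z).
by rewrite (tmapE lt li) (@tact2E K _ _ (tens_module X Y) Z) lact1.
Qed.

Lemma tact2_inr X Y Z (t : tensor A A) (v : tensor X (tensor Y Z)) :
  tmap id (@tact2 K A A Y Z t) v = @tact2 K _ _ X (tens_module Y Z) (1 \ot t) v.
Proof.
have lt := @tact2_linear K A A Y Z t; have li := @id_linear K X.
move: v; apply: tensor_ext => [||x z].
- exact: (tmap_linear li lt).
- exact: (@tact2_linear K _ _ X (tens_module Y Z)).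
by rewrite (tmapE li lt) (@tact2E K _ _ X (tens_module Y Z)) lact1.
Qed.

Lemma tlunit_tact2 X (t : tensor A A) (v : tensor K^o X) :
  tlunit (@tact2 K A A (rep_unit h) X t v) =
  lact (tlunit (tmap (heps h) id t)) (tlunit v).
Proof.
have ll := @tlunit_linear K X.
move: t; apply: tensor_ext => [||a b].
- exact: (comp_linear ll (@tact2_linearl K A A (rep_unit h) X v)).
- apply: (comp_linear (lactl_linear _)); apply: (comp_linear (@tlunit_linear _ _)).
  exact: (tmap_linear le lid).
move: v; apply: tensor_ext => [||c v].
- exact: (comp_linear ll (@tact2_linear K A A (rep_unit h) X _)).
- exact: (comp_linear (lact_linear _) ll).
rewrite (@tact2E K A A (rep_unit h) X) (tmapE le lid) !tlunitE.
rewrite (linearZ' _ (lactl_linear _)) (linearZ' _ (lact_linear _)) scalerA.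
by [].
Qed.

Lemma trunit_tact2 X (t : tensor A A) (v : tensor X K^o) :
  trunit (@tact2 K A A X (rep_unit h) t v) =
  lact (trunit (tmap id (heps h) t)) (trunit v).
Proof.
have ll := @trunit_linear K X.
move: t; apply: tensor_ext => [||a b].
- exact: (comp_linear ll (@tact2_linearl K A A X (rep_unit h) v)).
- apply: (comp_linear (lactl_linear _)); apply: (comp_linear (@trunit_linear _ _)).
  exact: (tmap_linear lid le).
move: v; apply: tensor_ext => [||v c].
- exact: (comp_linear ll (@tact2_linear K A A X (rep_unit h) _)).
- exact: (comp_linear (lact_linear _) ll).
rewrite (@tact2E K A A X (rep_unit h)) (tmapE lid le) !trunitE.
rewrite (linearZ' _ (lactl_linear _)) (linearZ' _ (lact_linear _)) scalerA.
by [].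
Qed.

End TensorActions.

Section TwistEquivalence.
Variables (K : fieldType) (A B : algType K).
Variables (ha : hopfAlgebra A) (hb : hopfAlgebra B).
Variables (f : {lrmorphism B -> A}) (g : {lrmorphism A -> B}).
Hypotheses (fK : cancel f g) (gK : cancel g f).
Variables (Phi Psi : tensor A A).
Hypotheses (PhiK : Phi * Psi = 1) (PsiK : Psi * Phi = 1).
Hypothesis Phi_twist : twist_cocycle ha Phi.
Hypothesis Phi_delta :
  forall x, Psi * hdelta ha (f x) * Phi = tmap f f (hdelta hb x).
Hypothesis f_eps : forall x, heps ha (f x) = heps hb x.

Local Notation F := (res_functor f).
Local Notation G := (res_functor g).

Fact res_unit_act x (a : rep_unit hb) :
  lact x a = lact x (a : res f (rep_unit ha)) :> K^o.
Proof. by rewrite /= /rep_unit_act f_eps. Qed.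

Definition res_unit : @iso (ModCat B) (rep_unit hb) (res f (rep_unit ha)) :=
  mk_iso (V := rep_unit hb) (W := res f (rep_unit ha))
    (f := @LModuleHom K B (rep_unit hb) (res f (rep_unit ha)) id
       (@id_linear K K^o) res_unit_act)
    (g := id) (@id_linear K K^o) (fun _ => erefl) (fun _ => erefl).

Section Tens.
Variables X Y : lmodule A.

(** As [Phi * Psi = 1], the hypothesis [Phi_delta] reads Phi (f (x) f)(Delta_B x) = Delta_A(f x)
    Phi: the action of Phi intertwines the two tensor products. *)
Fact twist_act x (v : rep_tens hb (res f X) (res f Y)) :
  @tact2 K A A X Y Phi (lact x v) =
  lact x (@tact2 K A A X Y Phi v : res f (rep_tens ha X Y)).
Proof.
transitivity (@tact2 K A A X Y Phi (tact2 (tmap f f (hdelta hb x)) v)).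
  by congr tact2; exact: tact2_res.
by rewrite -Phi_delta -tact2M !mulrA PhiK mul1r tact2M.
Qed.

Definition twist_hom :
    lmodule_hom (rep_tens hb (res f X) (res f Y)) (res f (rep_tens ha X Y)) :=
  @LModuleHom K B (rep_tens hb (res f X) (res f Y)) (res f (rep_tens ha X Y))
    (@tact2 K A A X Y Phi) (@tact2_linear K A A X Y Phi) twist_act.

Fact twistK : cancel (@tact2 K A A X Y Phi) (@tact2 K A A X Y Psi).
Proof. by move=> v; rewrite -tact2M PsiK tact2_1. Qed.
Fact twistVK : cancel (@tact2 K A A X Y Psi) (@tact2 K A A X Y Phi).
Proof. by move=> v; rewrite -tact2M PhiK tact2_1. Qed.

Definition twist_iso :
    @iso (ModCat B) (rep_tens hb (res f X) (res f Y)) (res f (rep_tens ha X Y)) :=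
  mk_iso (V := rep_tens hb (res f X) (res f Y)) (W := res f (rep_tens ha X Y))
    (f := twist_hom) (@tact2_linear K A A X Y Psi) twistK twistVK.

End Tens.

(** The two sides are the actions on X (x) (Y (x) Z) of the two sides of the cocycle equation. *)
Lemma twist_assoc (X Y Z : lmodule A) (v : tensor (tensor X Y) Z) :
  tassoc (@tact2 K A A (rep_tens ha X Y) Z Phi (tmap (@tact2 K A A X Y Phi) id v)) =
  @tact2 K A A X (rep_tens ha Y Z) Phi (tmap id (@tact2 K A A Y Z Phi) (tassoc v)).
Proof.
have [cocycle _ _] := Phi_twist.
rewrite tact2_delta_l tact2_inl tact2_delta_r tact2_inr.
have e1 := @tact2M K _ _ (tens_module X Y) Z (tmap (hdelta ha) id Phi) (Phi \ot 1)
  v.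
have e2 := @tact2M K _ _ X (tens_module Y Z) (tmap id (hdelta ha) Phi) (1 \ot Phi)
  (tassoc v).
apply: (etrans (congr1 (@tassoc K X Y Z) (esym e1))).
apply: (etrans (tassoc_act _ _)); rewrite cocycle; exact: e2.
Qed.

Lemma twist_lunit (X : lmodule A) (v : tensor K^o X) :
  tlunit (@tact2 K A A (rep_unit ha) X Phi v) = tlunit v.
Proof. by have [_ e _] := Phi_twist; rewrite tlunit_tact2 e lact1. Qed.

Lemma twist_runit (X : lmodule A) (v : tensor X K^o) :
  trunit (@tact2 K A A X (rep_unit ha) Phi v) = trunit v.
Proof. by have [_ _ e] := Phi_twist; rewrite trunit_tact2 e lact1. Qed.

Lemma tmap_id_id (V W : lmodType K) (v : tensor V W) : tmap id id v = v.
Proof.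
have li := @id_linear K V; have li' := @id_linear K W.
by move: v; apply: tensor_ext => [||x y] //; [exact: tmap_linear|rewrite tmapE].
Qed.

Definition twist_structure : @monoidal_structure (RepCat ha) (RepCat hb) F.
Proof.
refine (@MonoidalStructure (RepCat ha) (RepCat hb) F res_unit twist_iso _ _ _ _).
- by move=> X X' Y Y' u w; apply: lhom_ext => v; exact: tact2_tmap.
- by move=> X Y Z; apply: lhom_ext => v; exact: twist_assoc.
- move=> X; apply: lhom_ext => v.
  by apply: (etrans (twist_lunit _)); congr tlunit; exact: tmap_id_id.
- move=> X; apply: lhom_ext => v.
  by apply: (etrans (twist_runit _)); congr trunit; exact: tmap_id_id.
Defined.

Fact res_cancel_act (C D : algType K) (u : {lrmorphism D -> C})
    (w : {lrmorphism C -> D}) (uK : cancel w u) (X : lmodule C) x (v : res w (res u X)) :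
  lact x v = lact x (v : X) :> X.
Proof. by rewrite /= uK. Qed.

(** Restricting twice changes only the action, and [uK] gives the original one back; so the
    isomorphism is the identity map. *)
Definition res_cancel (C D : algType K) (u : {lrmorphism D -> C})
    (w : {lrmorphism C -> D}) (uK : cancel w u) (X : lmodule C) :
    @iso (ModCat C) (res w (res u X)) X :=
  mk_iso (V := res w (res u X)) (W := X)
    (f := @LModuleHom K C (res w (res u X)) X id (@id_linear K X)
       (res_cancel_act uK (X := X)))
    (g := id) (@id_linear K X) (fun _ => erefl) (fun _ => erefl).

Lemma twist_equivalence :
  monoidally_equivalent (RepCat ha) (RepCat hb) /\
  monoidally_equivalent (fdRepCat ha) (fdRepCat hb).
Proof.
have eta_nat (X Y : ModCat A) (u : Defs.hom X Y) :
    u \oc iso_hom (res_cancel gK X) = iso_hom (res_cancel gK Y) \oc fmap G (fmap F u).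
  by apply: lhom_ext.
have eps_nat (X Y : ModCat B) (u : Defs.hom X Y) :
    u \oc iso_hom (res_cancel fK X) = iso_hom (res_cancel fK Y) \oc fmap F (fmap G u).
  by apply: lhom_ext.
split.
  exists F; split; last exact: inhabits twist_structure.
  by exists G, (res_cancel gK), (res_cancel fK).
(* Restriction keeps the underlying space, so both functors preserve finite dimension trivially. *)
apply: (@full_monoidal_equivalence (RepCat ha) (RepCat hb) _ _ _ _ _ _ F G _ _
  (res_cancel gK) (res_cancel fK) eta_nat eps_nat twist_structure).
- by [].
- by [].
Qed.

End TwistEquivalence.

(** * The cocycle condition for 1 + s b (x) c with b and c skew primitive *)

Section Cocycle.
Variables (L : fieldType) (s : L).
Hypothesis s0 : s != 0.

(** After expansion the sides differ by s (x1 - x4) + s^2 (x2 x3 - x3 x2), which the commutator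
    hypothesis makes zero. *)
Lemma cocycle_algebra (T : algType L) (x1 x2 x3 x4 : T) :
  x1 * x3 = 0 -> x4 * x2 = 0 -> x2 * x3 - x3 * x2 = s^-1 *: (x4 - x1) ->
  (1 + s *: (x1 + x2)) * (1 + s *: x3) = (1 + s *: (x3 + x4)) * (1 + s *: x2).
Proof.
move=> e13 e42 e23.
have H : rules_hold [:: s; s^-1] [:: x1; x2; x3; x4]
    [:: ([:: 0; 2], [::]); ([:: 3; 1], [::]);
        ([:: 1; 2],
         [:: (SOne, [:: 2; 1]); (SVar 1, [:: 3]); (SOpp (SVar 1), [:: 0])])]%N.
  do ![split=> //=]; rewrite scale1r scaleNr -scalerBr -e23 addrC subrK //.
by nc H; repeat split; field.
Qed.

Variables (A : algType L) (h : hopfAlgebra A) (b c k k' : A).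
Hypotheses (Db : hdelta h b = b \ot k + 1 \ot b) (Dc : hdelta h c = c \ot 1 + k' \ot c).
Hypotheses (eb : heps h b = 0) (ec : heps h c = 0).
Hypotheses (bb : b * b = 0) (cc : c * c = 0) (bc : b * c - c * b = s^-1 *: (k' - k)).

Let T3 := tensor A (tensor A A).
Let w (x y z : A) : T3 := x \ot (y \ot z).
Let wM x y z x' y' z' : w x y z * w x' y' z' = w (x * x') (y * y') (z * z').
Proof. by rewrite /w [LHS]tensM [X in _ \ot X]tensM. Qed.

Lemma skew_primitive_cocycle : twist_cocycle h (1 \ot 1 + s *: (b \ot c)).
Proof.
have lD : linear (hdelta h) := linearP (hdelta h).
have le : linear (heps h) := linearP (heps h).
have lid : linear (@id A) := @id_linear _ A.
have D1 : hdelta h 1 = 1 \ot 1 by exact: rmorph1.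
have e1 : heps h 1 = 1 by exact: rmorph1.
split.
- rewrite (linearD' (tmap_linear lD lid)) (linearZ' _ (tmap_linear lD lid)).
  rewrite (linearD' (tmap_linear lid lD)) (linearZ' _ (tmap_linear lid lD)).
  rewrite !(tmapE lD lid) !(tmapE lid lD) D1 Db Dc.
  have aD := linearD' (@tassoc_linear _ A A A).
  have aZ d := linearZ' d (@tassoc_linear _ A A A).
  apply: (etrans (@tassocM L A A A _ _)).
  (* Delta(b) (x) c gives x1 + x2, and b (x) Delta(c) gives x3 + x4; the factors Phi (x) 1 and 1 (x)
     Phi give x3 and x2. *)
  have h1 := @cocycle_algebra T3 (w b k c) (w 1 b c) (w b c 1) (w b k' c).
  transitivity ((1 + s *: (w b k c + w 1 b c)) * (1 + s *: w b c 1)).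
    congr (_ * _).
      by rewrite aD aZ tensDl aD !tassocE.
    by rewrite tensDl tensZl aD aZ !tassocE.
  transitivity ((1 + s *: (w b c 1 + w b k' c)) * (1 + s *: w 1 b c)).
    refine (h1 _ _ _).
    - by rewrite wM bb /w tens0l.
    - by rewrite wM cc /w tens0r [LHS]tens0r.
    rewrite !wM !mul1r !mulr1.
    have lw : linear (fun y => w b y c) :=
      comp_linear (@tensr_linear L A (tensor A A) b) (@tensl_linear L A A c).
    have wB y y' : w b y c - w b y' c = w b (y - y') c.
      have /= e := lw (-1) y' y; rewrite !scaleN1r in e.
      by rewrite addrC -e addrC.
    by rewrite !wB bc [LHS](linearZ' _ lw).
  apply: (congr2 (@GRing.mul T3)).
    by rewrite tensDr.
  by rewrite tensDr tensZr.
- rewrite (linearD' (tmap_linear le lid)) (linearZ' _ (tmap_linear le lid)).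
  rewrite !(tmapE le lid).
  rewrite (linearD' (@tlunit_linear _ _)) (linearZ' _ (@tlunit_linear _ _)).
  by rewrite !tlunitE e1 eb scale0r scaler0 addr0 scale1r.
- rewrite (linearD' (tmap_linear lid le)) (linearZ' _ (tmap_linear lid le)).
  rewrite !(tmapE lid le).
  rewrite (linearD' (@trunit_linear _ _)) (linearZ' _ (@trunit_linear _ _)).
  by rewrite !trunitE e1 ec scale0r scaler0 addr0 scale1r.
Qed.

End Cocycle.

(** * The algebras U_a and U_s *)

Section UaUs.
Variables (L : fieldType) (p : nat) (q xi : L).
Hypotheses (hxi : xi = 1 \/ xi = -1) (hp : (2 <= p)%N) (qp : q ^+ p = -1).
Hypothesis qq_prim : forall j, (0 < j < p)%N -> (q * q) ^+ j != 1.

Let xi2 : xi ^+ 2 = 1.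
Proof. by case: hxi => ->; rewrite ?expr1n ?sqrrN ?expr1n. Qed.
Let p_gt0 : (0 < p)%N. Proof. exact: ltnW. Qed.
Let q0 : q != 0.
Proof.
apply/eqP => e; move/eqP: qp; rewrite e expr0n gtn_eqF //=.
by rewrite eq_sym oppr_eq0 oner_eq0.
Qed.
Let q2 : q * q - 1 != 0.
Proof. by rewrite subr_eq0 -[q * q]expr1 qq_prim. Qed.
Let q4 : p <> 2 -> q * q + 1 != 0.
Proof.
move=> p2; have : (q * q) ^+ 2 != 1.
  by apply: qq_prim; rewrite /= ltn_neqAle hp eq_sym andbT; apply/eqP.
by rewrite sqrf_eq1 negb_or addr_eq0 => /andP[].
Qed.
Let s0 : q - q^-1 != 0.
Proof.
by rewrite -(mulfK q0 (q - q^-1)) mulf_neq0 ?invr_eq0 // mulrBl mulVf.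
Qed.

Local Notation scal_env := [:: q; q^-1; xi; (q - q^-1)^-1].

Definition Ua_seq (A : algType L) (g : gen_a -> A) : seq A :=
  [:: g gaB; g gaF; g gaC; g gaE; g gak; g gak'; g gaK; g gaK'].
Definition Us_seq (A : algType L) (g : gen_s -> A) : seq A :=
  [:: g gsF1; g gsF2; g gsphi1; g gsphi2; g gsK1; g gsK1'; g gsK2; g gsK2'].

Let xiq : (xi * q) * (xi * q^-1) = 1.
Proof. by rewrite mulrACA -expr2 xi2 mul1r divff. Qed.
Let xiqV : (xi * q^-1) * (xi * q) = 1. Proof. by rewrite mulrC. Qed.
Let qq : q^-1 * q^-1 * (q * q) = 1.
Proof. by rewrite mulrACA mulVf // mulr1. Qed.
Let qqV : q * q * (q^-1 * q^-1) = 1. Proof. by rewrite mulrC. Qed.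
Let m11 : (-1) * (-1) = 1 :> L. Proof. by rewrite mulrNN mulr1. Qed.

Lemma Ua_rules_hold (A : algType L) (g : gen_a -> A) :
  sat (Ua_rel p q xi g) -> rules_hold scal_env (Ua_seq g) Ua_rules.
Proof.
move=> /satP /=.
move=> [kk [k'k [KK [K'K [Kp [kp [kK [KF [KE [EF [Fp [Ep [kE [kF [kB [KB [kC [KC
  [BB [CC [BC [FC [BE _]]]]]]]]]]]]]]]]]]]]]]].
have [s1 s2 s3 s4] := torus_swap kk k'k KK K'K kK.
have qE : q ^+ 2 = q * q by rewrite expr2.
have qV2 : q ^- 2 = q^-1 * q^-1 by rewrite -exprVn expr2.
rewrite -scaleN1r in kB; rewrite -scaleN1r in kC.
rewrite qV2 in KF; rewrite qE in KE.
rewrite expr2 in BB; rewrite expr2 in CC.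
do ![split=> //=]; rewrite ?scale1r //.
- exact: (swap_inv kk k'k kF xiq).
- exact: (swap_inv kk k'k kE xiqV).
- exact: (swap_inv kk k'k kB m11).
- exact: (swap_inv kk k'k kC m11).
- exact: (swap_inv KK K'K KF qq).
- exact: (swap_inv KK K'K KE qqV).
- exact: (swap_inv KK K'K KB xiq).
- exact: (swap_inv KK K'K KC xiqV).
- by rewrite scaleNr -scalerBr -EF addrC subrK.
- by rewrite scaleNr [- _ + _]addrC -opprB -scalerBr -BC opprB addrC subrK.
- by apply/esym/eqP; rewrite -subr_eq0; apply/eqP.
- by apply/esym/eqP; rewrite -subr_eq0; apply/eqP.
Qed.

(* For p <> 2 the last two rules follow from the Serre relations. *)
Lemma Serre_rules_hold (A : algType L) (g : gen_a -> A) :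
  sat (Ua_rel p q xi g) -> rules_hold scal_env (Ua_seq g) (Serre_rules p).
Proof.
move=> /satP; rewrite /Ua_rel /Serre_rules; case: (p =P 2%N) => [->|p2] /=.
  do 10 move=> [_]; move=> [FF [EE]]; do 11 move=> [_].
  by rewrite !mulrA => -[<- [<- _]]; rewrite -!expr2 FF EE !scale1r.
have c0 : xi * (q + q^-1) != 0.
  have -> : q + q^-1 = (q * q + 1) * q^-1 by rewrite mulrDl mul1r mulfK.
  apply: mulf_neq0; last by apply: mulf_neq0; [exact: q4|rewrite invr_eq0].
  by apply: contra_eq_neq xi2 => ->; rewrite expr0n /= eq_sym oner_neq0.
do 18 move=> [_]; move=> [BB [CC]]; do 3 move=> [_]; move=> [hF [hE _]].
rewrite !scaleN1r !scale1r !mulrA (Serre_commute c0 BB hF) (Serre_commute c0 CC hE).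
split; last split=> //; apply/eqP.
  by rewrite -subr_eq0 opprB addrA addrAC hF.
by rewrite -subr_eq0 opprB addrA addrAC hE.
Qed.

Lemma Us_rules_hold (A : algType L) (g : gen_s -> A) :
  sat (Us_rel p q xi g) -> rules_hold scal_env (Us_seq g) Us_rules.
Proof.
move=> /satP /=.
move=> [kk [k'k [KK [K'K [Kp [kp [kK [F11 [F22 [_ [P11 [P22 [_ [K1F1 [K1F2 [K2F1
  [K2F2 [K1P1 [K1P2 [K2P1 [K2P2 [F1P1 [F2P2 [F1P2 [F2P1 _]]]]]]]]]]]]]]]]]]]]]]]]].
have [s1 s2 s3 s4] := torus_swap kk k'k KK K'K kK.
rewrite -scaleN1r in K1F1; rewrite -scaleN1r in K2F2.
rewrite -scaleN1r in K1P1; rewrite -scaleN1r in K2P2.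
rewrite -scaleNr in K1F2; rewrite -scaleNr in K2F1.
rewrite -scaleNr in K1P2; rewrite -scaleNr in K2P1.
move/(swap_conj k'k): K1F1 => K1F1; move/(swap_conj k'k): K1F2 => K1F2.
move/(swap_conj k'k): K1P1 => K1P1; move/(swap_conj k'k): K1P2 => K1P2.
move/(swap_conj K'K): K2F1 => K2F1; move/(swap_conj K'K): K2F2 => K2F2.
move/(swap_conj K'K): K2P1 => K2P1; move/(swap_conj K'K): K2P2 => K2P2.
have nxiq : - (xi * q) * - (xi * q^-1) = 1 by rewrite mulrNN.
have nxiqV : - (xi * q^-1) * - (xi * q) = 1 by rewrite mulrNN.
rewrite expr2 in F11; rewrite expr2 in F22; rewrite expr2 in P11; rewrite expr2 in P22.
do ![split=> //=]; rewrite ?scale1r //.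
- exact: (swap_inv kk k'k K1F1 m11).
- exact: (swap_inv KK K'K K2F2 m11).
- exact: (swap_inv kk k'k K1P1 m11).
- exact: (swap_inv KK K'K K2P2 m11).
- exact: (swap_inv kk k'k K1F2 nxiqV).
- exact: (swap_inv KK K'K K2F1 nxiqV).
- exact: (swap_inv kk k'k K1P2 nxiq).
- exact: (swap_inv KK K'K K2P1 nxiq).
- by rewrite scaleN1r [- _ + _]addrC -opprB -F1P1 opprB addrC subrK.
- by rewrite scaleN1r [- _ + _]addrC -opprB -F2P2 opprB addrC subrK.
- by apply/esym/eqP; rewrite -subr_eq0; apply/eqP.
- by apply/esym/eqP; rewrite -subr_eq0; apply/eqP.
Qed.

Definition sigma_fam (A : algType L) (g : gen_a -> A) (x : gen_s) : A :=
  let B := g gaB in let F := g gaF in let C := g gaC in let E := g gaE in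
  let k := g gak in let k' := g gak' in let K := g gaK in let K' := g gaK' in
  match x with
  | gsF1 => (q - q^-1) *: (xi *: (B * F) - q^-1 *: (F * B))
  | gsF2 => - ((q - q^-1) *: (C * k'))
  | gsphi1 => E * C - (xi * q) *: (C * E)
  | gsphi2 => B * k
  | gsK1 => K * k
  | gsK1' => K' * k'
  | gsK2 => k'
  | gsK2' => k
  end.

Definition sigma_inv_fam (A : algType L) (g : gen_s -> A) (x : gen_a) : A :=
  let F1 := g gsF1 in let F2 := g gsF2 in
  let phi1 := g gsphi1 in let phi2 := g gsphi2 in
  let K1 := g gsK1 in let K1' := g gsK1' in
  let K2 := g gsK2 in let K2' := g gsK2' in
  match x with
  | gaF => - ((((q - q^-1) ^+ 2)^-1) *: (F1 * F2 + (xi * q) *: (F2 * F1)))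
  | gaB => phi2 * K2
  | gaC => - ((q - q^-1)^-1 *: (F2 * K2'))
  | gaE => - (q^-1 *: (phi1 * phi2 + (xi * q) *: (phi2 * phi1)))
  | gak => K2'
  | gak' => K2
  | gaK => K1 * K2
  | gaK' => K1' * K2'
  end.

Lemma q2_p2 : p = 2 -> q * q = -1. Proof. by move=> p2; rewrite -qp p2 expr2. Qed.

Lemma qV_p2 : p = 2 -> q^-1 = - q.
Proof. by move=> /q2_p2 e; apply: (mulfI q0); rewrite mulrN e opprK divff. Qed.

(** For p = 2 some coefficients vanish only modulo q * q = -1; writing q^-1 as -q lets [ring] use
    that equation. *)
Ltac scalars_p2 p2 :=
  repeat split; rewrite ?(qV_p2 p2);
  let h := fresh in destruct hxi as [h|h]; rewrite ?h; ring: (q2_p2 p2).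

(* The cross terms of (xy + xi q yx)^p vanish, and q^p = -1. *)
Lemma qcomm_expr (A : algType L) (x y : A) : x ^+ 2 = 0 -> y ^+ 2 = 0 ->
  (x * y + (xi * q) *: (y * x)) ^+ p = (x * y) ^+ p - xi ^- p *: (y * x) ^+ p.
Proof.
rewrite !expr2 => xx yy; case: p p_gt0 qp => // n _ qn.
have -> : xi ^- n.+1 = xi ^+ n.+1.
  by case: hxi => ->; rewrite -?exprVn ?invrN invr1.
rewrite exprD_orth.
- by rewrite exprZn exprMn qn mulrN1 scaleNr.
- by rewrite -scalerAr mulrA -[x * y * y]mulrA yy mulr0 mul0r scaler0.
- by rewrite -scalerAl mulrA -[y * x * x]mulrA xx mulr0 mul0r scaler0.
Qed.

Lemma sigma_sat (A : algType L) (g : gen_a -> A) :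
  sat (Ua_rel p q xi g) -> sat (Us_rel p q xi (sigma_fam g)).
Proof.
move=> hg; have H := Ua_rules_hold hg.
have S := rules_hold_cat H (Serre_rules_hold hg).
move/satP: (hg) => /=.
move=> [kk [k'k [KK [K'K [Kp [kp [kK [_ [_ [_ [Fp [Ep _]]]]]]]]]]]].
set f := sigma_fam g.
have fF1 : f gsF1 ^+ 2 = 0.
  rewrite /f /=; move: S; rewrite /Serre_rules; case: eqP => [p2|_] S; nc S.
    by scalars_p2 p2.
  by scalars.
have fF2 : f gsF2 ^+ 2 = 0 by rewrite /f /=; nc H; scalars.
have fP1 : f gsphi1 ^+ 2 = 0.
  rewrite /f /=; move: S; rewrite /Serre_rules; case: eqP => [p2|_] S; nc S.
    by scalars_p2 p2.
  by scalars.
have fP2 : f gsphi2 ^+ 2 = 0 by rewrite /f /=; nc H; scalars.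
(* This combination of the images is F up to -(q - q^-1)^2, the reciprocal of the constant in
   [sigma_inv_fam]; its p-th power vanishes with F^p. *)
have fFF : f gsF1 * f gsF2 + (xi * q) *: (f gsF2 * f gsF1) =
    - ((q - q^-1) * (q - q^-1)) *: g gaF.
  rewrite /f /=; nc H; scalars.
have fPP : f gsphi1 * f gsphi2 + (xi * q) *: (f gsphi2 * f gsphi1) = - q *: g gaE.
  rewrite /f /=; nc H; scalars.
have kp' : g gak' ^+ (2 * p) = 1.
  by rewrite -[LHS]mulr1 -kp -exprMn_comm ?k'k ?expr1n // /GRing.comm k'k kk.
have fK1 : f gsK1 ^+ (2 * p) = 1.
  by rewrite exprMn_comm ?Kp ?kp ?mulr1.
(* The body of [f] is hidden until the power relations are rewritten; otherwise simplification would
   expand the images and the facts above would no longer match. *)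
have fE : f = sigma_fam g by [].
clearbody f; apply/satP; rewrite /Us_rel -!qcomm_expr // fFF fPP /=.
rewrite !exprZn Fp Ep !scaler0 fF1 fF2 fP1 fP2 fK1.
do ![split=> //]; rewrite fE /= ?kp' //; nc H; scalars.
Qed.

Lemma sigma_inv_sat (A : algType L) (g : gen_s -> A) :
  sat (Us_rel p q xi g) -> sat (Ua_rel p q xi (sigma_inv_fam g)).
Proof.
move=> hg; have H := Us_rules_hold hg.
move/satP: (hg) => /=.
move=> [kk [k'k [KK [K'K [Kp [kp [kK [F11 [F22 [Fp [P11 [P22 [Pp _]]]]]]]]]]]]].
set f := sigma_inv_fam g.
have fF : f gaF ^+ p = 0.
  by rewrite /f /= -scaleNr exprZn qcomm_expr // Fp scaler0.
have fE : f gaE ^+ p = 0.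
  by rewrite /f /= -scaleNr exprZn qcomm_expr // Pp scaler0.
have k'p : g gsK2' ^+ (2 * p) = 1.
  by rewrite -[LHS]mulr1 -kp -exprMn_comm ?K'K ?expr1n // /GRing.comm K'K KK.
have fK : f gaK ^+ (2 * p) = 1.
  by rewrite exprMn_comm ?Kp ?kp ?mulr1.
rewrite /Ua_rel sat_cat; split; apply/satP.
  have hf : f = sigma_inv_fam g by [].
  clearbody f; cbn [foldr fst snd]; rewrite fF fE fK.
  do ![split=> //]; rewrite hf /= ?k'p // -?exprVn ?expr2; nc H; scalars.
rewrite /f; case: (p =P 2%N) => [p2|_] /=.
  (* For p = 2 the relation of order 2p has degree four and xi^-2 = 1, so it can be used as a
     rewriting rule. *)
  have {}Fp : g gsF2 * (g gsF1 * (g gsF2 * g gsF1)) =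
      1 *: (g gsF1 * (g gsF2 * (g gsF1 * g gsF2))).
    apply/esym/eqP; rewrite scale1r -subr_eq0; move/eqP: Fp.
    by rewrite p2 xi2 invr1 scale1r !expr2 !mulrA.
  have {}Pp : g gsphi2 * (g gsphi1 * (g gsphi2 * g gsphi1)) =
      1 *: (g gsphi1 * (g gsphi2 * (g gsphi1 * g gsphi2))).
    apply/esym/eqP; rewrite scale1r -subr_eq0; move/eqP: Pp.
    by rewrite p2 xi2 invr1 scale1r !expr2 !mulrA.
  have H2 : rules_hold scal_env (Us_seq g) (Us_rules ++
      [:: ([:: 1; 0; 1; 0], [:: (SOne, [:: 0; 1; 0; 1])]);
          ([:: 3; 2; 3; 2], [:: (SOne, [:: 2; 3; 2; 3])])]%N).
    by apply: (rules_hold_cat H); split; [exact: Fp|split=> //; exact: Pp].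
  rewrite -exprVn ?expr2; split; last split=> //.
    nc H2; scalars_p2 p2.
  nc H2; scalars_p2 p2.
(* For p <> 2 the quadratic rules of U_s already imply the Serre relations. *)
rewrite -exprVn expr2; split; last split=> //.
  nc H; scalars.
nc H; scalars.
Qed.

Lemma sigma_invK (A : algType L) (g : gen_s -> A) x :
  sat (Us_rel p q xi g) -> sigma_fam (sigma_inv_fam g) x = g x.
Proof.
move=> hg; have H := Us_rules_hold hg.
by case: x; rewrite /= -?exprVn ?expr2; nc H; scalars.
Qed.

Lemma sigmaK (A : algType L) (g : gen_a -> A) x :
  sat (Ua_rel p q xi g) -> sigma_inv_fam (sigma_fam g) x = g x.
Proof.
move=> hg; have H := Ua_rules_hold hg.
by case: x; rewrite /= -?exprVn ?expr2; nc H; scalars.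
Qed.

Section Map.
Variables (A B : algType L) (f : {lrmorphism A -> B}).

Let fD x y : f (x + y) = f x + f y. Proof. exact: rmorphD. Qed.
Let fN x : f (- x) = - f x. Proof. exact: rmorphN. Qed.
Let fM x y : f (x * y) = f x * f y. Proof. exact: rmorphM. Qed.
Let fZ a x : f (a *: x) = a *: f x. Proof. exact: linearZ. Qed.
Let fE := (fD, fN, fM, fZ).

Lemma sigma_fam_map (g : gen_a -> A) x :
  f (sigma_fam g x) = sigma_fam (fun y => f (g y)) x.
Proof. by case: x; rewrite /= ?fE. Qed.

Lemma sigma_inv_fam_map (g : gen_s -> A) x :
  f (sigma_inv_fam g x) = sigma_inv_fam (fun y => f (g y)) x.
Proof. by case: x; rewrite /= ?fE. Qed.

End Map.

(* [gl x] and [gr x] stand for x (x) 1 and 1 (x) x. *)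
Definition delta_fam (T : algType L) (gl gr : gen_a -> T) (x : gen_a) : T :=
  match x with
  | gaB => gl gaB + gl gak' * gr gaB
  | gaF => gl gaF + gl gaK' * gr gaF
  | gaC => gl gaC * gr gak + gr gaC
  | gaE => gl gaE * gr gaK + gr gaE
  | _ => gl x * gr x
  end.

(* The letters of the second tensor factor are shifted by 8. *)
Definition cross_rules : seq ncrule :=
  [seq ([:: 8 + ij.1; ij.2], [:: (SOne, [:: ij.2; 8 + ij.1])])%N |
     ij <- [seq (i, j) | i <- iota 0 8, j <- iota 0 8]].

Lemma cross_rules_hold (T : algType L) (gl gr : gen_a -> T) :
  (forall x y, gr y * gl x = gl x * gr y) ->
  rules_hold scal_env (Ua_seq gl ++ Ua_seq gr) cross_rules.
Proof.
move=> hc; rewrite /cross_rules /=.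
by do ![split=> //]; rewrite scale1r hc.
Qed.

Lemma two_rules_hold (T : algType L) (gl gr : gen_a -> T) rs :
  (forall x y, gr y * gl x = gl x * gr y) ->
  all (rule_within 8) rs ->
  rules_hold scal_env (Ua_seq gl) rs ->
  rules_hold scal_env (Ua_seq gr) rs ->
  rules_hold scal_env (Ua_seq gl ++ Ua_seq gr)
    (rs ++ shift_rules 8 rs ++ cross_rules).
Proof.
move=> hc h8 hl hr; apply: rules_hold_cat; last apply: rules_hold_cat.
- exact: rules_hold_catl.
- exact: rules_hold_shift.
- exact: cross_rules_hold.
Qed.

Lemma delta_sat (T : algType L) (gl gr : gen_a -> T) :
  sat (Ua_rel p q xi gl) -> sat (Ua_rel p q xi gr) ->
  (forall x y, gr y * gl x = gl x * gr y) -> sat (Ua_rel p q xi (delta_fam gl gr)).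
Proof.
move=> hl hr hc.
have Hl := Ua_rules_hold hl; have Hr := Ua_rules_hold hr.
have Sl := rules_hold_cat Hl (Serre_rules_hold hl).
have Sr := rules_hold_cat Hr (Serre_rules_hold hr).
have H := two_rules_hold hc (isT : all (rule_within 8) Ua_rules) Hl Hr.
have {Sl Sr} S : rules_hold scal_env (Ua_seq gl ++ Ua_seq gr)
    ((Ua_rules ++ Serre_rules p) ++ shift_rules 8 (Ua_rules ++ Serre_rules p) ++
     cross_rules).
  by apply: two_rules_hold => //; rewrite /Serre_rules; case: eqP.
move/satP: hl => /=.
move=> [kk [k'k [KK [K'K [Kp [kp [kK [_ [_ [_ [Fp [Ep _]]]]]]]]]]]].
move/satP: hr => /=.
move=> [rkk [rk'k [rKK [rK'K [rKp [rkp [rkK [_ [_ [_ [rFp [rEp _]]]]]]]]]]]].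
set f := delta_fam gl gr.
have z1 : (q * q) ^+ p = 1 by rewrite exprMn qp mulrNN mulr1.
have fF : f gaF ^+ p = 0.
  apply: (qbin_expr0 p_gt0 z1 qq_prim _ Fp).
    by nc H; scalars.
  by rewrite exprMn_comm ?rFp ?mulr0 // /GRing.comm hc.
have fE : f gaE ^+ p = 0.
  (* The summands are exchanged: with x = 1 (x) E and y = E (x) K one has yx = q^2 xy, from K E =
     q^2 E K in the second factor. *)
  rewrite /f /= addrC; apply: (qbin_expr0 p_gt0 z1 qq_prim _ rEp).
    by nc H; scalars.
  by rewrite exprMn_comm ?Ep ?mul0r // /GRing.comm hc.
have fK : f gaK ^+ (2 * p) = 1.
  by rewrite exprMn_comm ?Kp ?rKp ?mulr1 // /GRing.comm hc.
have fk : f gak ^+ (2 * p) = 1.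
  by rewrite exprMn_comm ?kp ?rkp ?mulr1 // /GRing.comm hc.
rewrite /Ua_rel sat_cat; split; apply/satP.
  have hf : f = delta_fam gl gr by [].
  clearbody f; cbn [foldr fst snd]; rewrite fF fE fK fk.
  do ![split=> //]; rewrite hf /= -?exprVn ?expr2; nc H; scalars.
rewrite /f /Serre_rules in S *; case: (p =P 2%N) S => [p2|_] S /=;
  split; [| split=> // | | split=> //]; nc S; try by scalars.
all: scalars_p2 p2.
Qed.

Definition antipode_fam (A : algType L) (g : gen_a -> A) (x : gen_a) : A :=
  match x with
  | gaB => - (g gak * g gaB)
  | gaF => - (g gaK * g gaF)
  | gaC => - (g gaC * g gak')
  | gaE => - (g gaE * g gaK')
  | gak => g gak'
  | gak' => g gak
  | gaK => g gaK'
  | gaK' => g gaK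
  end.

Lemma antipode_sat (A : algType L) (g : gen_a -> A) :
  sat (Ua_rel p q xi g) -> sat (Ua_rel p q xi (antipode_fam g : gen_a -> A^c)).
Proof.
move=> hg; have H := Ua_rules_hold hg.
have S := rules_hold_cat H (Serre_rules_hold hg).
move/satP: (hg) => /=.
move=> [kk [k'k [KK [K'K [Kp [kp [kK [KF [KE [_ [Fp [Ep _]]]]]]]]]]]].
set f : gen_a -> A^c := antipode_fam g.
have fF : f gaF ^+ p = 0.
  (* Powers in [A^c] and in A agree, and -K F is a scalar multiple of F K. *)
  rewrite revrX /f /= -scaleN1r KF scalerA exprZn (skew_expr0 KF Fp) scaler0 //.
have fE : f gaE ^+ p = 0.
  rewrite revrX /f /= -scaleN1r exprZn.
  rewrite (@skew_expr0 _ _ _ _ (q^-1 * q^-1) _ _ Ep) ?scaler0 //.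
  by nc H; scalars.
have fK : f gaK ^+ (2 * p) = 1 by rewrite revrX; exact: inv_expr Kp.
have fk : f gak ^+ (2 * p) = 1 by rewrite revrX; exact: inv_expr kp.
rewrite /Ua_rel sat_cat; split; apply/satP.
  have hf : f = antipode_fam g by [].
  clearbody f; cbn [foldr fst snd]; rewrite fF fE fK fk.
  do ![split=> //]; rewrite -?exprVn ?expr2 ?mulcE hf /=; nc H; scalars.
rewrite /f /Serre_rules in S *; case: (p =P 2%N) S => [p2|_] S /=;
  split; [| split=> // | | split=> //]; rewrite ?mulcE; nc S; try by scalars.
all: scalars_p2 p2.
Qed.

Definition delta_s_fam (T : algType L) (gl gr : gen_s -> T) (x : gen_s) : T :=
  match x with
  | gsF1 => gl gsF1 + gl gsK1' * gr gsF1
  | gsF2 => gl gsF2 + gl gsK2' * gr gsF2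
  | gsphi1 => gl gsphi1 * gr gsK1 + gr gsphi1
  | gsphi2 => gl gsphi2 * gr gsK2 + gr gsphi2
  | _ => gl x * gr x
  end.

Section TwoFamilies.
Variables (T : algType L) (gl gr : gen_a -> T).
Hypotheses (hl : sat (Ua_rel p q xi gl)) (hr : sat (Ua_rel p q xi gr)).
Hypothesis hc : forall x y, gr y * gl x = gl x * gr y.

Let bc : T := gl gaB * gl gak * (gr gaC * gr gak').
Let Phi : T := 1 + (q - q^-1) *: bc.
(** The inverse of [Phi], since [bc] squares to zero with B and C. *)
Let Psi : T := 1 - (q - q^-1) *: bc.

Let H : rules_hold scal_env (Ua_seq gl ++ Ua_seq gr)
  (Ua_rules ++ shift_rules 8 Ua_rules ++ cross_rules).
Proof.
have Hl := Ua_rules_hold hl; have Hr := Ua_rules_hold hr.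
exact: (two_rules_hold hc (isT : all (rule_within 8) Ua_rules) Hl Hr).
Qed.

Lemma twist_famK : Phi * Psi = 1.
Proof. by rewrite /Phi /Psi /bc; nc H; scalars. Qed.
Lemma twist_fam_invK : Psi * Phi = 1.
Proof. by rewrite /Phi /Psi /bc; nc H; scalars. Qed.

(** Conjugation by [Phi] is multiplicative, so comparing the coproducts amounts to these eight
    identities. *)
Lemma twist_fam_conj x : Psi * sigma_fam (delta_fam gl gr) x * Phi =
  delta_s_fam (sigma_fam gl) (sigma_fam gr) x.
Proof. by rewrite /Phi /Psi /bc; case: x => /=; nc H; scalars. Qed.

End TwoFamilies.

Section Antipode.
Variables (A : algType L) (g : gen_a -> A).
Hypothesis hg : sat (Ua_rel p q xi g).
(** [V] is m (S_a (x) id)(Phi): its sign and its k^-1 come from S_a(Bk) = -B. *)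
Let U : A := 1 + (q - q^-1) *: (g gaB * g gaC * g gak).
Let V : A := 1 - (q - q^-1) *: (g gaB * g gaC * g gak').

Let H : rules_hold scal_env (Ua_seq g) Ua_rules.
Proof. exact: (Ua_rules_hold hg). Qed.

Lemma antipodeUV : U * V = 1.
Proof. by rewrite /U /V; nc H; scalars. Qed.
Lemma antipodeVU : V * U = 1.
Proof. by rewrite /U /V; nc H; scalars. Qed.

Definition antipode_s_fam (B : algType L) (h : gen_s -> B) (x : gen_s) : B :=
  match x with
  | gsF1 => - (h gsK1 * h gsF1)
  | gsF2 => - (h gsK2 * h gsF2)
  | gsphi1 => - (h gsphi1 * h gsK1')
  | gsphi2 => - (h gsphi2 * h gsK2')
  | gsK1 => h gsK1'
  | gsK1' => h gsK1
  | gsK2 => h gsK2'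
  | gsK2' => h gsK2
  end.

Variable S : {linear A -> A}.
Hypothesis SM : forall x y, S (x * y) = S y * S x.
Hypothesis Sg : forall x, S (g x) = antipode_fam g x.

Lemma antipode_conj x : U * S (sigma_fam g x) * V =
  antipode_s_fam (sigma_fam g) x.
Proof.
have SB a b : S (a - b) = S a - S b by exact: linearB.
have SZ c a : S (c *: a) = c *: S a by exact: linearZ.
have SN a : S (- a) = - S a by exact: linearN.
by rewrite /U /V; case: x; rewrite /= ?(SB, SZ, SN, SM, Sg) /=; nc H; scalars.
Qed.

End Antipode.

Lemma Ua_gen_sat : sat (Ua_rel p q xi (Ua_gen q xi hp)).
Proof.
move=> r; have -> : Ua_rel p q xi (Ua_gen q xi hp) =
    Ua_rel p q xi (fun x => api (pres_ideal (Ua_pres q xi hp)) (fvar L x)) by [].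
by rewrite Ua_rel_map => /mapP[s hs ->]; exact: pvar_rel.
Qed.

Lemma Us_gen_sat : sat (Us_rel p q xi (Us_gen q xi hp)).
Proof.
move=> r; have -> : Us_rel p q xi (Us_gen q xi hp) =
    Us_rel p q xi (fun x => api (pres_ideal (Us_pres q xi hp)) (fvar L x)) by [].
by rewrite Us_rel_map => /mapP[s hs ->]; exact: pvar_rel.
Qed.

Lemma Ua_generates : generates (Ua_gen q xi hp).
Proof. exact: (@pvar_generates L (Ua_pres q xi hp)). Qed.

Lemma Us_generates : generates (Us_gen q xi hp).
Proof. exact: (@pvar_generates L (Us_pres q xi hp)). Qed.

Lemma Ua_lift (A : algType L) (g : gen_a -> A) : sat (Ua_rel p q xi g) ->
  exists f : {lrmorphism Ua q xi hp -> A}, forall x, f (Ua_gen q xi hp x) = g x.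
Proof.
move=> hg; apply: (@pres_lift L (Ua_pres q xi hp)) => r hr.
apply: (hg (feval g r.1, feval g r.2)).
have -> : Ua_rel p q xi g =
    [seq (feval g s.1, feval g s.2) | s <- Ua_rel p q xi (@fvar L gen_a)].
  rewrite -Ua_rel_map; congr (Ua_rel _ _ _ _).
  by apply/funext => x; exact/esym/feval_var.
by apply/mapP; exists r.
Qed.

Lemma Us_lift (A : algType L) (g : gen_s -> A) : sat (Us_rel p q xi g) ->
  exists f : {lrmorphism Us q xi hp -> A}, forall x, f (Us_gen q xi hp x) = g x.
Proof.
move=> hg; apply: (@pres_lift L (Us_pres q xi hp)) => r hr.
apply: (hg (feval g r.1, feval g r.2)).
have -> : Us_rel p q xi g =
    [seq (feval g s.1, feval g s.2) | s <- Us_rel p q xi (@fvar L gen_s)].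
  rewrite -Us_rel_map; congr (Us_rel _ _ _ _).
  by apply/funext => x; exact/esym/feval_var.
by apply/mapP; exists r.
Qed.

Lemma sat_Ua_map (A B : algType L) (f : {lrmorphism A -> B}) (g : gen_a -> A) :
  sat (Ua_rel p q xi g) -> sat (Ua_rel p q xi (fun x => f (g x))).
Proof. by move=> hg r; rewrite Ua_rel_map => /mapP[s /hg hs ->] /=; rewrite hs. Qed.

Lemma eps_a_sat : sat (Ua_rel p q xi (eps_a L)).
Proof.
have p0 : (0 : L^o) ^+ p = 0 by rewrite expr0n; case: p hp.
apply/satP; rewrite /Ua_rel; case: eqP => _ /=;
  by rewrite ?(mulr0, mul0r, mulr1, p0, expr0n, scaler0, subrr, oppr0,
    expr1n, addr0).
Qed.

(** * The Hopf structure of U_a *)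

Section UaHopf.
Variables (UA : algType L) (ga : gen_a -> UA).
Hypothesis sat_a : sat (Ua_rel p q xi ga).
Hypothesis gen_ga : generates ga.
Hypothesis lift_a : forall (A : algType L) (g : gen_a -> A),
  sat (Ua_rel p q xi g) -> exists f : {lrmorphism UA -> A}, forall x, f (ga x) = g x.

Let B := ga gaB. Let F := ga gaF. Let C := ga gaC. Let E := ga gaE.
Let k := ga gak. Let k' := ga gak'. Let K := ga gaK. Let K' := ga gaK'.

(** U_a enters only through generation and its universal property. That [hS] reverses products is
    recorded because [hopfAlgebra] does not contain it and the transport to U_s uses it. *)
Lemma Ua_hopf : exists h : hopfAlgebra UA,
  [/\ forall x, hdelta h (ga x) =
        delta_fam (fun y => tinl UA (ga y)) (fun y => tinr UA (ga y)) x,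
      forall x, heps h (ga x) = eps_a L x,
      forall x, hS h (ga x) = antipode_fam ga x,
      forall x y, hS h (x * y) = hS h y * hS h x & hS h 1 = 1].
Proof.
have H := Ua_rules_hold sat_a.
have [] := @lift_a (tensor UA UA)
  (delta_fam (fun x => tinl UA (ga x)) (fun x => tinr UA (ga x))).
  apply: delta_sat.
  - exact: sat_Ua_map.
  - exact: sat_Ua_map.
  - by move=> x y; exact: tin_comm.
move=> D hD.
have [e he] := lift_a eps_a_sat.
have [s hs] := lift_a (antipode_sat sat_a).
(* [UA^c] has the same vector space as [UA], so [s] read as a self-map is linear and reverses
   products. *)
have ls : linear (s : UA -> UA) by move=> a x y; exact: (linearP s).
pose S : {linear UA -> UA} := linmap ls.
have SM x y : S (x * y) = S y * S x by exact: (rmorphM s).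
have S1 : S 1 = 1 by exact: (rmorph1 s).
have hSg x : S (ga x) = antipode_fam ga x by exact: hs.
have DB : D B = B \ot 1 + k' \ot B by rewrite hD /= tinM.
have DF : D F = F \ot 1 + K' \ot F by rewrite hD /= tinM.
have DC : D C = C \ot k + 1 \ot C by rewrite hD /= tinM.
have DE' : D E = E \ot K + 1 \ot E by rewrite hD /= tinM.
have Dk : D k = k \ot k by rewrite hD /= tinM.
have DK : D K = K \ot K by rewrite hD /= tinM.
have Dk' : D k' = k' \ot k' by rewrite hD /= tinM.
have DK' : D K' = K' \ot K' by rewrite hD /= tinM.
have D1 : D 1 = 1 \ot 1 by rewrite rmorph1.
have lD : linear D := linearP D.
have le : linear e := linearP e.
have lid : linear (@id UA) := @id_linear _ UA.
have aD := linearD' (@tassoc_linear _ UA UA UA).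
have tD := linearD' (tmap_linear lD lid).
have tD' := linearD' (tmap_linear lid lD).
have teD := linearD' (tmap_linear le lid).
have teD' := linearD' (tmap_linear lid le).
have gD := (DB, DF, DC, DE', Dk, DK, Dk', DK').
have [h [h1 h2 h3]] : exists h : hopfAlgebra UA,
    [/\ (forall x, hdelta h x = D x), (forall x, heps h x = e x) &
      (forall x, hS h x = S x)].
  apply: (generators_hopf gen_ga S1 SM) => i.
  - by case: i; rewrite gD ?tD ?tD' ?(tmapE lD lid) ?(tmapE lid lD) ?gD ?D1 ?tensDl
      ?tensDr ?aD ?tassocE ?addrA.
  - have lD' := linearD' (@tlunit_linear _ UA).
    by case: i; rewrite gD ?teD (tmapE le lid) ?(tmapE le lid) ?rmorph1 !he /=
      ?lD' ?tlunitE ?scale1r ?scale0r ?add0r ?addr0.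
  - have lD' := linearD' (@trunit_linear _ UA).
    by case: i; rewrite gD ?teD' (tmapE lid le) ?(tmapE lid le) ?rmorph1 !he /=
      ?lD' ?trunitE ?scale1r ?scale0r ?add0r ?addr0.
  - have bS := antil_bilin S; have lD' := linearD' (tlift_linear bS).
    case: i; rewrite gD ?lD' (tliftE bS) ?(tliftE bS) ?S1 !hSg he /=;
      by rewrite ?scale0r ?scale1r /B /F /C /E /k /k' /K /K'; nc H; scalars.
  - have bS := antir_bilin S; have lD' := linearD' (tlift_linear bS).
    case: i; rewrite gD ?lD' (tliftE bS) ?(tliftE bS) ?S1 !hSg he /=;
      by rewrite ?scale0r ?scale1r /B /F /C /E /k /k' /K /K'; nc H; scalars.
exists h; split=> [x|x|x|x y|].
- by rewrite h1.
- by rewrite h2.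
- by rewrite h3.
- by rewrite !h3.
- by rewrite h3.
Qed.

End UaHopf.

(** * Transport of the Hopf structure along sigma *)

Section Transport.
Variables (UA : algType L) (ga : gen_a -> UA) (US : algType L) (gs : gen_s -> US).
Hypothesis sat_a : sat (Ua_rel p q xi ga).
Hypothesis sat_s : sat (Us_rel p q xi gs).
Hypothesis gen_ga : generates ga.
Hypothesis gen_gs : generates gs.
Variables (f : {lrmorphism US -> UA}) (g : {lrmorphism UA -> US}).
Hypothesis hf : forall x, f (gs x) = sigma_fam ga x.
Hypothesis hg : forall x, g (ga x) = sigma_inv_fam gs x.

Let s := q - q^-1.
Let B := ga gaB. Let C := ga gaC. Let k := ga gak. Let k' := ga gak'.

Lemma sigma_cancel : cancel f g.
Proof.
apply: (generates_ext (f := g \o f : {lrmorphism US -> US}) (f' := idfun)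
  gen_gs) => i /=.
rewrite hf sigma_fam_map -[RHS](sigma_invK i sat_s).
by congr sigma_fam; apply/funext.
Qed.

Lemma sigma_inv_cancel : cancel g f.
Proof.
apply: (generates_ext (f := f \o g : {lrmorphism UA -> UA}) (f' := idfun)
  gen_ga) => i /=.
rewrite hg sigma_inv_fam_map -[RHS](sigmaK i sat_a).
by congr sigma_inv_fam; apply/funext.
Qed.

Variable ha : hopfAlgebra UA.
Hypothesis ha_delta : forall x, hdelta ha (ga x) =
  delta_fam (fun x => tinl UA (ga x)) (fun x => tinr UA (ga x)) x.
Hypothesis ha_eps : forall x, heps ha (ga x) = eps_a L x.
Hypothesis haSM : forall x y, hS ha (x * y) = hS ha y * hS ha x.
Hypothesis haS1 : hS ha 1 = 1.
Hypothesis haS : forall x, hS ha (ga x) = antipode_fam ga x.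

Definition twist_elt : tensor UA UA := 1 \ot 1 + s *: ((B * k) \ot (C * k')).
Definition twist_elt_inv : tensor UA UA := 1 \ot 1 - s *: ((B * k) \ot (C * k')).
Definition antipode_elt : UA := 1 + s *: (B * C * k).
Definition antipode_elt_inv : UA := 1 - s *: (B * C * k').

Let gl x := tinl UA (ga x).
Let gr x := tinr UA (ga x).
Let hl : sat (Ua_rel p q xi gl). Proof. exact: sat_Ua_map. Qed.
Let hr : sat (Ua_rel p q xi gr). Proof. exact: sat_Ua_map. Qed.
Let hc x y : gr y * gl x = gl x * gr y. Proof. exact: tin_comm. Qed.

Let bcE : (B * k) \ot (C * k') = gl gaB * gl gak * (gr gaC * gr gak').
Proof. by rewrite /gl /gr /tinl /tinr !tensM !mulr1 !mul1r. Qed.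

Lemma twist_eltK : twist_elt * twist_elt_inv = 1.
Proof. by rewrite /twist_elt /twist_elt_inv bcE; exact: (twist_famK hl hr hc). Qed.
Lemma twist_elt_invK : twist_elt_inv * twist_elt = 1.
Proof. by rewrite /twist_elt /twist_elt_inv bcE; exact: (twist_fam_invK hl hr hc). Qed.

Lemma antipode_eltK : antipode_elt * antipode_elt_inv = 1.
Proof. exact: (antipodeUV sat_a). Qed.
Lemma antipode_elt_invK : antipode_elt_inv * antipode_elt = 1.
Proof. exact: (antipodeVU sat_a). Qed.

Definition tw_delta (x : US) : tensor UA UA :=
  twist_elt_inv * hdelta ha (f x) * twist_elt.

Lemma tw_delta_linear : linear tw_delta.
Proof.
have lf : linear f := linearP f; have ld : linear (hdelta ha) := linearP (hdelta ha).
apply: (comp_linear (mulr_linear twist_elt)).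
apply: (comp_linear (mull_linear twist_elt_inv)).
exact: (comp_linear ld lf).
Qed.

Lemma tw_deltaM : {morph tw_delta : x y / x * y}.
Proof.
move=> x y; rewrite /tw_delta !rmorphM !mulrA.
by rewrite -[in RHS](mulrA _ twist_elt twist_elt_inv) twist_eltK mulr1.
Qed.

Lemma tw_delta_gen x : tw_delta (gs x) =
  delta_s_fam (fun x => tinl UA (f (gs x))) (fun x => tinr UA (f (gs x))) x.
Proof.
have -> : (fun x => tinl UA (f (gs x))) = sigma_fam gl.
  by apply/funext => y; rewrite hf; exact: (sigma_fam_map (@tinl L UA UA)).
have -> : (fun x => tinr UA (f (gs x))) = sigma_fam gr.
  by apply/funext => y; rewrite hf; exact: (sigma_fam_map (@tinr L UA UA)).
rewrite -(twist_fam_conj hl hr hc) /tw_delta hf sigma_fam_map.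
rewrite /twist_elt /twist_elt_inv bcE.
by do 2 congr (_ * _); congr sigma_fam; apply/funext.
Qed.

Let lg : linear g := linearP g.
Let lf : linear f := linearP f.
Let gM a b : g (a * b) = g a * g b. Proof. exact: rmorphM. Qed.
Let gN a : g (- a) = - g a. Proof. exact: rmorphN. Qed.
Let gfK x : g (f x) = x. Proof. exact: sigma_cancel. Qed.
Let mg : {morph g : x y / x * y} := rmorphM g.

Lemma tw_s_linear : linear (fun x => tmap g g (tw_delta x)).
Proof. exact: (comp_linear (tmap_linear lg lg) tw_delta_linear). Qed.
Lemma tw_s_monoid : monoid_morphism (fun x => tmap g g (tw_delta x)).
Proof.
split=> [|x y]; last by rewrite tw_deltaM (tmapM lg lg mg mg).
by rewrite /tw_delta !rmorph1 mulr1 twist_elt_invK tens1 (tmapE lg lg) rmorph1.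
Qed.

Lemma tmap_sigmaK (t : tensor UA UA) : tmap f f (tmap g g t) = t.
Proof.
move: t; apply: tensor_ext => [||a b] //.
  exact: (comp_linear (tmap_linear lf lf) (tmap_linear lg lg)).
by rewrite (tmapE lg lg) (tmapE lf lf) !sigma_inv_cancel.
Qed.

Lemma tw_antipode_linear :
  linear (fun x => g (antipode_elt * hS ha (f x) * antipode_elt_inv)).
Proof.
have lS : linear (hS ha) := linearP (hS ha).
apply: (comp_linear lg); apply: (comp_linear (mulr_linear antipode_elt_inv)).
by apply: (comp_linear (mull_linear antipode_elt)); exact: (comp_linear lS lf).
Qed.

(** Intended for the transported maps: once their values on the generators are the prescribed ones,
    each Hopf axiom is a check on eight elements. *)
Lemma Us_hopf_on_generators (D : {lrmorphism US -> tensor US US})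
    (e : {lrmorphism US -> L^o}) (S : {linear US -> US}) :
  (forall x, D (gs x) =
    delta_s_fam (fun x => tinl US (gs x)) (fun x => tinr US (gs x)) x) ->
  (forall x, e (gs x) = eps_s L x) ->
  (forall x, S (gs x) = antipode_s_fam gs x) ->
  (forall x y, S (x * y) = S y * S x) -> S 1 = 1 ->
  exists h : hopfAlgebra US, [/\ (forall x, hdelta h x = D x),
    (forall x, heps h x = e x) & (forall x, hS h x = S x)].
Proof.
move=> hD he hSg SM S1; have H := Us_rules_hold sat_s.
have DF1 : D (gs gsF1) = gs gsF1 \ot 1 + gs gsK1' \ot gs gsF1 by rewrite hD /= tinM.
have DF2 : D (gs gsF2) = gs gsF2 \ot 1 + gs gsK2' \ot gs gsF2 by rewrite hD /= tinM.
have DP1 : D (gs gsphi1) = gs gsphi1 \ot gs gsK1 + 1 \ot gs gsphi1.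
  by rewrite hD /= tinM.
have DP2 : D (gs gsphi2) = gs gsphi2 \ot gs gsK2 + 1 \ot gs gsphi2.
  by rewrite hD /= tinM.
have DK1 : D (gs gsK1) = gs gsK1 \ot gs gsK1 by rewrite hD /= tinM.
have DK2 : D (gs gsK2) = gs gsK2 \ot gs gsK2 by rewrite hD /= tinM.
have DK1' : D (gs gsK1') = gs gsK1' \ot gs gsK1' by rewrite hD /= tinM.
have DK2' : D (gs gsK2') = gs gsK2' \ot gs gsK2' by rewrite hD /= tinM.
have D1 : D 1 = 1 \ot 1 by rewrite rmorph1.
have lD : linear D := linearP D.
have le : linear e := linearP e.
have lid : linear (@id US) := @id_linear _ US.
have aD := linearD' (@tassoc_linear _ US US US).
have tD := linearD' (tmap_linear lD lid).
have tD' := linearD' (tmap_linear lid lD).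
have teD := linearD' (tmap_linear le lid).
have teD' := linearD' (tmap_linear lid le).
have gD := (DF1, DF2, DP1, DP2, DK1, DK2, DK1', DK2').
apply: (generators_hopf gen_gs S1 SM) => i.
- by case: i; rewrite gD ?tD ?tD' ?(tmapE lD lid) ?(tmapE lid lD) ?gD ?D1 ?tensDl
    ?tensDr ?aD ?tassocE ?addrA.
- have lD' := linearD' (@tlunit_linear _ US).
  by case: i; rewrite gD ?teD (tmapE le lid) ?(tmapE le lid) ?(rmorph1 e) !he /=
    ?lD' ?tlunitE ?scale1r ?scale0r ?add0r ?addr0.
- have lD' := linearD' (@trunit_linear _ US).
  by case: i; rewrite gD ?teD' (tmapE lid le) ?(tmapE lid le) ?(rmorph1 e) !he /=
    ?lD' ?trunitE ?scale1r ?scale0r ?add0r ?addr0.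
- have bS := antil_bilin S; have lD' := linearD' (tlift_linear bS).
  case: i; rewrite gD ?lD' (tliftE bS) ?(tliftE bS) ?S1 !hSg he /=;
    by rewrite ?scale0r ?scale1r; nc H; scalars.
- have bS := antir_bilin S; have lD' := linearD' (tlift_linear bS).
  case: i; rewrite gD ?lD' (tliftE bS) ?(tliftE bS) ?S1 !hSg he /=;
    by rewrite ?scale0r ?scale1r; nc H; scalars.
Qed.

Lemma Us_hopf : exists h : hopfAlgebra US,
  [/\ forall x, hdelta h x = tmap g g (tw_delta x),
      forall x, heps h x = heps ha (f x),
      forall x, hS h x = g (antipode_elt * hS ha (f x) * antipode_elt_inv),
      (forall x, hdelta h (gs x) =
        delta_s_fam (fun x => tinl US (gs x)) (fun x => tinr US (gs x)) x) &
      (forall x, heps h (gs x) = eps_s L x) /\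
      (forall x, hS h (gs x) = antipode_s_fam gs x)].
Proof.
pose D : {lrmorphism US -> tensor US US} := lrmap tw_s_linear tw_s_monoid.
pose e : {lrmorphism US -> L^o} := heps ha \o f.
pose S : {linear US -> US} := linmap tw_antipode_linear.
have hD x : D (gs x) =
    delta_s_fam (fun x => tinl US (gs x)) (fun x => tinr US (gs x)) x.
  rewrite -[LHS]/(tmap g g (tw_delta (gs x))) tw_delta_gen.
  case: x; rewrite /= !tinM /tinl /tinr ?(linearD' (tmap_linear lg lg)) !(tmapE lg lg);
    by rewrite ?(rmorph1 g) !gfK.
have he x : e (gs x) = eps_s L x.
  rewrite -[LHS]/(heps ha (f (gs x))) hf sigma_fam_map.
  have -> : (fun y => heps ha (ga y)) = eps_a L by apply/funext.
  case: x; rewrite /= ?(mulr0, mul0r, mulr1, scaler0, subrr, oppr0) //.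
have hSg x : S (gs x) = antipode_s_fam gs x.
  rewrite -[LHS]/(g (antipode_elt * hS ha (f (gs x)) * antipode_elt_inv)) hf.
  rewrite (antipode_conj sat_a haSM haS).
  by case: x; rewrite /antipode_s_fam -!hf ?gN ?gM !gfK.
have SM x y : S (x * y) = S y * S x.
  rewrite -[LHS]/(g (antipode_elt * hS ha (f (x * y)) * antipode_elt_inv)).
  rewrite (rmorphM f) haSM -[RHS]gM !mulrA.
  by rewrite -(mulrA _ antipode_elt_inv antipode_elt) antipode_elt_invK mulr1.
have S1 : S 1 = 1.
  rewrite -[LHS]/(g (antipode_elt * hS ha (f 1) * antipode_elt_inv)).
  rewrite (rmorph1 f) haS1 mulr1 antipode_eltK.
  exact: rmorph1.
have [h [h1 h2 h3]] := Us_hopf_on_generators hD he hSg SM S1.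
exists h; split=> // [x|]; first by rewrite h1.
by split=> x; rewrite ?h2 ?h3.
Qed.

(** Bk and Ck^-1 are skew primitive with group-likes k and k^-1; since k anticommutes with B and C,
    their commutator is -(BC - CB), which is the required multiple of k^-1 - k. *)
Lemma twist_elt_cocycle : twist_cocycle ha twist_elt.
Proof.
have H := Ua_rules_hold sat_a.
have dM a b : hdelta ha (a * b) = hdelta ha a * hdelta ha b by exact: rmorphM.
have eM a b : heps ha (a * b) = heps ha a * heps ha b by exact: rmorphM.
apply: (skew_primitive_cocycle (k := k) (k' := k') s0).
- rewrite dM !ha_delta /= !tinM mulrDl !tensM mul1r.
  by congr (_ + _ \ot _); rewrite /k; nc H; scalars.
- rewrite dM !ha_delta /= !tinM mulrDl !tensM mul1r.
  by congr (_ \ot _ + _); rewrite /k'; nc H; scalars.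
- by rewrite eM ha_eps mul0r.
- by rewrite eM ha_eps mul0r.
- by rewrite /B /k; nc H; scalars.
- by rewrite /C /k'; nc H; scalars.
- by rewrite /s /B /C /k /k'; nc H; scalars.
Qed.

Lemma Us_twist : exists hs : hopfAlgebra US,
  [/\ forall x, hdelta hs (gs x) =
        delta_s_fam (fun x => tinl US (gs x)) (fun x => tinr US (gs x)) x,
      forall x, heps hs (gs x) = eps_s L x,
      forall x, hS hs (gs x) = antipode_s_fam gs x,
      forall x, twist_elt_inv * hdelta ha (f x) * twist_elt = tmap f f (hdelta hs x) &
      (forall x, antipode_elt * hS ha (f x) * antipode_elt_inv = f (hS hs x)) /\
      (monoidally_equivalent (RepCat ha) (RepCat hs) /\
       monoidally_equivalent (fdRepCat ha) (fdRepCat hs))].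
Proof.
have [hs [hD he hS hDg [heg hSg]]] := Us_hopf.
have hPhi x : twist_elt_inv * hdelta ha (f x) * twist_elt = tmap f f (hdelta hs x).
  by rewrite hD tmap_sigmaK.
exists hs; split=> //; split=> [x|]; first by rewrite hS sigma_inv_cancel.
apply: (twist_equivalence sigma_cancel sigma_inv_cancel twist_eltK twist_elt_invK
  twist_elt_cocycle hPhi) => x.
by rewrite he.
Qed.

End Transport.
End UaUs.

(** * The root of unity *)

Section RootOfUnity.
Variables (R : realType) (p : nat).
Hypothesis hp : (2 <= p)%N.
Local Notation q := (qroot R p).

Lemma de_moivre (a : R) n :
  ((cos a +i* sin a)%C : R[i]) ^+ n = (cos (a *+ n) +i* sin (a *+ n))%C.
Proof.
elim: n => [|n IH]; first by rewrite expr0 mulr0n cos0 sin0.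
rewrite exprS IH mulrS cosD sinD; apply/eqP; rewrite eq_complex /= eqxx.
by rewrite [sin a * _ + _]addrC eqxx.
Qed.

Let p0 : (p%:R : R) != 0.
Proof. by rewrite pnatr_eq0 -lt0n ltnW. Qed.

Lemma qroot_expr : q ^+ p = -1.
Proof.
rewrite /qroot de_moivre -[_ / _ *+ _]mulr_natr divfK // cospi sinpi.
by apply/eqP; rewrite eq_complex /= oppr0 !eqxx.
Qed.

(** (q^2)^j = 1 would force q^j = 1 or q^j = -1, but the imaginary part sin(j pi / p) of q^j is
    positive. *)
Lemma qroot_prim j : (0 < j < p)%N -> (q * q) ^+ j != 1.
Proof.
move=> /andP[j0 jp]; rewrite exprMn -expr2 sqrf_eq1 /qroot de_moivre.
have s0 : 0 < sin ((pi / p%:R) *+ j : R).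
  have pp : 0 < p%:R :> R by rewrite ltr0n ltnW.
  apply: sin_gt0_pi; rewrite -[_ / _ *+ _]mulr_natr; apply/andP; split.
    by rewrite mulr_gt0 ?divr_gt0 ?pi_gt0 ?ltr0n // ltnW.
  by rewrite mulrAC ltr_pdivrMr // ltr_pM2l ?pi_gt0 // ltr_nat.
by rewrite !eq_complex /= oppr0 (gt_eqF s0) !andbF.
Qed.

End RootOfUnity.

(** [RepCat] and [fdRepCat] settle both readings of representation category: all modules, and
    finite-dimensional ones. *)
Theorem mainTheorem1 (R : realType) (p : nat) (hp : (2 <= p)%N) (xi : R[i])
    (hxi : xi = 1 \/ xi = -1) :
  let q := qroot R p in
  let Ua := Ua q xi hp in
  let Us := Us q xi hp in
  let B := Ua_gen q xi hp gaB in let F := Ua_gen q xi hp gaF in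
  let C := Ua_gen q xi hp gaC in let E := Ua_gen q xi hp gaE in
  let k := Ua_gen q xi hp gak in let k' := Ua_gen q xi hp gak' in
  let K := Ua_gen q xi hp gaK in
  let F1 := Us_gen q xi hp gsF1 in let F2 := Us_gen q xi hp gsF2 in
  let phi1 := Us_gen q xi hp gsphi1 in let phi2 := Us_gen q xi hp gsphi2 in
  let K1 := Us_gen q xi hp gsK1 in
  let K2 := Us_gen q xi hp gsK2 in let K2' := Us_gen q xi hp gsK2' in
  let Phi : tensor Ua Ua :=
    1 \ot 1 + (q - q^-1) *: ((B * k) \ot (C * k')) in
  (* U = m (id (x) S_a) (Phi^-1) = 1 - (q - q^-1) B k C.  Since k C = - C k, this
     is 1 + (q - q^-1) B C k; with the opposite sign the identity below fails
     for x = phi_2, where it would force 2 B = 2 B k^2. *)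
  let U : Ua := 1 + (q - q^-1) *: (B * C * k) in
  exists (ha : hopfAlgebra Ua) (hs : hopfAlgebra Us)
         (sigma : {lrmorphism Us -> Ua}) (sigma_inv : {lrmorphism Ua -> Us}),
    Ua_hopf_spec ha /\ Us_hopf_spec hs /\
    (cancel sigma sigma_inv /\ cancel sigma_inv sigma /\
     [/\ sigma F1 = (q - q^-1) *: (xi *: (B * F) - q^-1 *: (F * B)),
         sigma F2 = - ((q - q^-1) *: (C * k')),
         sigma phi1 = E * C - (xi * q) *: (C * E) &
         sigma phi2 = B * k] /\
     (sigma K1 = K * k /\ sigma K2 = k') /\
     [/\ sigma_inv F =
           - ((((q - q^-1) ^+ 2)^-1) *: (F1 * F2 + (xi * q) *: (F2 * F1))),
         sigma_inv B = phi2 * K2,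
         sigma_inv C = - ((q - q^-1)^-1 *: (F2 * K2')) &
         sigma_inv E = - (q^-1 *: (phi1 * phi2 + (xi * q) *: (phi2 * phi1)))] /\
     (sigma_inv K = K1 * K2 /\ sigma_inv k = K2')) /\
    (exists Phi_inv : tensor Ua Ua,
       inverse_of Phi Phi_inv /\
       twist_cocycle ha Phi /\
       (forall x : Us, Phi_inv * hdelta ha (sigma x) * Phi =
                       tmap sigma sigma (hdelta hs x))) /\
    (monoidally_equivalent (RepCat ha) (RepCat hs) /\
     monoidally_equivalent (fdRepCat ha) (fdRepCat hs)) /\
    (exists U_inv : Ua,
       inverse_of U U_inv /\
       (forall x : Us, U * hS ha (sigma x) * U_inv = sigma (hS hs x))).
Proof.
move=> q UA US B F C E k k' K F1 F2 phi1 phi2 K1 K2 K2' Phi U.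
have qp : q ^+ p = -1 := qroot_expr R hp.
have qq : forall j, (0 < j < p)%N -> (q * q) ^+ j != 1 := qroot_prim R hp.
have sat_a := @Ua_gen_sat _ p q xi hp; have sat_s := @Us_gen_sat _ p q xi hp.
have gen_a := @Ua_generates _ p q xi hp; have gen_s := @Us_generates _ p q xi hp.
have [ha [haD hae haS haSM haS1]] :=
  Ua_hopf hxi hp qp qq sat_a gen_a (@Ua_lift _ p q xi hp).
have [f hf] := Us_lift hp (sigma_sat hxi hp qp qq sat_a).
have [g hg] := Ua_lift hp (sigma_inv_sat hxi hp qp qq sat_s).
have [hs [hsD hse hsS hPhi [hU heq]]] :=
  Us_twist hxi hp qp qq sat_a sat_s gen_a gen_s hf hg haD hae haSM haS1 haS.
exists ha, hs, f, g; split.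
  by split; split; rewrite ?haD ?hae ?haS /= ?tinM.
split.
  by split; split; rewrite ?hsD ?hse ?hsS /= ?tinM.
split.
  split; first exact: (sigma_cancel hxi hp qp qq sat_s gen_s hf hg).
  split; first exact: (sigma_inv_cancel hxi hp qp qq sat_a gen_a hf hg).
  by do ![split]; rewrite ?hf ?hg.
split.
  exists (twist_elt_inv q (Ua_gen q xi hp)); split.
    split; first exact: (twist_eltK hxi hp qp sat_a).
    exact: (twist_elt_invK hxi hp qp sat_a).
  split; last exact: hPhi.
  exact: (twist_elt_cocycle hxi hp qp qq sat_a haD hae).
split; first exact: heq.
exists (antipode_elt_inv q (Ua_gen q xi hp)); split; last exact: hU.
split; first exact: (antipode_eltK hxi hp qp qq sat_a).
exact: (antipode_elt_invK hxi hp qp qq sat_a).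
Qed.
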